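(* Let $k$ be an algebraically closed field of characteristic $2$, and let $B$ be an algebraic variety over $k$ equipped with four regular functions $a,b,c,e\in k[B]$ such that $c\ne0$, $e\ne0$ and $b\notin k(B)^2$. With the notation of the context, the fibration $\Phi_{B_c}:T_{B_c}\to B_c$ by quartic curves admits a cover by the elliptic fibration $\varepsilon_{B'_{c'}}:E_{B'_{c'}}\to B'_{c'}$. This cover is purely inseparable of exponent one on the bases but birational on the fibres. More precisely, there is a commutative diagram \[ \begin{array}{ccccc} E_{B'_{c'}} & \longrightarrow & T_{B_c} & \longrightarrow & E_{B_c}\\ \downarrow{\scriptstyle\varepsilon} & & \downarrow{\scriptstyle\Phi} & & \downarrow{\scriptstyle\varepsilon}\\ B'_{c'} & \overset{\varphi}{\longrightarrow} & B_c & \overset{id}{\longrightarrow} & B_c \end{array} \] where the morphism on the left-hand side is given on the bases by the bijective purely inseparable Frobenius morphism $\varphi$ and on the fibres by bijective birational morphisms $E_{(\bar a^{1/2},(\bar c\bar e)^{1/2})}\to Q_{(\bar a,\bar b,\bar c,\bar e)}$ (with $\bar a=a(P)$, $\bar b=b(P)$, $\bar c=c(P)$, $\bar e=e(P)$). It assigns to a point $P'\in B'_{c'}$ the point $P:=\varphi(P')\in B_c$, and to each point $((\bar x':\bar y':\bar z'),P')$ of the fibre over $P'$ the point \[ \begin{cases}((\bar x'^2:\bar y'^2:b'(P')\bar y'^2+a'(P')b'(P')\bar x'^2+c'(P')\bar x'\bar z'),P) & \text{if }(\bar x':\bar y':\bar z')\ne(0:0:1),\\((0:e'(P'):1+b'(P')e'(P')),P)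 & \text{if }(\bar x':\bar y':\bar z')=(0:0:1).\end{cases} \] In contrast, the morphism on the right-hand side leaves the points of the base fixed and is given on the fibres by the bijective purely inseparable degree-two morphism \[ (\bar x:\bar y:\bar z)\mapsto\begin{cases}(c(P)\bar x^2:c(P)\bar x\bar y:\bar z^2+b(P)\bar y^2+a(P)b(P)\bar x^2) & \text{if }(\bar x:\bar y:\bar z)\ne(0:1:b(P)^{1/2}),\\(0:1:0) & \text{if }(\bar x:\bar y:\bar z)=(0:1:b(P)^{1/2}).\end{cases} \] The composite horizontal morphisms are Frobenius morphisms that raise coordinates to their second powers.
   Context: For $\bar a,\bar b,\bar c,\bar e,\bar\eta\in k$: $Q_{(\bar a,\bar b,\bar c,\bar e)}\subset\mathbb P^2$ is the quartic $\bar c\bar x^4+(\bar z^2+\bar b\bar y^2+\bar a\bar b\bar x^2)(\bar e(\bar z^2+\bar b\bar y^2+\bar a\bar b\bar x^2)+(\bar y^2+\bar x\bar y+\bar a\bar x^2))=0$, and $E_{(\bar a,\bar\eta)}\subset\mathbb P^2$ is the cubic $\bar y^2\bar z+\bar x\bar y\bar z=\bar x^3+\bar a\bar x^2\bar z+\bar\eta\bar x\bar z^2$. $T_B\subset\mathbb P^2\times B$ is the variety of pairs $((\bar x:\bar y:\bar z),P)$ with $(\bar x:\bar y:\bar z)\in Q_{(a(P),b(P),c(P),e(P))}$, and $\Phi_B:T_B\to B$ is the second projection. $E_B\subset\mathbb P^2\times B$ is the variety of pairs with $(\bar x:\bar y:\bar z)\in E_{(a(P),c(P)e(P))}$, and $\varepsilon_B:E_B\to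 B$ is the second projection. $B_c=\{P\in B\mid c(P)\ne0\}$, and $\Phi_{B_c},\varepsilon_{B_c}$ are the restrictions to the base $B_c$. The Frobenius pushforward $B'$ of $B$ is the scheme $B$ with structure morphism $B\to\mathrm{Spec}(k)$ replaced by its composite with the absolute Frobenius $\mathrm{Spec}(k)\to\mathrm{Spec}(k)$; the absolute Frobenius of $B$ then becomes a $k$-morphism $\varphi:B'\to B$. The local sections of the structure sheaf of $B'$ are the square roots of local sections of that of $B$. (If $B\subset\mathbb A^n$ is closed with ideal $I(B)$, then $B'=\{(x_1,\dots,x_n)\mid h(x_1^2,\dots,x_n^2)=0\ \forall h\in I(B)\}$ and $\varphi(x_1,\dots,x_n)=(x_1^2,\dots,x_n^2)$.) $B'$ is equipped with the regular functions $a',b',c',e'$ determined by $a'^2=a\circ\varphi$, $b'^2=b\circ\varphi$, $c'^2=c\circ\varphi$, $e'^2=e\circ\varphi$, i.e. $a'(P')=a(\varphi(P'))^{1/2}$ and so on. $E_{B'}\subset\mathbb P^2\times B'$ is the variety of pairs $((\bar x':\bar y':\bar z'),P')$ with $\bar y'^2\bar z'+\bar x'\bar y'\bar z'=\bar x'^3+a'(P')\bar x'^2\bar z'+c'(P')e'(P')\bar x'\bar z'^2$, and $\varepsilon_{B'}:E_{B'}\to B'$ is the second projection; $B'_{c'}=\{P'\in B'\mid c'(P')\ne0\}$. Varieties are integral; an elliptic fibration here is one whose general fibres are elliptic curves. *)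

(* Defs.v *)
From HB Require Import structures.
From mathcomp Require Import all_boot all_order all_algebra.
From mathcomp Require Import boolp classical_sets.
From mathcomp Require Import mpoly.

Set Implicit Arguments.
Unset Strict Implicit.
Unset Printing Implicit Defensive.

Import GRing.Theory.

Local Open Scope classical_set_scope.
Local Open Scope ring_scope.

(** Varieties over an algebraically closed field are treated as spaces with
    functions.  A variety is represented by its set of closed points, its Zariski
    topology, and, for every open [U], the [k]-valued functions regular on
    [U].  Functions are total on the space; only their values on [U] matter
    in [regular U]. *)

Record fspace (k : fieldType) := FSpace {
  points :> Type;
  is_open : set points -> Prop;
  regular : set points -> (points -> k) -> Prop }.

Section Spaces.
Variable k : fieldType.
Implicit Types X Y Z : fspace k.

Definition is_closed X (S : set X) := is_open (~` S).

Definition irreducible X :=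
  [set: X] !=set0 /\
  forall U V : set X, is_open U -> is_open V ->
    U !=set0 -> V !=set0 -> (U `&` V) !=set0.

Definition topology_axioms X :=
  [/\ is_open [set: X],
      forall U V : set X, is_open U -> is_open V -> is_open (U `&` V) &
      forall A : set (set X), (forall U, A U -> is_open U) ->
        is_open (\bigcup_(U in A) U)].

Definition sheaf_axioms X :=
  (forall (U : set X) (f g : X -> k), is_open U ->
     (forall x, U x -> f x = g x) -> regular U f -> regular U g) /\
  (forall (U : set X) (f : X -> k), is_open U ->
     (regular U f <->
      forall x, U x -> exists V : set X,
        [/\ is_open V, V x, V `<=` U & regular V f])).

Definition morphism X Y (f : X -> Y) :=
  forall U : set Y, is_open U ->
    is_open (f @^-1` U) /\
    forall g : Y -> k, regular U g -> regular (f @^-1` U) (g \o f).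

Definition isomorphism X Y (f : X -> Y) :=
  morphism f /\ exists g : Y -> X, [/\ morphism g, cancel f g & cancel g f].

Definition isomorphic X Y := exists f : X -> Y, isomorphism f.

Definition subspace X (S : set X) : fspace k :=
  @FSpace k (set_type S)
    (fun W => exists2 U : set X, is_open U & W = [set x | U (val x)])
    (fun W f => forall x, W x ->
       exists U : set X, exists g : X -> k,
         [/\ is_open U, U (val x), regular U g &
             forall y, W y -> U (val y) -> f y = g (val y)]).

Definition affine_space n : fspace k :=
  @FSpace k 'rV[k]_n
    (fun W => exists I : set {mpoly k[n]},
       W = [set x | exists2 p, I p & p.@[x 0] != 0])
    (fun W f => forall x, W x ->
       exists p q : {mpoly k[n]}, q.@[x 0] != 0 /\
         forall y, W y -> q.@[y 0] != 0 -> f y = p.@[y 0] / q.@[y 0]).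

Definition affine X :=
  exists n, exists I : set {mpoly k[n]},
    isomorphic X
      (subspace ([set x | forall p, I p -> p.@[x 0] = 0] :
                   set (affine_space n))).

(** Projective space: its points are the lines of [k^(n+1)]. *)
Definition proj_point n :=
  {U : {vspace 'rV[k]_n.+1} | \dim U == 1%N}.

(** Value of a homogeneous polynomial at some homogeneous coordinates of [p];
    its vanishing, and quotients of such values in equal degrees, do not
    depend on the coordinates. *)
Definition proj_eval n (F : {mpoly k[n.+1]}) (p : proj_point n) : k :=
  F.@[vpick (val p) 0].

Definition proj_space n : fspace k :=
  @FSpace k (proj_point n)
    (fun W => exists I : set {mpoly k[n.+1]},
       (forall F, I F -> exists d, F \is d.-homog) /\
       W = [set p | exists2 F, I F & proj_eval F p != 0])
    (fun W f => forall p, W p ->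
       exists d, exists F G : {mpoly k[n.+1]},
         [/\ F \is d.-homog, G \is d.-homog, proj_eval G p != 0 &
             forall q, W q -> proj_eval G q != 0 ->
               f q = proj_eval F q / proj_eval G q]).

(** Products: on [U * V] one has the functions [\sum_i f_i(x) g_i(y)]; their
    non-vanishing loci form a basis of the topology, and regular functions are
    locally quotients of them. *)
Definition tensor_fun X Y (U : set X) (V : set Y) (h : X * Y -> k) :=
  exists n, exists f : 'I_n -> X -> k, exists g : 'I_n -> Y -> k,
    [/\ forall i, regular U (f i), forall i, regular V (g i) &
        forall xy, h xy = \sum_(i < n) f i xy.1 * g i xy.2].

Definition prod_space X Y : fspace k :=
  @FSpace k (X * Y)%type
    (fun W => forall xy, W xy ->
       exists U : set X, exists V : set Y, exists h : X * Y -> k,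
         [/\ is_open U /\ is_open V, U xy.1 /\ V xy.2, tensor_fun U V h,
             h xy != 0 &
             forall st, U st.1 -> V st.2 -> h st != 0 -> W st])
    (fun W f => forall xy, W xy ->
       exists U : set X, exists V : set Y, exists h1 h2 : X * Y -> k,
         [/\ is_open U /\ is_open V, U xy.1 /\ V xy.2,
             tensor_fun U V h1 /\ tensor_fun U V h2, h2 xy != 0 &
             forall st, W st -> U st.1 -> V st.2 -> h2 st != 0 ->
               f st = h1 st / h2 st]).

Definition separated X :=
  @is_closed (prod_space X X) [set xy | xy.1 = xy.2].

Definition variety X :=
  [/\ topology_axioms X, sheaf_axioms X, irreducible X, separated X &
      exists n, exists U : 'I_n -> set X,
        (forall i, is_open (U i) /\ affine (subspace (U i))) /\
        forall x, exists i, U i x].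

(** The function field of an irreducible [X] consists of the functions that
    are regular on some non-empty open set, modulo equality on some non-empty
    open set. *)

Definition rational X (f : X -> k) :=
  exists U : set X, [/\ is_open U, U !=set0 & regular U f].

Definition gen_eq X (f g : X -> k) :=
  exists U : set X, [/\ is_open U, U !=set0 & forall x, U x -> f x = g x].

Definition is_square_in_function_field X (f : X -> k) :=
  exists2 g : X -> k, rational g & gen_eq f (fun x => g x ^+ 2).

Definition dominant X Y (f : X -> Y) :=
  forall V : set Y, is_open V -> V !=set0 -> (f @^-1` V) !=set0.

Definition birational X Y (f : X -> Y) :=
  [/\ irreducible X, irreducible Y, morphism f &
      exists U : set X, exists V : set Y,
        [/\ is_open U, is_open V, U !=set0, V !=set0 &
            exists2 fUV : subspace U -> subspace V,
              isomorphism fUV & forall u, val (fUV u) = f (val u)]].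

(** The extension [k(X) / f^* k(Y)] has degree [d]: it has a basis [u]. *)
Definition has_degree X Y (f : X -> Y) (d : nat) :=
  exists u : 'I_d -> X -> k,
    [/\ forall i, rational (u i),
        forall g : X -> k, rational g ->
          exists2 h : 'I_d -> Y -> k, forall i, rational (h i) &
            gen_eq g (fun x => \sum_(i < d) h i (f x) * u i x) &
        forall h : 'I_d -> Y -> k, (forall i, rational (h i)) ->
          gen_eq (fun x => \sum_(i < d) h i (f x) * u i x) (fun=> 0) ->
          forall i, gen_eq (h i) (fun=> 0)].

(** Characteristic 2: [g^(2^m)] lies in [f^* k(Y)]. *)
Definition power_descends X Y (f : X -> Y) (m : nat) (g : X -> k) :=
  exists2 h : Y -> k, rational h &
    gen_eq (fun x => g x ^+ (2 ^ m)) (h \o f).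

Definition purely_inseparable X Y (f : X -> Y) :=
  [/\ irreducible X, irreducible Y, morphism f, dominant f &
      forall g : X -> k, rational g -> exists m, power_descends f m g].

Definition has_exponent X Y (f : X -> Y) (m : nat) :=
  (forall g : X -> k, rational g -> power_descends f m g) /\
  forall m', (m' < m)%N ->
    ~ forall g : X -> k, rational g -> power_descends f m' g.

(** In characteristic 2, the Frobenius pushforward has the same points and the same topology.
    Composing the structure morphism with the Frobenius of [k] replaces the
    value of a section at a point by its square root, so the regular
    functions are the square roots of the regular functions of [X], and the
    absolute Frobenius is the identity on points. *)

Definition frob_push X : fspace k :=
  @FSpace k (points X) (@is_open k X)
    (fun U f => regular U (fun x => f x ^+ 2)).

Definition frob X : frob_push X -> X := fun x => x.

(** Up to an isomorphism of the source, [f] is the Frobenius of [Y]. *)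
Definition is_frobenius X Y (f : X -> Y) :=
  exists2 g : X -> frob_push Y, isomorphism g & forall x, f x = frob (g x).

Definition vec3 (x y z : k) : 'rV[k]_3 := \row_i [:: x; y; z]`_i.

Definition P2 : fspace k := proj_space 2.

(** [p = (x : y : z)]; this includes [(x, y, z) != 0]. *)
Definition has_coords (p : P2) (x y z : k) :=
  vec3 x y z != 0 /\ val p = <[vec3 x y z]>%VS.

Definition plane_curve (F : {mpoly k[3]}) : fspace k :=
  subspace ([set p | proj_eval F p = 0] : set P2).

(** A smooth plane cubic, by the Jacobian criterion. *)
Definition elliptic_cubic (F : {mpoly k[3]}) :=
  F \is 3.-homog /\
  forall p : P2, proj_eval F p = 0 -> exists i, proj_eval F^`M(i) p != 0.

Definition total_set Y (F : Y -> {mpoly k[3]}) : set (prod_space P2 Y) :=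
  [set pP | proj_eval (F pP.2) pP.1 = 0].

Definition total_space Y (F : Y -> {mpoly k[3]}) : fspace k :=
  subspace (total_set F).

Definition proj_base Y (F : Y -> {mpoly k[3]}) (w : total_space F) : Y := (val w).2.

Definition plane_fibration (d : nat) Y (F : Y -> {mpoly k[3]}) :=
  [/\ forall y, F y != 0 /\ F y \is d.-homog,
      is_closed (total_set F), irreducible (total_space F),
      morphism (@proj_base Y F) & forall y, exists w : total_space F, proj_base w = y].

Definition elliptic_fibration Y (F : Y -> {mpoly k[3]}) :=
  plane_fibration 3 F /\
  exists U : set Y,
    [/\ is_open U, U !=set0 & forall y, U y -> elliptic_cubic (F y)].

(** [f] maps the fibre [C] over [y] to the fibre [D] over [z], by [g]. *)
Definition induces_on_fibres Y Z (F : Y -> {mpoly k[3]})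
    (G : Z -> {mpoly k[3]}) (f : total_space F -> total_space G) (y : Y) (z : Z)
    (C D : {mpoly k[3]}) (g : plane_curve C -> plane_curve D) :=
  forall p : plane_curve C, exists w : total_space F,
    val w = (val p, y) /\ val (f w) = (val (g p), z).

Definition quartic (a b c e : k) : {mpoly k[3]} :=
  let x := 'X_(@Ordinal 3 0 isT) in
  let y := 'X_(@Ordinal 3 1 isT) in
  let z := 'X_(@Ordinal 3 2 isT) in
  let w := z ^+ 2 + b *: y ^+ 2 + (a * b) *: x ^+ 2 in
  c *: x ^+ 4 + w * (e *: w + (y ^+ 2 + x * y + a *: x ^+ 2)).

Definition cubic (a eta : k) : {mpoly k[3]} :=
  let x := 'X_(@Ordinal 3 0 isT) in
  let y := 'X_(@Ordinal 3 1 isT) in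
  let z := 'X_(@Ordinal 3 2 isT) in
  y ^+ 2 * z + x * y * z
    - (x ^+ 3 + a *: (x ^+ 2 * z) + eta *: (x * z ^+ 2)).

End Spaces.

Lemma sqrt_exists (k : closedFieldType) (t : k) : exists s : k, s ^+ 2 == t.
Proof.
have [s sE] := @solve_monicpoly k 2 (nth 0 [:: t]) isT.
exists s; apply/eqP; rewrite sE big_ord_recr big_ord1 /=.
by rewrite mulr1 mul0r addr0.
Qed.

(** In characteristic 2 this is the unique square root. *)
Definition root2 (k : closedFieldType) (t : k) : k := xchoose (sqrt_exists t).

Lemma root2K (k : closedFieldType) (t : k) : root2 t ^+ 2 = t.
Proof. exact/eqP/(xchooseP (sqrt_exists t)). Qed.

(* Main.v *)
Require Import Defs.
From HB Require Import structures.
From mathcomp Require Import all_boot all_order all_algebra.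
From mathcomp Require Import boolp classical_sets.
From mathcomp Require Import mpoly.
From mathcomp Require Import ring zify.

Set Implicit Arguments.
Unset Strict Implicit.
Unset Printing Implicit Defensive.

Import GRing.Theory.

Local Open Scope classical_set_scope.
Local Open Scope ring_scope.

(** In characteristic 2 put w = z^2 + b y^2 + ab x^2, the square of a linear
    form, and v = e w + y^2 + xy + a x^2; the quartic reads w v = c x^4.  Hence
    (x : y : z) |-> (c x^2 : c x y : w) maps the quartic to the cubic with
    parameters (a, ce): substitution in the cubic equation gives c^2 x^2 times
    the quartic equation.  Conversely, with square roots a', b', c', e' of the
    parameters, substitution of (x^2 : y^2 : b'y^2 + a'b'x^2 + c'xz) in the
    quartic equation gives the square of c'x times the equation of the cubic
    with parameters (a', c'e').  The composite squares all coordinates.  Each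
    map degenerates at one point of the curve, where multiplication by a
    suitable function and division by a common factor give another expression
    ([left_chart], [right_chart]).  Both are bijective because a point with
    x = 1 is recovered by square roots and division, and each curve has just
    two points with x = 0.

    On a fibre, z is a rational function of the image (1 : Y : Z) under the
    first map, and so is y, because the cubic equation expresses y through z
    and y^2; thus this map is birational.  The second map adjoins z/x to the
    function field of the cubic; the square of z/x lies in that field, and
    z/x does not, because c x is not a square there
    ([cubic_square_class]), by the parity of degrees in k[x].  So the degree
    is two.

    For the geometry of the total spaces, everything is expressed through
    germs of functions at points: a map into a subspace, a product, the plane
    or a Frobenius pushforward is a morphism as soon as it is so locally
    ([into_subspace], [pair_local_morphism], [into_plane],
    [into_frob_subspace]).  The families of cubics are irreducible since
    projection to the base sends basic open sets to sets that contain
    non-empty open sets, and the fibres are irreducible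
    ([cubic_family_irreducible]).  The latter is seen on the chart z = 1, where
    the cubic is a quadratic extension of the line: a form becomes
    A(x) + B(x) y, and its norm to k[x] vanishes only if A = B = 0.  The
    quartic families are images of families of cubics.

    On the bases, the morphism is the Frobenius morphism between open
    subspaces.  Its exponent is one and not zero, because the square root of b
    would otherwise descend and make b a square in the function field. *)

(** * Germs of regular functions *)

Section Germs.
Variable k : fieldType.
Implicit Types X Y Z : fspace k.

Definition nearby X (x : X) (W : set X) :=
  exists V : set X, [/\ is_open V, V x & V `<=` W].

(** The sheaf axioms do not let regular functions be restricted to smaller
    open sets, so the domain [U] of [g] and the neighbourhood on which [f]
    agrees with [g] are two different sets. *)
Definition germ X (x : X) (f : X -> k) :=
  exists U : set X, exists g : X -> k,
    [/\ is_open U, U x, regular U g & nearby x [set y | f y = g y]].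

(** The part of the properties of a variety that is preserved by subspaces,
    products and Frobenius pushforwards. *)
Record local_rings X : Prop := LocalRings {
  lr_top : topology_axioms X;
  germ_cst : forall (x : X) (t : k), germ x (fun=> t);
  germD : forall (x : X) f g,
    germ x f -> germ x g -> germ x (fun y => f y + g y);
  germM : forall (x : X) f g,
    germ x f -> germ x g -> germ x (fun y => f y * g y);
  germV : forall (x : X) f, germ x f -> f x != 0 -> germ x (fun y => (f y)^-1);
  germ_neq0 : forall (x : X) f,
    germ x f -> f x != 0 -> nearby x [set y | f y != 0] }.

Definition sheaf_of_germs X :=
  forall (U : set X) f, is_open U ->
    (regular U f <-> forall x, U x -> germ x f).

Definition ringed X := local_rings X /\ sheaf_of_germs X.

Definition local_morphism X Y (f : X -> Y) (x : X) :=
  (forall V : set Y, is_open V -> V (f x) -> nearby x (f @^-1` V)) /\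
  (forall g : Y -> k, germ (f x) g -> germ x (g \o f)).

Section Topology.
Variable X : fspace k.
Hypothesis topX : topology_axioms X.

Lemma open_setT : is_open [set: X]. Proof. by case: topX. Qed.

Lemma open_setI (U V : set X) : is_open U -> is_open V -> is_open (U `&` V).
Proof. by case: topX => _ h _; apply: h. Qed.

Lemma openP (W : set X) : is_open W <-> forall x, W x -> nearby x W.
Proof.
split=> [oW x Wx|h]; first by exists W; split.
case: topX => _ _ /(_ [set V | is_open V /\ V `<=` W]) hU.
suff -> : W = \bigcup_(V in [set V | is_open V /\ V `<=` W]) V.
  by apply: hU => U [].
apply/seteqP; split=> [x /h [V [oV Vx VW]]|x [V [_ VW] /VW //]].
by exists V.
Qed.

Lemma nearbyS (x : X) (V W : set X) : V `<=` W -> nearby x V -> nearby x W.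
Proof. by move=> VW [U [oU Ux UV]]; exists U; split=> // y /UV /VW. Qed.

Lemma nearbyI (x : X) (V W : set X) :
  nearby x V -> nearby x W -> nearby x (V `&` W).
Proof.
move=> [U [oU Ux UV]] [U' [oU' Ux' UW]]; exists (U `&` U').
split=> //; first exact: open_setI.
by move=> y [/UV ? /UW].
Qed.

Lemma nearby_point (x : X) (W : set X) : nearby x W -> W x.
Proof. by case=> V [_ Vx VW]; apply: VW. Qed.

Lemma nearby_open (x : X) (W : set X) : is_open W -> W x -> nearby x W.
Proof. by move=> oW Wx; exists W; split. Qed.

Lemma nearby_all (x : X) (W : set X) : (forall y, W y) -> nearby x W.
Proof. by move=> h; exists [set: X]; split=> //; apply: open_setT. Qed.

Lemma germ_ext (x : X) f g : f =1 g -> germ x g -> germ x f.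
Proof. by move=> /funext ->. Qed.

Lemma germ_eq (x : X) f g :
  nearby x [set y | f y = g y] -> germ x g -> germ x f.
Proof.
move=> fg [U [h [oU Ux rh gh]]]; exists U, h; split=> //.
by apply: nearbyS (nearbyI fg gh) => y [/= -> ->].
Qed.

Lemma germ_regular (U : set X) f (x : X) :
  is_open U -> regular U f -> U x -> germ x f.
Proof. by move=> oU rf Ux; exists U, f; split=> //; apply: nearby_all. Qed.

Lemma local_morphism_nearby Y (f : X -> Y) (x : X) (W : set Y) :
  local_morphism f x -> nearby (f x) W -> nearby x (f @^-1` W).
Proof.
move=> [h _] [V [oV Vx VW]]; apply: nearbyS (h _ oV Vx) => y /=.
exact: VW.
Qed.

Lemma local_morphism_eq Y (f g : X -> Y) (x : X) :
  nearby x [set y | f y = g y] -> local_morphism g x -> local_morphism f x.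
Proof.
move=> fg [cg rg]; have fgx := nearby_point fg; split=> [V oV|h].
  rewrite fgx => /(cg _ oV) hV; apply: nearbyS (nearbyI fg hV) => y [/= -> //].
rewrite fgx => /rg; apply: germ_eq.
by apply: nearbyS fg => y /= ->.
Qed.

Lemma morphism_local Y (f : X -> Y) (x : X) :
  morphism f -> local_morphism f x.
Proof.
move=> mf; split=> [V oV Vx|g [U [h [oU Ux rh [V [oV Vx gh]]]]]].
  by exists (f @^-1` V); split=> //; case: (mf _ oV).
exists (f @^-1` U), (h \o f); have [oU' rU'] := mf _ oU; split=> //.
- exact: rU'.
- exists (f @^-1` V); split=> //; first by case: (mf _ oV).
  by move=> y /gh.
Qed.

End Topology.

Lemma local_morphismP X Y (f : X -> Y) :
  ringed X -> topology_axioms Y ->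
  (morphism f <-> forall x, local_morphism f x).
Proof.
move=> [lX sX] tY; have tX := lr_top lX.
split=> [mf x|h U oU]; first exact: morphism_local.
have oU' : is_open (f @^-1` U).
  by apply/(openP tX) => x Ux; have [+ _] := h x; apply.
split=> // g rg; apply/(sX _ _ oU') => x Ux.
by have [_] := h x; apply; apply: (germ_regular tY oU).
Qed.

Lemma local_morphism_comp X Y Z (g : Y -> Z) (f : X -> Y) (x : X) :
  topology_axioms X -> local_morphism f x -> local_morphism g (f x) ->
  local_morphism (g \o f) x.
Proof.
move=> tX lf [cg rg]; split=> [V oV /(cg _ oV)|h /rg]; last exact: (proj2 lf).
exact: local_morphism_nearby.
Qed.

Section LocalRings.
Variable X : fspace k.
Hypothesis lX : local_rings X.

Lemma germ_sum (x : X) (I : Type) (r : seq I) (P : pred I) (f : I -> X -> k) :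
  (forall i, P i -> germ x (f i)) -> germ x (fun y => \sum_(i <- r | P i) f i y).
Proof.
move=> hf; elim: r => [|i r IH].
  by apply: germ_ext _ (germ_cst lX x 0) => y; rewrite big_nil.
have e (y : X) : \sum_(j <- i :: r | P j) f j y =
    (if P i then f i y else 0) + \sum_(j <- r | P j) f j y.
  by rewrite big_cons; case: (P i); rewrite ?add0r.
apply: (germ_ext e).
apply: germD => //; case: (P i) (hf i) => [/(_ isT) //|_].
exact: germ_cst.
Qed.

Lemma germX (x : X) n f : germ x f -> germ x (fun y => f y ^+ n).
Proof.
move=> hf; elim: n => [|n IH].
  by apply: germ_ext _ (germ_cst lX x 1) => y; rewrite expr0.
by apply: germ_ext _ (germM lX hf IH) => y; rewrite exprS.
Qed.

Lemma germN (x : X) f : germ x f -> germ x (fun y => - f y).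
Proof.
move=> hf; by apply: germ_ext _ (germM lX (germ_cst lX x (-1)) hf) => y; rewrite mulN1r.
Qed.

Lemma germB (x : X) f g : germ x f -> germ x g -> germ x (fun y => f y - g y).
Proof. by move=> hf hg; apply: germD => //; apply: germN. Qed.

Lemma germ_div (x : X) f g :
  germ x f -> germ x g -> g x != 0 -> germ x (fun y => f y / g y).
Proof. by move=> hf hg g0; apply: germM => //; apply: germV. Qed.

Lemma germ_prod (x : X) (I : Type) (r : seq I) (f : I -> X -> k) :
  (forall i, germ x (f i)) -> germ x (fun y => \prod_(i <- r) f i y).
Proof.
move=> hf; elim: r => [|i r IH].
  by apply: germ_ext _ (germ_cst lX x 1) => y; rewrite big_nil.
by apply: germ_ext _ (germM lX (hf i) IH) => y; rewrite big_cons.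
Qed.

Lemma germ_meval (x : X) n (F : {mpoly k[n]}) (s : 'I_n -> X -> k) :
  (forall i, germ x (s i)) -> germ x (fun y => F.@[fun i => s i y]).
Proof.
move=> hs.
have e (y : X) : F.@[fun i => s i y] =
    \sum_(m <- msupp F) F@_m * \prod_i s i y ^+ m i by rewrite mevalE.
apply: (germ_ext e).
apply: germ_sum => m _; apply: germM => //; first exact: germ_cst.
by apply: germ_prod => i; apply: germX.
Qed.

End LocalRings.

(** * Subspaces *)

Section Subspaces.
Variables (X : fspace k) (S : set X).

Lemma subspace_top : topology_axioms X -> topology_axioms (subspace S).
Proof.
move=> tX; split=> [|_ _ [U oU ->] [V oV ->]|A hA].
- by exists setT => //; apply: open_setT.
- by exists (U `&` V) => //; apply: open_setI.
exists (\bigcup_(U in [set U | is_open U /\ A [set x : subspace S | U (val x)]]) U).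
  by case: tX => _ _; apply => U [].
apply/seteqP; split=> x [W]; last by case=> _ AW Wx; exists [set x : subspace S | W (val x)].
by move=> AW Wx; have [U oU e] := hA _ AW; subst W; exists U.
Qed.

Lemma subspace_nearby (x : subspace S) (W : set (subspace S)) :
  nearby x W <-> nearby (val x) [set y | forall w : subspace S, val w = y -> W w].
Proof.
split=> [[_ [[U oU ->] Ux UW]]|[U [oU Ux UW]]].
  exists U; split=> // y Uy w wy; apply: UW => /=; by rewrite wy.
exists [set w : subspace S | U (val w)]; split=> //; first by exists U.
by move=> w /UW; apply.
Qed.

Lemma val_local_morphism (x : subspace S) :
  topology_axioms X -> local_morphism (val : subspace S -> X) x.
Proof.
move=> tX; split=> [V oV Vx|g [U [h [oU Ux rh gh]]]].
  by exists [set w : subspace S | V (val w)]; split=> //; exists V.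
exists [set w : subspace S | U (val w)], (h \o val); split=> //.
- by exists U.
- by move=> w Uw; exists U, h; split.
- by apply/subspace_nearby; apply: nearbyS gh => y gy w wy /=; rewrite wy.
Qed.

(** Germs on a subspace are restrictions of germs of the ambient space, by the
    definition of its regular functions. *)
Lemma germ_subspace (x : subspace S) (f : subspace S -> k) :
  topology_axioms X ->
  germ x f <-> exists2 g, germ (val x) g & nearby x [set w | f w = g (val w)].
Proof.
move=> tX; have tS := subspace_top tX.
split=> [[U [h [oU Ux rh fh]]]|[g gx fg]]; last first.
  by apply: (germ_eq tS fg); apply: (proj2 (val_local_morphism x tX)).
have [V [g [oV Vx rg hg]]] := rh _ Ux.
exists g; first exact: (germ_regular tX oV).
have nU : nearby x U by exists U; split.
have nV : @nearby (subspace S) x [set w | V (val w)].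
  by exists [set w : subspace S | V (val w)]; split=> //; exists V.
apply: nearbyS (nearbyI tS (nearbyI tS nU nV) fh) => w [[Uw Vw] /= ->].
exact: hg.
Qed.

Lemma subspace_local_rings : local_rings X -> local_rings (subspace S).
Proof.
move=> lX; have tX := lr_top lX; have tS := subspace_top tX.
split=> //.
- move=> x t; apply/germ_subspace => //; exists (fun=> t).
    exact: germ_cst.
  exact: nearby_all.
- move=> x f g /(germ_subspace _ _ tX) [f' gf ff] /(germ_subspace _ _ tX) [g' gg fg].
  apply/germ_subspace => //; exists (fun y => f' y + g' y); first exact: germD.
  by apply: nearbyS (nearbyI tS ff fg) => w [/= -> ->].
- move=> x f g /(germ_subspace _ _ tX) [f' gf ff] /(germ_subspace _ _ tX) [g' gg fg].
  apply/germ_subspace => //; exists (fun y => f' y * g' y); first exact: germM.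
  by apply: nearbyS (nearbyI tS ff fg) => w [/= -> ->].
- move=> x f /(germ_subspace _ _ tX) [f' gf ff] fx.
  apply/germ_subspace => //; exists (fun y => (f' y)^-1).
    by apply: germV => //; rewrite -(nearby_point ff).
  by apply: nearbyS ff => w /= ->.
- move=> x f /(germ_subspace _ _ tX) [f' gf ff] fx.
  have : nearby (val x) [set y | f' y != 0].
    by apply: germ_neq0 => //; rewrite -(nearby_point ff).
  move/(local_morphism_nearby (val_local_morphism x tX)) => n0.
  by apply: nearbyS (nearbyI tS ff n0) => w [/= ->].
Qed.

Lemma subspace_sheaf : ringed X -> sheaf_of_germs (subspace S).
Proof.
move=> [lX sX]; have tX := lr_top lX; have tS := subspace_top tX.
move=> U f oU; split=> [rf x Ux|hf x Ux]; first exact: (germ_regular tS oU).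
have /(germ_subspace _ _ tX) [g gx fg] := hf x Ux.
have [V [h [oV Vx rh gh]]] := gx.
have /subspace_nearby [V' [oV' Vx' fV']] := fg.
have [W [oW Wx gW]] := gh.
exists (V `&` (V' `&` W)), h.
have oVW : is_open (V `&` (V' `&` W)) by do 2!apply: open_setI => //.
split=> //.
  by apply/sX => // y [Vy _]; apply: (germ_regular tX oV).
by move=> y Uy [_ [V'y Wy]]; rewrite (fV' _ V'y y erefl); apply: gW.
Qed.

(** When restriction is not available in the ambient space, the identity
    principle on an irreducible subspace replaces it: two functions that are
    regular at all points of an open set and agree somewhere locally agree
    on the whole of it. *)
Lemma subspace_sheaf_irreducible :
  local_rings X -> irreducible (subspace S) -> sheaf_of_germs (subspace S).
Proof.
move=> lX [_ irr]; have tX := lr_top lX; have tS := subspace_top tX.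
have lS := subspace_local_rings lX.
move=> U f oU; split=> [rf x Ux|hf x Ux]; first exact: (germ_regular tS oU).
have /(germ_subspace _ _ tX) [g [V [h [oV Vx rh gh]]] fg] := hf x Ux.
exists V, h; split=> // y Uy Vy; apply/eqP; rewrite -subr_eq0; apply: contrapT.
move/negP => ne.
have [W [oW Wx hW]] : @nearby (subspace S) x [set w | f w = h (val w)].
  move/(local_morphism_nearby (val_local_morphism x tX)): gh => gh.
  by apply: nearbyS (nearbyI tS fg gh) => w [/= ->].
have [W' [oW' Wy hW']] : @nearby (subspace S) y [set w | f w - h (val w) != 0].
  apply: germ_neq0 => //; apply: germB => //; first exact: hf.
  by apply/germ_subspace => //; exists h; [exact: (germ_regular tX oV)|exact: nearby_all].
have [w [/hW /= e /hW' /=]] := irr W W' oW oW' (ex_intro _ _ Wx) (ex_intro _ _ Wy).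
by rewrite e subrr eqxx.
Qed.

End Subspaces.

End Germs.

Section MapsIntoSubspaces.
Variable k : fieldType.
Implicit Types X Y : fspace k.

(** The functions regular on a subspace are locally restrictions, so it is
    enough to pull back germs from the ambient space. *)
Lemma into_subspace X Y (S : set Y) (f : X -> subspace S) (x : X) :
  topology_axioms X -> topology_axioms Y ->
  local_morphism (fun y => val (f y) : Y) x -> local_morphism f x.
Proof.
move=> tX tY [cf rf]; split=> [_ [V oV ->] Vx|g]; first exact: cf.
move/(germ_subspace _ _ tY) => [h /rf gh].
move/subspace_nearby => [V [oV Vx gV]].
apply: (germ_eq tX _ gh); apply: nearbyS (cf _ oV Vx) => y Vy /=.
exact: (gV _ Vy).
Qed.

Lemma germ_open_subspace X (U : set X) (x : subspace U) (f : X -> k) :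
  topology_axioms X -> is_open U ->
  germ (val x) f <-> @germ k (subspace U) x (fun w => f (val w)).
Proof.
move=> tX oU; split; first by case: (val_local_morphism x tX) => _; apply.
move/(germ_subspace _ _ tX) => [g gx /subspace_nearby fg].
apply: (germ_eq tX _ gx).
have nU : nearby (val x) U by exists U; split=> //; apply: set_valP.
apply: nearbyS (nearbyI tX fg nU) => y [h Uy].
exact: (h (exist _ y (mem_set Uy)) erefl).
Qed.

(** All the properties are local; the map [f] is a chart around [x], such as
    the inclusion of an open set or an isomorphism. *)
Lemma local_rings_transfer X : topology_axioms X ->
  (forall x : X, exists Y, exists f : Y -> X, exists y : Y,
     [/\ local_rings Y, f y = x,
         forall h, germ x h <-> germ y (h \o f) &
         forall W : set X, nearby y (f @^-1` W) -> nearby x W]) ->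
  local_rings X.
Proof.
move=> tX loc; split=> //.
- move=> x t; have [Y [f [y [lY _ gP _]]]] := loc x.
  by apply/gP; apply: germ_cst.
- move=> x h h'; have [Y [f [y [lY _ gP _]]]] := loc x.
  by move=> /gP gh /gP gh'; apply/gP; apply: germD gh gh'.
- move=> x h h'; have [Y [f [y [lY _ gP _]]]] := loc x.
  by move=> /gP gh /gP gh'; apply/gP; apply: germM gh gh'.
- move=> x h; have [Y [f [y [lY <- gP _]]]] := loc x.
  by move=> /gP gh h0; apply/gP; apply: germV gh h0.
- move=> x h; have [Y [f [y [lY <- gP nP]]]] := loc x.
  by move=> /gP gh h0; apply: nP; apply: germ_neq0 gh h0.
Qed.

Lemma isomorphic_local_rings X Y :
  topology_axioms X -> isomorphic X Y -> local_rings Y -> local_rings X.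
Proof.
move=> tX [f [mf [g [mg fK gK]]]] lY; have tY := lr_top lY.
apply: local_rings_transfer => // x; exists Y, g, (f x); split=> //.
- move=> h; split=> [gh|gh].
    by have [_] := morphism_local (f x) mg; apply; rewrite fK.
  apply: germ_ext _ (proj2 (morphism_local x mf) _ gh) => y /=.
  by rewrite fK.
- move=> W /(local_morphism_nearby (morphism_local x mf)).
  by apply: nearbyS => y /=; rewrite fK.
Qed.

Lemma local_rings_cover X : topology_axioms X ->
  (forall x : X, exists U : set X,
     [/\ is_open U, U x & local_rings (subspace U)]) ->
  local_rings X.
Proof.
move=> tX cov; apply: local_rings_transfer => // x.
have [U [oU Ux lU]] := cov x.
exists (subspace U), val, (exist _ x (mem_set Ux)); split=> //.
  by move=> h; apply: (germ_open_subspace (exist _ x (mem_set Ux) : subspace U)).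
move=> W /subspace_nearby hW.
have nU : nearby x U by exists U; split.
apply: nearbyS (nearbyI tX hW nU) => y [h Uy].
exact: (h (exist _ y (mem_set Uy)) erefl).
Qed.

End MapsIntoSubspaces.

(** * Spaces whose functions are fractions *)

(** Affine space, projective space and products share one construction: there
    is a stock of numerators, each with a domain and a degree, whose
    non-vanishing loci form a basis of the topology, and regular functions are
    locally quotients of numerators of equal degrees. *)
Section Fractions.
Variables (k : fieldType) (X : fspace k).
Variable num : set X -> nat -> (X -> k) -> Prop.

Hypothesis num_dom : forall D d F, num D d F -> num D 0 (fun=> 1).
Hypothesis numC : forall t, num [set: X] 0 (fun=> t).
Hypothesis numD : forall D D' d F G, num D d F -> num D' d G ->
  num (D `&` D') d (fun x => F x + G x).
Hypothesis numM : forall D D' d d' F G, num D d F -> num D' d' G ->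
  num (D `&` D') (d + d') (fun x => F x * G x).

Hypothesis open_num : forall W : set X, is_open W <->
  forall x, W x -> exists D d F,
    [/\ num D d F, D x, F x != 0 & forall y, D y -> F y != 0 -> W y].

Hypothesis regular_num : forall (W : set X) f, regular W f <->
  forall x, W x -> exists D D' d F G,
    [/\ num D d F, num D' d G, D x /\ D' x, G x != 0 &
        forall y, W y -> D y -> D' y -> G y != 0 -> f y = F y / G y].

Let fraction (x : X) (f : X -> k) := exists D D' d F G,
  [/\ num D d F, num D' d G, D x /\ D' x, G x != 0 &
      nearby x [set y | f y = F y / G y]].

Lemma fraction_top : topology_axioms X.
Proof.
split.
- apply/open_num => x _; exists setT, 0%N, (fun=> 1).
  by split=> //; rewrite oner_neq0.
- move=> U V /open_num oU /open_num oV; apply/open_num => x [Ux Vx].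
  have [D [d [F [nF Dx Fx hU]]]] := oU x Ux.
  have [D' [d' [G [nG Dx' Gx hV]]]] := oV x Vx.
  exists (D `&` D'), (d + d')%N, (fun x => F x * G x); split=> //.
  + exact: numM.
  + by rewrite mulf_neq0.
  + move=> y [Dy Dy']; rewrite mulf_eq0 negb_or => /andP[Fy Gy].
    by split; [apply: hU|apply: hV].
move=> A oA; apply/open_num => x [U AU Ux].
have /open_num/(_ x Ux) [D [d [F [nF Dx Fx hU]]]] := oA U AU.
exists D, d, F; split=> // y Dy Fy; exists U => //; exact: hU.
Qed.

Lemma nearby_num (x : X) D d F : num D d F -> D x -> F x != 0 ->
  nearby x [set y | D y /\ F y != 0].
Proof.
move=> nF Dx Fx; exists [set y | D y /\ F y != 0]; split=> //.
by apply/open_num => y [Dy Fy]; exists D, d, F.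
Qed.

Lemma nearby_dom (x : X) D d F : num D d F -> D x -> nearby x D.
Proof.
move=> /num_dom nD Dx.
by apply: nearbyS (nearby_num nD Dx (oner_neq0 _)) => y [].
Qed.

Lemma germ_fraction (x : X) f : germ x f <-> fraction x f.
Proof.
have tX := fraction_top; split.
  move=> [U [g [oU Ux /regular_num/(_ x Ux)]]].
  move=> [D [D' [d [F [G [nF nG [Dx Dx'] Gx gE]]]]]] fg.
  exists D, D', d, F, G; split=> //.
  have nU : nearby x U by exists U; split.
  apply: nearbyS (nearbyI tX (nearbyI tX nU fg)
    (nearbyI tX (nearby_dom nF Dx) (nearby_num nG Dx' Gx))).
  by move=> y [[Uy /= ->] [Dy [Dy' Gy]]]; apply: gE.
move=> [D [D' [d [F [G [nF nG [Dx Dx'] Gx fE]]]]]].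
have [U [oU Ux hU]] := nearbyI tX (nearby_dom nF Dx) (nearby_num nG Dx' Gx).
exists U, (fun y => F y / G y); split=> //.
apply/regular_num => y /hU [Dy [Dy' Gy]].
by exists D, D', d, F, G.
Qed.

Lemma fraction_ringed : ringed X.
Proof.
have tX := fraction_top; split; first split=> //.
- move=> x t; apply/germ_fraction; exists setT, setT, 0%N, (fun=> t), (fun=> 1).
  split=> //; first by rewrite oner_neq0.
  by apply: nearby_all => // y /=; rewrite divr1.
- move=> x f g /germ_fraction [D1 [D2 [d [F [G [nF nG [D1x D2x] Gx fE]]]]]].
  move=> /germ_fraction [D3 [D4 [d' [F' [G' [nF' nG' [D3x D4x] Gx' gE]]]]]].
  apply/germ_fraction.
  exists ((D1 `&` D4) `&` (D3 `&` D2)), (D2 `&` D4), (d + d')%N.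
  exists (fun x => F x * G' x + F' x * G x), (fun x => G x * G' x); split=> //.
  + by apply: numD; [exact: numM|rewrite addnC; exact: numM].
  + exact: numM.
  + by rewrite mulf_neq0.
  + apply: nearbyS (nearbyI tX (nearbyI tX fE gE)
      (nearbyI tX (nearby_num nG D2x Gx) (nearby_num nG' D4x Gx'))).
    by move=> y [[/= -> ->] [[_ Gy] [_ Gy']]]; rewrite addf_div.
- move=> x f g /germ_fraction [D1 [D2 [d [F [G [nF nG [D1x D2x] Gx fE]]]]]].
  move=> /germ_fraction [D3 [D4 [d' [F' [G' [nF' nG' [D3x D4x] Gx' gE]]]]]].
  apply/germ_fraction.
  exists (D1 `&` D3), (D2 `&` D4), (d + d')%N.
  exists (fun x => F x * F' x), (fun x => G x * G' x); split=> //.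
  + exact: numM.
  + exact: numM.
  + by rewrite mulf_neq0.
  + by apply: nearbyS (nearbyI tX fE gE) => y [/= -> ->]; rewrite mulf_div.
- move=> x f /germ_fraction [D1 [D2 [d [F [G [nF nG [D1x D2x] Gx fE]]]]]] fx.
  have Fx : F x != 0.
    by apply: contraNneq fx => Fx0; rewrite (nearby_point fE) Fx0 mul0r.
  apply/germ_fraction; exists D2, D1, d, G, F; split=> //.
  by apply: nearbyS fE => y /= ->; rewrite invf_div.
- move=> x f /germ_fraction [D1 [D2 [d [F [G [nF nG [D1x D2x] Gx fE]]]]]] fx.
  have Fx : F x != 0.
    by apply: contraNneq fx => Fx0; rewrite (nearby_point fE) Fx0 mul0r.
  apply: nearbyS (nearbyI tX fE
    (nearbyI tX (nearby_num nF D1x Fx) (nearby_num nG D2x Gx))).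
  by move=> y [/= -> [[_ Fy] [_ Gy]]]; rewrite mulf_neq0 ?invr_eq0.
move=> U f oU; split=> [rf x Ux|hf]; first exact: (germ_regular tX oU).
apply/regular_num => x Ux.
have /germ_fraction [D1 [D2 [d [F [G [nF nG [D1x D2x] Gx fE]]]]]] := hf x Ux.
have [W [/open_num oW Wx hW]] := fE.
have [E [e [K [nK Ex Kx hK]]]] := oW x Wx.
exists (D1 `&` E), (D2 `&` E), (d + e)%N, (fun x => F x * K x), (fun x => G x * K x).
split=> //; try exact: numM; first by rewrite mulf_neq0.
move=> y Uy [_ Ey] _; rewrite mulf_eq0 negb_or => /andP[Gy Ky].
by rewrite (hW _ (hK _ Ey Ky)) -mulf_div divff // mulr1.
Qed.

End Fractions.

Section AffineProjective.
Variable k : fieldType.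

Lemma affine_space_ringed n : ringed (affine_space k n).
Proof.
pose num (D : set (affine_space k n)) (d : nat) (F : affine_space k n -> k) :=
  D = setT /\ exists p : {mpoly k[n]}, F = fun x => p.@[x 0].
apply: (@fraction_ringed _ _ num).
- by move=> D d F [-> _]; split=> //; exists 1; apply/funext => x; rewrite meval1.
- by move=> t; split=> //; exists t%:MP; apply/funext => x; rewrite mevalC.
- move=> D D' d _ _ [-> [p ->]] [-> [q ->]]; rewrite setIT; split=> //.
  by exists (p + q); apply/funext => x; rewrite mevalD.
- move=> D D' d d' _ _ [-> [p ->]] [-> [q ->]]; rewrite setIT; split=> //.
  by exists (p * q); apply/funext => x; rewrite mevalM.
- move=> W; split=> [[I ->] x [p Ip px]|hW].
    exists setT, 0%N, (fun x : 'rV_n => p.@[x 0]); split=> //; first by split=> //; exists p.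
    by move=> y _ py; exists p.
  exists [set p : {mpoly k[n]} | forall y : 'rV_n, p.@[y 0] != 0 -> W y].
  apply/seteqP; split=> [x Wx|x [p /= h /h //]].
  have [D [d [_ [[-> [p ->]] _ px h]]]] := hW x Wx.
  by exists p => // y; apply: h.
move=> W f; split=> hf x Wx.
  have [p [q [qx h]]] := hf x Wx.
  exists setT, setT, 0%N, (fun x : 'rV_n => p.@[x 0]), (fun x : 'rV_n => q.@[x 0]).
  split=> //; first by split=> //; exists p.
    by split=> //; exists q.
  by move=> y Wy _ _; apply: h.
have [D [D' [d [_ [_ [[-> [p ->]] [-> [q ->]] _ qx h]]]]]] := hf x Wx.
by exists p, q; split=> // y Wy; apply: h.
Qed.

Lemma proj_space_ringed n : ringed (proj_space k n).
Proof.
pose num (D : set (proj_space k n)) (d : nat) (F : proj_space k n -> k) :=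
  D = setT /\ exists2 p : {mpoly k[n.+1]}, p \is d.-homog & F = proj_eval p.
apply: (@fraction_ringed _ _ num).
- move=> D d F [-> _]; split=> //; exists 1; first exact: dhomog1.
  by apply/funext => x; rewrite /proj_eval meval1.
- move=> t; split=> //; exists t%:MP; last first.
    by apply/funext => x; rewrite /proj_eval mevalC.
  by rewrite -[t%:MP]mulr1 mul_mpolyC dhomogZ // dhomog1.
- move=> D D' d _ _ [-> [p hp ->]] [-> [q hq ->]]; rewrite setIT; split=> //.
  exists (p + q); first exact: dhomogD.
  by apply/funext => x; rewrite /proj_eval mevalD.
- move=> D D' d d' _ _ [-> [p hp ->]] [-> [q hq ->]]; rewrite setIT; split=> //.
  exists (p * q); first exact: dhomogM.
  by apply/funext => x; rewrite /proj_eval mevalM.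
- move=> W; split=> [[I [hI ->]] x [p Ip px]|hW].
    have [d hp] := hI p Ip.
    exists setT, d, (proj_eval p); split=> //; first by split=> //; exists p.
    by move=> y _ py; exists p.
  exists [set p : {mpoly k[n.+1]} | (exists d, p \is d.-homog) /\
     forall y : proj_point k n, proj_eval p y != 0 -> W y].
  split; first by move=> F [].
  apply/seteqP; split=> [x Wx|x [p [_ h] /h //]].
  have [D [d [_ [[-> [p hp ->]] _ px h]]]] := hW x Wx.
  by exists p => //; split; [exists d|move=> y; apply: h].
move=> W f; split=> hf x Wx.
  have [d [F [G [hF hG Gx h]]]] := hf x Wx.
  exists setT, setT, d, (proj_eval F), (proj_eval G).
  split=> //; first by split=> //; exists F.
    by split=> //; exists G.
  by move=> y Wy _ _; apply: h.
have [D [D' [d [_ [_ [[-> [F hF ->]] [-> [G hG ->]] _ Gx h]]]]]] := hf x Wx.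
by exists d, F, G; split=> // y Wy; apply: h.
Qed.

(** The property holds for affine space, hence for its closed subspaces, and
    it is local. *)
Lemma variety_local_rings (X : fspace k) : variety X -> local_rings X.
Proof.
move=> [tX _ _ _ [n [U [hU cov]]]].
apply: local_rings_cover => // x; have [i Ux] := cov x.
have [oU [m [I iso]]] := hU i; exists (U i); split=> //.
apply: isomorphic_local_rings iso _; first exact: subspace_top.
by apply: subspace_local_rings; case: (affine_space_ringed m).
Qed.

End AffineProjective.

(** * Products *)

Section Products.
Variable k : fieldType.
Implicit Types X Y Z : fspace k.

Lemma regular_restrict X (U V : set X) f :
  ringed X -> is_open U -> is_open V -> V `<=` U -> regular U f -> regular V f.
Proof.
move=> [lX sX] oU oV VU rf; apply/sX => // x /VU Ux.
exact: (germ_regular (lr_top lX) oU).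
Qed.

Lemma tensor_fin X Y (U : set X) (V : set Y) (I : finType)
    (f : I -> X -> k) (g : I -> Y -> k) :
  (forall i, regular U (f i)) -> (forall i, regular V (g i)) ->
  tensor_fun U V (fun xy => \sum_i f i xy.1 * g i xy.2).
Proof.
move=> rf rg; exists #|I|, (fun i => f (enum_val i)), (fun i => g (enum_val i)).
split=> // xy.
by rewrite (reindex _ (onW_bij _ (@enum_val_bij I))).
Qed.

Lemma tensor_restrict X Y (U U' : set X) (V V' : set Y) h :
  ringed X -> ringed Y -> is_open U -> is_open U' -> is_open V -> is_open V' ->
  U' `<=` U -> V' `<=` V -> tensor_fun U V h -> tensor_fun U' V' h.
Proof.
move=> gX gY oU oU' oV oV' sU sV [n [f [g [rf rg hE]]]].
exists n, f, g; split=> // i.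
  exact: (regular_restrict gX oU oU' sU (rf i)).
exact: (regular_restrict gY oV oV' sV (rg i)).
Qed.

Lemma tensorD X Y (U : set X) (V : set Y) h h' :
  tensor_fun U V h -> tensor_fun U V h' ->
  tensor_fun U V (fun xy => h xy + h' xy).
Proof.
move=> [n [f [g [rf rg hE]]]] [n' [f' [g' [rf' rg' hE']]]].
pose F (i : 'I_n + 'I_n') := match i with inl i => f i | inr i => f' i end.
pose G (i : 'I_n + 'I_n') := match i with inl i => g i | inr i => g' i end.
have -> : (fun xy => h xy + h' xy) = (fun xy => \sum_i F i xy.1 * G i xy.2).
  by apply/funext => xy; rewrite big_sumType /= hE hE'.
by apply: tensor_fin => -[].
Qed.

Lemma tensorM X Y (U : set X) (V : set Y) h h' :
  ringed X -> ringed Y -> is_open U -> is_open V ->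
  tensor_fun U V h -> tensor_fun U V h' ->
  tensor_fun U V (fun xy => h xy * h' xy).
Proof.
move=> [lX sX] [lY sY] oU oV.
move=> [n [f [g [rf rg hE]]]] [n' [f' [g' [rf' rg' hE']]]].
pose F (i : 'I_n * 'I_n') (x : X) := f i.1 x * f' i.2 x.
pose G (i : 'I_n * 'I_n') (y : Y) := g i.1 y * g' i.2 y.
have -> : (fun xy => h xy * h' xy) = (fun xy => \sum_i F i xy.1 * G i xy.2).
  apply/funext => xy; rewrite hE hE' big_distrlr /= pair_bigA /=.
  by apply: eq_bigr => i _; rewrite /F /G mulrACA.
apply: (@tensor_fin _ _ U V _ F G) => -[i j].
  apply/sX => // x Ux; apply: germM => //.
    exact: (germ_regular (lr_top lX) oU (rf i)).
  exact: (germ_regular (lr_top lX) oU (rf' j)).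
apply/sY => // y Vy; apply: germM => //.
  exact: (germ_regular (lr_top lY) oV (rg i)).
exact: (germ_regular (lr_top lY) oV (rg' j)).
Qed.

Lemma regular_cst X (U : set X) t : ringed X -> is_open U -> regular U (fun=> t).
Proof. by move=> [lX sX] oU; apply/sX => // x _; apply: germ_cst. Qed.

Lemma tensor_pure X Y (U : set X) (V : set Y) f g :
  regular U f -> regular V g -> tensor_fun U V (fun xy => f xy.1 * g xy.2).
Proof.
move=> rf rg; have -> : (fun xy => f xy.1 * g xy.2) =
    (fun xy : X * Y => \sum_(i : unit) f xy.1 * g xy.2).
  by apply/funext => xy; rewrite big_const card_unit /= addr0.
exact: (@tensor_fin _ _ U V unit (fun=> f) (fun=> g)).
Qed.

Section Prod.
Variables (X Y : fspace k).
Hypotheses (gX : ringed X) (gY : ringed Y).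
Let tX := lr_top (proj1 gX).
Let tY := lr_top (proj1 gY).

Let num (D : set (prod_space X Y)) (d : nat) (F : prod_space X Y -> k) :=
  exists U : set X, exists V : set Y,
    [/\ is_open U, is_open V, D = [set st | U st.1 /\ V st.2] &
        tensor_fun U V F].

Lemma prod_space_ringed : ringed (prod_space X Y).
Proof.
have numI D D' U V U' V' : D = [set st : X * Y | U st.1 /\ V st.2] ->
    D' = [set st : X * Y | U' st.1 /\ V' st.2] ->
    D `&` D' = [set st : X * Y | (U `&` U') st.1 /\ (V `&` V') st.2].
  move=> -> ->; apply/seteqP; split=> st /=; last by case=> [[]] ? ? [].
  by case=> [[]] ? ? [].
apply: (@fraction_ringed _ _ num).
- move=> D d F [U [V [oU oV DE _]]]; exists U, V; split=> //.
  have -> : (fun=> 1) = (fun xy : X * Y => 1 * 1 : k).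
    by apply/funext => xy; rewrite mulr1.
  by apply: (tensor_pure (f := fun=> 1) (g := fun=> 1)); apply: regular_cst.
- move=> t; exists setT, setT; split=> //; try exact: open_setT.
    by apply/seteqP; split.
  have -> : (fun=> t) = (fun xy : X * Y => t * 1 : k).
    by apply/funext => xy; rewrite mulr1.
  by apply: (tensor_pure (f := fun=> t) (g := fun=> 1)); apply: regular_cst => //;
    apply: open_setT.
- move=> D D' d F G [U [V [oU oV DE tF]]] [U' [V' [oU' oV' DE' tG]]].
  have oUU := open_setI tX oU oU'; have oVV := open_setI tY oV oV'.
  exists (U `&` U'), (V `&` V'); split=> //; first exact: numI.
  apply: tensorD.
    by apply: tensor_restrict tF => // x [].
  by apply: tensor_restrict tG => // x [].
- move=> D D' d d' F G [U [V [oU oV DE tF]]] [U' [V' [oU' oV' DE' tG]]].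
  have oUU := open_setI tX oU oU'; have oVV := open_setI tY oV oV'.
  exists (U `&` U'), (V `&` V'); split=> //; first exact: numI.
  apply: tensorM => //.
    by apply: tensor_restrict tF => // x [].
  by apply: tensor_restrict tG => // x [].
- move=> W; split=> hW xy Wxy.
    have [U [V [h [[oU oV] [Ux Vy] th h0 hh]]]] := hW xy Wxy.
    exists [set st | U st.1 /\ V st.2], 0%N, h; split=> //.
      by exists U, V.
    by move=> st [Us Vt] h1; apply: hh.
  have [_ [d [F [[U [V [oU oV -> tF]]] [Ux Vy] F0 h]]]] := hW xy Wxy.
  by exists U, V, F; split=> // st Us Vt; apply: h.
move=> W f; split=> hf xy Wxy.
  have [U [V [h1 [h2 [[oU oV] [Ux Vy] [t1 t2] h0 hh]]]]] := hf xy Wxy.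
  exists [set st | U st.1 /\ V st.2], [set st | U st.1 /\ V st.2], 0%N, h1, h2.
  split=> //.
  + by exists U, V.
  + by exists U, V.
  + by move=> st Wst [Us Vt] _; apply: hh.
have [_ [_ [d [F [G [[U [V [oU oV -> tF]]] [U' [V' [oU' oV' -> tG]]]]]]]]] := hf xy Wxy.
move=> [[Ux Vy] [Ux' Vy']] G0 h.
have oUU := open_setI tX oU oU'; have oVV := open_setI tY oV oV'.
exists (U `&` U'), (V `&` V'), F, G; split=> //.
  split; first by apply: tensor_restrict tF => // x [].
  by apply: tensor_restrict tG => // x [].
by move=> st Wst [Us Us'] [Vt Vt']; apply: h.
Qed.

Lemma fst_local_morphism (w : prod_space X Y) :
  local_morphism (fst : prod_space X Y -> X) w.
Proof.
apply: morphism_local => U oU.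
have oT : is_open [set: Y] := open_setT tY.
have t1 f : regular U f -> tensor_fun U [set: Y] (fun xy => f xy.1 * 1).
  move=> rf; apply: (tensor_pure (g := fun=> 1)) => //; exact: regular_cst.
have t2 : tensor_fun U [set: Y] (fun xy => 1).
  have -> : (fun=> 1) = (fun xy : X * Y => 1 * 1 : k).
    by apply/funext => xy; rewrite mulr1.
  by apply: (t1 (fun=> 1)); apply: regular_cst.
split=> [xy Ux|g rg xy Ux].
  by exists U, setT, (fun=> 1); split=> //; rewrite oner_neq0.
exists U, setT, (fun xy => g xy.1 * 1), (fun=> 1); split=> //.
- by split=> //; apply: t1.
- by rewrite oner_neq0.
- by move=> st _ _ _ _ /=; rewrite mulr1 divr1.
Qed.

Lemma snd_local_morphism (w : prod_space X Y) :
  local_morphism (snd : prod_space X Y -> Y) w.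
Proof.
apply: morphism_local => V oV.
have oT : is_open [set: X] := open_setT tX.
have t1 f : regular V f -> tensor_fun [set: X] V (fun xy => 1 * f xy.2).
  move=> rf; apply: (tensor_pure (f := fun=> 1)) => //; exact: regular_cst.
have t2 : tensor_fun [set: X] V (fun xy => 1).
  have -> : (fun=> 1) = (fun xy : X * Y => 1 * 1 : k).
    by apply/funext => xy; rewrite mulr1.
  by apply: (t1 (fun=> 1)); apply: regular_cst.
split=> [xy Vy|g rg xy Vy].
  by exists setT, V, (fun=> 1); split=> //; rewrite oner_neq0.
exists setT, V, (fun xy => 1 * g xy.2), (fun=> 1); split=> //.
- by split=> //; apply: t1.
- by rewrite oner_neq0.
- by move=> st _ _ _ _ /=; rewrite mul1r divr1.
Qed.

(** Sums of products of regular functions pull back to sums of products, both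
    in the numerators and denominators of functions and in the equations of
    closed sets. *)
Lemma pair_local_morphism Z (f : Z -> X) (g : Z -> Y) (z : Z) : local_rings Z ->
  local_morphism f z -> local_morphism g z ->
  local_morphism (fun t => (f t, g t) : prod_space X Y) z.
Proof.
move=> lZ lf lg; have tZ := lr_top lZ.
have tensor_germ (U : set X) (V : set Y) h :
    is_open U -> is_open V -> U (f z) -> V (g z) ->
    tensor_fun U V h -> germ z (fun t => h (f t, g t)).
  move=> oU oV Ux Vy [n [p [q [rp rq hE]]]].
  have e t : h (f t, g t) = \sum_(i < n) p i (f t) * q i (g t) by rewrite hE.
  apply: (germ_ext e); apply: germ_sum => // i _; apply: germM => //.
    apply: (proj2 lf); exact: (germ_regular tX oU).
  apply: (proj2 lg); exact: (germ_regular tY oV).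
have near_rect (U : set X) (V : set Y) : is_open U -> is_open V ->
    U (f z) -> V (g z) -> nearby z [set t | U (f t) /\ V (g t)].
  move=> oU oV Ux Vy; apply: (nearbyI tZ); [exact: (proj1 lf)|exact: (proj1 lg)].
split=> [W oW Wz|h [W [h' [oW Wz rh hh]]]].
  have [U [V [h [[oU oV] [Ux Vy] th h0 hW]]]] := oW _ Wz.
  have gh := tensor_germ U V h oU oV Ux Vy th.
  apply: nearbyS (nearbyI tZ (near_rect U V oU oV Ux Vy) (germ_neq0 lZ gh h0)).
  by move=> t [[Ut Vt] ht]; apply: hW.
have cont (N : set (prod_space X Y)) : @nearby _ (prod_space X Y) (f z, g z) N ->
    nearby z [set t | N (f t, g t)].
  move=> [N' [oN' Nz NN]].
  have [U [V [h0 [[oU oV] [Ux Vy] th hz hW]]]] := oN' _ Nz.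
  have gh := tensor_germ U V h0 oU oV Ux Vy th.
  apply: nearbyS (nearbyI tZ (near_rect U V oU oV Ux Vy) (germ_neq0 lZ gh hz)).
  by move=> t [[Ut Vt] ht]; apply: NN; apply: hW.
have [U [V [h1 [h2 [[oU oV] [Ux Vy] [t1 t2] h0 hE]]]]] := rh _ Wz.
have g1 := tensor_germ U V h1 oU oV Ux Vy t1.
have g2 := tensor_germ U V h2 oU oV Ux Vy t2.
apply: (germ_eq tZ) (germ_div lZ g1 g2 h0).
have nW : @nearby _ (prod_space X Y) (f z, g z) W by exists W; split.
apply: nearbyS (nearbyI tZ (nearbyI tZ (cont _ nW) (cont _ hh))
  (nearbyI tZ (near_rect U V oU oV Ux Vy) (germ_neq0 lZ g2 h0))).
by move=> t [[Wt /= ->] [[Ut Vt] ht]]; apply: hE.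
Qed.

End Prod.

End Products.

(** * The projective plane *)

Local Notation o0 := (@Ordinal 3 0 isT).
Local Notation o1 := (@Ordinal 3 1 isT).
Local Notation o2 := (@Ordinal 3 2 isT).

Section Plane.
Variable k : fieldType.
Implicit Types (p q : P2 k) (F G : {mpoly k[3]}).

Definition coord (i : 'I_3) (p : P2 k) : k := vpick (val p) 0 i.

Definition eval3 F (x y z : k) : k := F.@[vec3 x y z 0].

Lemma ord3P (i : 'I_3) : [\/ i = o0, i = o1 | i = o2].
Proof.
by case: i => -[|[|[|//]]] h; [apply: Or31|apply: Or32|apply: Or33]; apply: val_inj.
Qed.

Lemma vec3E (x y z : k) :
  (vec3 x y z 0 o0 = x) * (vec3 x y z 0 o1 = y) * (vec3 x y z 0 o2 = z).
Proof. by rewrite !mxE. Qed.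

Lemma vec3_eta (v : 'rV[k]_3) : v = vec3 (v 0 o0) (v 0 o1) (v 0 o2).
Proof. by apply/rowP => i; case: (ord3P i) => ->; rewrite !vec3E. Qed.

Lemma vec3_eq0 (x y z : k) : (vec3 x y z == 0) = [&& x == 0, y == 0 & z == 0].
Proof.
apply/eqP/and3P => [/rowP h|[/eqP-> /eqP-> /eqP->]].
  by have := (h o0, h o1, h o2); rewrite !vec3E !mxE => -[[-> ->] ->].
by apply/rowP => i; case: (ord3P i) => ->; rewrite !vec3E mxE.
Qed.

Lemma vec3Z (t x y z : k) : t *: vec3 x y z = vec3 (t * x) (t * y) (t * z).
Proof. by apply/rowP => i; case: (ord3P i) => ->; rewrite !(vec3E, mxE). Qed.

Lemma coordP p : has_coords p (coord o0 p) (coord o1 p) (coord o2 p).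
Proof.
rewrite /has_coords -vec3_eta; have p1 := valP p.
have v0 : vpick (val p) != 0.
  by rewrite vpick0; apply: contraTneq p1 => ->; rewrite dimv0.
split=> //; apply/esym/eqP; rewrite eqEdim.
by rewrite -memvE memv_pick dim_vline v0 (eqP p1).
Qed.

Lemma point_exists (x y z : k) :
  exists p : P2 k, vec3 x y z != 0 -> has_coords p x y z.
Proof.
suff [p hp] : exists p : P2 k, True.
  case: (boolP (vec3 x y z == 0)) => [_|v0]; first by exists p.
  have h : \dim <[vec3 x y z]>%VS == 1%N by rewrite dim_vline v0.
  by exists (exist (fun U : {vspace 'rV[k]_3} => \dim U == 1%N) _ h).
have h : \dim <[vec3 (1 : k) 0 0]>%VS == 1%N.
  by rewrite dim_vline vec3_eq0 oner_eq0.
by exists (exist (fun U : {vspace 'rV[k]_3} => \dim U == 1%N) _ h).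
Qed.

Definition point x y z : P2 k := projT1 (cid (point_exists x y z)).

Lemma pointP x y z : vec3 x y z != 0 -> has_coords (point x y z) x y z.
Proof. exact: (projT2 (cid (point_exists x y z))). Qed.

Lemma has_coords_neq0 p x y z : has_coords p x y z -> vec3 x y z != 0.
Proof. by case. Qed.

Lemma has_coords_scale p x y z x' y' z' :
  has_coords p x y z -> has_coords p x' y' z' ->
  exists2 t, t != 0 & [/\ x' = t * x, y' = t * y & z' = t * z].
Proof.
move=> [v0 e] [v0' e'].
have /vlineP[t tE] : vec3 x' y' z' \in <[vec3 x y z]>%VS.
  by rewrite -e e' memv_line.
exists t; first by apply: contraNneq v0' => t0; rewrite tE t0 scale0r.
move: tE; rewrite vec3Z => /rowP h.
by have := (h o0, h o1, h o2); rewrite !vec3E => -[[-> ->] ->].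
Qed.

Lemma has_coordsZ p x y z t : t != 0 ->
  has_coords p x y z -> has_coords p (t * x) (t * y) (t * z).
Proof.
move=> t0 [v0 e]; rewrite /has_coords -vec3Z scaler_eq0 negb_or t0; split=> //.
rewrite e; apply/eqP; rewrite eqEdim !dim_vline v0 scaler_eq0 negb_or t0 v0.
by rewrite leqnn andbT -memvE; apply/vlineP; exists t^-1; rewrite scalerK.
Qed.

Lemma has_coords_inj p q x y z :
  has_coords p x y z -> has_coords q x y z -> p = q.
Proof. by move=> [_ e] [_ e']; apply: val_inj; rewrite e e'. Qed.

(** The vanishing minors say that the two vectors span the same line. *)
Lemma proportional_coords p x y z x' y' z' : has_coords p x y z ->
  vec3 x' y' z' != 0 ->
  x * y' = y * x' -> x * z' = z * x' -> y * z' = z * y' ->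
  has_coords p x' y' z'.
Proof.
move=> hp v0' exy exz eyz; have [v0 _] := hp.
suff [t [ex ey ez]] : exists t, [/\ x' = t * x, y' = t * y & z' = t * z].
  rewrite ex ey ez; apply: has_coordsZ => //.
  by apply: contraNneq v0' => t0; rewrite ex ey ez t0 !mul0r vec3_eq0 eqxx.
have [x0|x0] := eqVneq x 0; last first.
  exists (x' / x); rewrite divfK //; split=> //; apply: (mulfI x0).
    by rewrite exy; field.
  by rewrite exz; field.
have [y0|y0] := eqVneq y 0; last first.
  move: exy; rewrite x0 mul0r => /esym/eqP; rewrite mulf_eq0 (negPf y0) => /eqP->.
  exists (y' / y); rewrite divfK // mulr0; split=> //; apply: (mulfI y0).
  by rewrite eyz; field.
have z0 : z != 0 by move: v0; rewrite vec3_eq0 x0 y0 eqxx.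
move: exz eyz; rewrite x0 y0 !mul0r.
move=> /esym/eqP; rewrite mulf_eq0 (negPf z0) => /eqP->.
move=> /esym/eqP; rewrite mulf_eq0 (negPf z0) => /eqP->.
by exists (z' / z); rewrite divfK // !mulr0.
Qed.

Lemma dhomog_meval n (H : {mpoly k[n]}) d t (v : 'I_n -> k) :
  H \is d.-homog -> H.@[fun i => t * v i] = t ^+ d * H.@[v].
Proof.
move=> /dhomogP hH; rewrite !mevalE mulr_sumr; apply: eq_big_seq => m /hH <-.
rewrite mulrCA; congr (_ * _).
rewrite -[X in t ^+ X]/(mdeg m) mdegE -prodrXr -big_split /=.
by apply: eq_bigr => i _; rewrite exprMn.
Qed.

Lemma proj_eval_coords p x y z : has_coords p x y z ->
  exists2 t, t != 0 & forall d F, F \is d.-homog ->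
    proj_eval F p = t ^+ d * eval3 F x y z.
Proof.
move=> hp; have [t t0 [ex ey ez]] := has_coords_scale hp (coordP p).
exists t => // d F hF; rewrite -(dhomog_meval _ _ hF); apply: meval_eq => i.
by case: (ord3P i) => ->; rewrite vec3E; [exact: ex|exact: ey|exact: ez].
Qed.

Lemma proj_eval_eq0 p x y z d F : has_coords p x y z -> F \is d.-homog ->
  (proj_eval F p == 0) = (eval3 F x y z == 0).
Proof.
move=> /proj_eval_coords[t t0 h] /h ->.
by rewrite mulf_eq0 expf_eq0 (negPf t0) andbF.
Qed.

Lemma proj_eval_ratio p x y z d F G : has_coords p x y z ->
  F \is d.-homog -> G \is d.-homog ->
  proj_eval F p / proj_eval G p = eval3 F x y z / eval3 G x y z.
Proof.
move=> /proj_eval_coords[t t0 h] /h -> /h ->.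
by rewrite -mulf_div divff ?mul1r // expf_neq0.
Qed.

Lemma coord_germ (i j : 'I_3) p :
  coord j p != 0 -> germ p (fun q => coord i q / coord j q).
Proof.
have e l (q : P2 k) : proj_eval 'X_l q = coord l q by rewrite /proj_eval mevalXU.
have hX l : ('X_l : {mpoly k[3]}) \is 1.-homog by rewrite dhomogX /= mdeg1.
move=> jp; exists [set q | coord j q != 0], (fun q => coord i q / coord j q).
split=> //; last by apply: nearby_all => //; apply: lr_top; case: (proj_space_ringed k 2).
  exists [set 'X_j]; split; first by move=> F ->; exists 1%N.
  apply/seteqP; split=> q /=; first by exists 'X_j; rewrite ?e.
  by move=> [F ->]; rewrite e.
move=> q jq; exists 1%N, 'X_i, 'X_j; split; rewrite ?e //.
by move=> q' _ _; rewrite !e.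
Qed.

(** Forms in regular coordinates are regular functions; hence non-vanishing
    loci and quotients of forms pull back to open sets and regular functions. *)
Lemma into_plane (X : fspace k) (f : X -> P2 k) (x : X) (s0 s1 s2 : X -> k) :
  local_rings X -> germ x s0 -> germ x s1 -> germ x s2 ->
  nearby x [set y | has_coords (f y) (s0 y) (s1 y) (s2 y)] ->
  local_morphism f x.
Proof.
move=> lX g0 g1 g2 hf; have tX := lr_top lX.
have geval F : germ x (fun y => eval3 F (s0 y) (s1 y) (s2 y)).
  pose s (i : 'I_3) y := vec3 (s0 y) (s1 y) (s2 y) 0 i.
  apply: (@germ_meval _ _ lX x _ F s) => i; rewrite /s; case: (ord3P i) => ->.
  - by apply: germ_ext _ g0 => y; rewrite vec3E.
  - by apply: germ_ext _ g1 => y; rewrite vec3E.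
  - by apply: germ_ext _ g2 => y; rewrite vec3E.
have near_neq0 d F : F \is d.-homog -> proj_eval F (f x) != 0 ->
    nearby x [set y | proj_eval F (f y) != 0].
  move=> hF; rewrite (proj_eval_eq0 (nearby_point hf) hF) => Fx.
  apply: nearbyS (nearbyI tX hf (germ_neq0 lX (geval F) Fx)) => y [/= hy].
  by rewrite (proj_eval_eq0 hy hF).
have cont (V : set (P2 k)) : is_open V -> V (f x) -> nearby x (f @^-1` V).
  move=> [I [hI ->]] [F IF Fx]; have [d hF] := hI F IF.
  by apply: nearbyS (near_neq0 d F hF Fx) => y Fy; exists F.
split=> // g [U [h [oU Ux rh [V [oV Vx gh]]]]].
have [d [F [G [hF hG Gx hE]]]] := rh _ Ux.
have Gx' := Gx; rewrite (proj_eval_eq0 (nearby_point hf) hG) in Gx'.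
apply: (germ_eq tX) (germ_div lX (geval F) (geval G) Gx').
apply: nearbyS (nearbyI tX (nearbyI tX hf (near_neq0 d G hG Gx))
  (nearbyI tX (cont U oU Ux) (cont V oV Vx))) => y [[/= hy Gy] [Uy Vy]].
by rewrite (gh _ Vy) (hE _ Uy Gy) (proj_eval_ratio hy hF hG).
Qed.

End Plane.

(** * Rational functions *)

Section RationalFunctions.
Variable k : fieldType.
Implicit Types X Y : fspace k.

Lemma rationalP X (f : X -> k) : ringed X ->
  rational f <-> exists x, germ x f.
Proof.
move=> [lX sX]; have tX := lr_top lX; split.
  by move=> [U [oU [x Ux] rf]]; exists x; apply: (germ_regular tX oU rf).
move=> [x [U [g [oU Ux rg [V [oV Vx fg]]]]]].
exists (U `&` V); split; first exact: open_setI.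
  by exists x.
apply/sX; first exact: open_setI.
move=> y [Uy Vy]; apply: (germ_eq tX) (germ_regular tX oU rg Uy).
by exists V; split.
Qed.

Lemma gen_eq_ext X (x : X) (f g : X -> k) : topology_axioms X ->
  f =1 g -> Defs.gen_eq f g.
Proof.
move=> tX fg; exists [set: X]; split; [exact: open_setT|by exists x|].
by move=> y _; apply: fg.
Qed.

Lemma irreducible_image X Y (f : X -> Y) :
  (forall V : set Y, is_open V -> is_open (f @^-1` V)) ->
  (forall y, exists x, f x = y) -> irreducible X -> irreducible Y.
Proof.
move=> cf sf [[x _] irr]; split; first by exists (f x).
move=> U V oU oV [u Uu] [v Vv].
have [u' eu] := sf u; have [v' ev] := sf v.
have [||w [Uw Vw]] := irr _ _ (cf _ oU) (cf _ oV).
- by exists u'; rewrite /= eu.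
- by exists v'; rewrite /= ev.
by exists (f w).
Qed.

End RationalFunctions.

(** * Square roots and the Frobenius pushforward *)

Section CharTwo.
Variable k : closedFieldType.
Hypothesis char2 : 2%N \in [pchar k].
Implicit Types X Y Z : fspace k.

Lemma two0 : 2%:R = 0 :> k. Proof. exact: pcharf0. Qed.

(** Identities of characteristic 2 are proved as identities over the integers
    up to a multiple of 2. *)
Lemma eq_mod2 (x y z : k) : x = y + 2%:R * z -> x = y.
Proof. by rewrite two0 mul0r addr0. Qed.

Lemma sqrD (x y : k) : (x + y) ^+ 2 = x ^+ 2 + y ^+ 2.
Proof. by apply: (@eq_mod2 _ _ (x * y)); ring. Qed.

Lemma opp2 (x : k) : - x = x.
Proof. by apply: (@eq_mod2 _ _ (- x)); ring. Qed.

Lemma addxx (x : k) : x + x = 0.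
Proof. by apply: (@eq_mod2 _ _ x); ring. Qed.

Lemma add_eq0 (x y : k) : (x + y == 0) = (x == y).
Proof. by rewrite addr_eq0 opp2. Qed.

Lemma sqr_inj (x y : k) : x ^+ 2 = y ^+ 2 -> x = y.
Proof.
move=> e; apply/eqP; rewrite -add_eq0 -sqrf_eq0 sqrD e addxx.
by rewrite eqxx.
Qed.

Lemma sqrK (x : k) : root2 (x ^+ 2) = x.
Proof. by apply: sqr_inj; rewrite root2K. Qed.

Lemma root2D (x y : k) : root2 (x + y) = root2 x + root2 y.
Proof. by apply: sqr_inj; rewrite sqrD !root2K. Qed.

Lemma root2M (x y : k) : root2 (x * y) = root2 x * root2 y.
Proof. by apply: sqr_inj; rewrite exprMn !root2K. Qed.

Lemma root2_eq0 (x : k) : (root2 x == 0) = (x == 0).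
Proof. by rewrite -sqrf_eq0 root2K. Qed.

Lemma root2_0 : root2 0 = 0 :> k.
Proof. by apply/eqP; rewrite root2_eq0. Qed.

Lemma root2_1 : root2 1 = 1 :> k.
Proof. by apply: sqr_inj; rewrite root2K expr1n. Qed.

Lemma root2V (x : k) : root2 x^-1 = (root2 x)^-1.
Proof. by apply: sqr_inj; rewrite root2K exprVn root2K. Qed.

Lemma root2_sum (I : Type) (r : seq I) (F : I -> k) :
  root2 (\sum_(i <- r) F i) = \sum_(i <- r) root2 (F i).
Proof. by apply: big_morph; [exact: root2D|exact: root2_0]. Qed.

Lemma root2_prod (I : Type) (r : seq I) (F : I -> k) :
  root2 (\prod_(i <- r) F i) = \prod_(i <- r) root2 (F i).
Proof. by apply: big_morph; [exact: root2M|exact: root2_1]. Qed.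

Lemma root2X n (x : k) : root2 (x ^+ n) = root2 x ^+ n.
Proof. by elim: n => [|n IH]; rewrite ?root2_1 // !exprS root2M IH. Qed.

Lemma germ_frob X (x : X) f : topology_axioms X ->
  @germ k (frob_push X) x f <-> germ x (fun y => f y ^+ 2).
Proof.
move=> tX; split=> [[U [g [oU Ux rg [V [oV Vx fg]]]]]|].
  exists U, (fun y => g y ^+ 2); split=> //; exists V; split=> // y /fg /= ->.
  by [].
move=> [U [h [oU Ux rh [V [oV Vx fh]]]]]; exists U, (fun y => root2 (h y)).
split=> //=.
  by rewrite (_ : (fun y => _) = h) //; apply/funext => y; rewrite root2K.
by exists V; split=> // y /fh /= <-; rewrite sqrK.
Qed.

Lemma frob_push_local_rings X : local_rings X -> local_rings (frob_push X).
Proof.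
move=> lX; have tX := lr_top lX; split=> //.
- by move=> x t; apply/germ_frob => //; apply: germ_cst.
- move=> x f g /(germ_frob _ _ tX) gf /(germ_frob _ _ tX) gg; apply/germ_frob => //.
  by apply: germ_ext _ (germD lX gf gg) => y; rewrite sqrD.
- move=> x f g /(germ_frob _ _ tX) gf /(germ_frob _ _ tX) gg; apply/germ_frob => //.
  by apply: germ_ext _ (germM lX gf gg) => y; rewrite exprMn.
- move=> x f /(germ_frob _ _ tX) gf fx; apply/germ_frob => //.
  apply: germ_ext _ (germV lX gf _) => [y|]; first by rewrite exprVn.
  by rewrite expf_neq0.
- move=> x f /(germ_frob _ _ tX) gf fx.
  have := germ_neq0 lX gf; rewrite expf_neq0 // => /(_ isT).
  by apply: nearbyS => y /=; rewrite sqrf_eq0.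
Qed.

Lemma frob_push_ringed X : ringed X -> ringed (frob_push X).
Proof.
move=> [lX sX]; split; first exact: frob_push_local_rings.
have tX := lr_top lX.
move=> U f oU; split=> [/(sX U _ oU) h x Ux|h].
  by apply/germ_frob => //; apply: h.
by apply/(sX U _ oU) => x Ux; apply/germ_frob => //; apply: h.
Qed.

Lemma frob_local_morphism X (x : X) : local_rings X ->
  local_morphism (@frob k X) x.
Proof.
move=> lX; split=> [V oV Vx|g gx]; first by exists V; split.
apply/germ_frob; first exact: lr_top.
by apply: germ_ext _ (germM lX gx gx) => y.
Qed.

(** Regularity on the pushforward is regularity of the square, so morphisms
    carry over; the next lemmas do the same for subspaces and products. *)
Lemma frob_push_functor X Y (f : X -> Y) (x : X) :
  topology_axioms X -> topology_axioms Y -> local_morphism f x ->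
  @local_morphism k (frob_push X) (frob_push Y) f x.
Proof.
move=> tX tY [cf rf]; split=> [V oV Vx|g]; first exact: cf.
by move/(germ_frob _ _ tY)/rf => ?; apply/germ_frob.
Qed.

Lemma into_frob_subspace X Y (S : set Y) (f : X -> subspace S) (x : X) :
  topology_axioms X -> topology_axioms Y ->
  @local_morphism k X (frob_push Y) (fun y => val (f y)) x ->
  @local_morphism k X (frob_push (subspace S)) f x.
Proof.
move=> tX tY [cf rf]; split=> [_ [V oV ->] Vx|g]; first exact: cf.
move/(germ_frob _ _ (subspace_top S tY))/(germ_subspace _ _ tY) => [h gh].
move/subspace_nearby => [V [oV Vx gV]].
have /rf : @germ k (frob_push Y) (val (f x)) (fun y => root2 (h y)).
  by apply/germ_frob => //; apply: germ_ext _ gh => y; rewrite root2K.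
apply: (germ_eq tX); apply: nearbyS (cf _ oV Vx) => y Vy /=.
by rewrite -(gV _ Vy _ erefl) sqrK.
Qed.

(** The square root of a sum of products is the sum of the products of the
    square roots. *)
Lemma prod_frob_morphism X Y :
  @morphism k (prod_space (frob_push X) (frob_push Y))
    (frob_push (prod_space X Y)) id.
Proof.
have root_tensor (U : set X) (V : set Y) h : tensor_fun U V h ->
    @tensor_fun k (frob_push X) (frob_push Y) U V (fun xy => root2 (h xy)).
  move=> [n [f [g [rf rg hE]]]].
  exists n, (fun i x => root2 (f i x)), (fun i y => root2 (g i y)); split=> //=.
  - move=> i; rewrite (_ : (fun x => _) = f i) //.
    by apply/funext => x; rewrite root2K.
  - move=> i; rewrite (_ : (fun x => _) = g i) //.
    by apply/funext => x; rewrite root2K.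
  - by move=> xy; rewrite hE root2_sum; apply: eq_bigr => i _; rewrite root2M.
move=> W oW; split=> [xy Wxy|f rf xy Wxy].
  have [U [V [h [oUV xUV th h0 hW]]]] := oW xy Wxy.
  exists U, V, (fun xy => root2 (h xy)); split=> //.
  - exact: root_tensor.
  - by rewrite root2_eq0.
  - by move=> st Us Vt; rewrite root2_eq0; apply: hW.
have [U [V [h1 [h2 [oUV xUV [t1 t2] h0 hW]]]]] := rf xy Wxy.
exists U, V, (fun xy => root2 (h1 xy)), (fun xy => root2 (h2 xy)); split=> //.
- by split; apply: root_tensor.
- by rewrite root2_eq0.
- move=> st Ws Us Vt; rewrite root2_eq0 => h2s; apply: sqr_inj.
  by rewrite expr_div_n !root2K; apply: hW.
Qed.

(** If s are the coordinates whose squares give the map, the square root of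
    F(s^2) is the form in s whose coefficients are the roots of those of F. *)
Lemma into_frob_plane X (f : X -> P2 k) (x : X) (s0 s1 s2 : X -> k) :
  local_rings X -> germ x s0 -> germ x s1 -> germ x s2 ->
  nearby x [set y | has_coords (f y) (s0 y ^+ 2) (s1 y ^+ 2) (s2 y ^+ 2)] ->
  @local_morphism k X (frob_push (P2 k)) f x.
Proof.
move=> lX g0 g1 g2 hf; have tX := lr_top lX.
have sq g : germ x g -> germ x (fun y => g y ^+ 2) by move=> ?; apply: germX.
have [cf rf] : local_morphism f x.
  by apply: into_plane hf => //; apply: sq.
split=> // g /(germ_frob _ _ (lr_top (proj1 (proj_space_ringed k 2)))).
move=> [U [h [oU Ux rh [V [oV Vx gh]]]]].
have [d [F [G [hF hG Gx hE]]]] := rh _ Ux.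
pose rt (H : {mpoly k[3]}) : {mpoly k[3]} :=
  \sum_(m <- msupp H) root2 H@_m *: 'X_[m].
have rtE H y0 y1 y2 : eval3 (rt H) y0 y1 y2 = root2 (eval3 H (y0 ^+ 2) (y1 ^+ 2) (y2 ^+ 2)).
  rewrite /eval3 (mevalE _ H) root2_sum raddf_sum /=; apply: eq_bigr => m _.
  rewrite mevalZ mevalX root2M root2_prod; congr (_ * _); apply: eq_bigr => i _.
  rewrite root2X; congr (_ ^+ _).
  by case: (ord3P i) => ->; rewrite !vec3E sqrK.
have geval H : germ x (fun y => eval3 H (s0 y) (s1 y) (s2 y)).
  pose s (i : 'I_3) y := vec3 (s0 y) (s1 y) (s2 y) 0 i.
  apply: (@germ_meval _ _ lX x _ H s) => i; rewrite /s; case: (ord3P i) => ->.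
  - by apply: germ_ext _ g0 => y; rewrite vec3E.
  - by apply: germ_ext _ g1 => y; rewrite vec3E.
  - by apply: germ_ext _ g2 => y; rewrite vec3E.
have Gx' : eval3 (rt G) (s0 x) (s1 x) (s2 x) != 0.
  by rewrite rtE root2_eq0 -(proj_eval_eq0 (nearby_point hf) hG).
apply: (germ_eq tX) (germ_div lX (geval (rt F)) (geval (rt G)) Gx').
apply: nearbyS (nearbyI tX (nearbyI tX hf (germ_neq0 lX (geval (rt G)) Gx'))
  (nearbyI tX (cf U oU Ux) (cf V oV Vx))) => y [[/= hy Gy] [Uy Vy]].
rewrite !rtE -root2V -root2M -(proj_eval_ratio hy hF hG).
rewrite -hE //; first by rewrite -[LHS]sqrK; congr root2; apply: gh.
by move: Gy; rewrite /= rtE root2_eq0 (proj_eval_eq0 hy hG).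
Qed.

Lemma frobenius_bijective X Y (f : X -> Y) : is_frobenius f -> bijective f.
Proof. by move=> [g [_ [s [_ gK sK]]] fg]; exists s => x; rewrite ?fg ?gK ?sK. Qed.

Lemma frobenius_morphism X Y (f : X -> Y) : ringed X -> ringed Y ->
  is_frobenius f -> morphism f.
Proof.
move=> gX [lY sY] [g [mg _] fg]; apply/local_morphismP => //; first exact: lr_top.
move=> x; apply: (local_morphism_eq (lr_top (proj1 gX)) (g := @frob k Y \o g)).
  by apply: nearby_all => //; apply: (lr_top (proj1 gX)).
apply: (local_morphism_comp (lr_top (proj1 gX))); first exact: morphism_local.
exact: frob_local_morphism.
Qed.

(** The inverse of the isomorphism with the pushforward turns g into a function
    whose square is regular on the target. *)
Lemma frobenius_power X Y (f : X -> Y) (g : X -> k) : ringed X -> ringed Y ->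
  is_frobenius f -> rational g -> power_descends f 1 g.
Proof.
move=> gX gY [F [mF [s [ms FK sK]]] fF] /(rationalP _ gX) [x gx].
have tX := lr_top (proj1 gX); have tY := lr_top (proj1 gY).
exists (fun y => g (s y) ^+ 2).
  apply/rationalP => //; exists (F x).
  apply: (proj1 (@germ_frob Y (F x) (fun y => g (s y)) tY)).
  by have [_] := morphism_local (F x) ms; apply; rewrite FK.
apply: (gen_eq_ext x) => // y /=; rewrite fF /frob.
by rewrite (FK y).
Qed.

End CharTwo.

(** * Forms on a plane cubic *)

Section Curves.
Variable k : fieldType.

Lemma eval3_cubic (a eta x y z : k) : eval3 (cubic a eta) x y z =
  y ^+ 2 * z + x * y * z - (x ^+ 3 + a * (x ^+ 2 * z) + eta * (x * z ^+ 2)).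
Proof.
rewrite /eval3 /cubic !(mevalB, mevalD, mevalM, mevalZ, rmorphXn) /=.
by rewrite !mevalXU !vec3E.
Qed.

Lemma eval3_quartic (a b c e x y z : k) :
  let w := z ^+ 2 + b * y ^+ 2 + a * b * x ^+ 2 in
  eval3 (quartic a b c e) x y z =
  c * x ^+ 4 + w * (e * w + (y ^+ 2 + x * y + a * x ^+ 2)).
Proof.
rewrite /eval3 /quartic !(mevalD, mevalM, mevalZ, rmorphXn) /=.
by rewrite !mevalXU !vec3E.
Qed.

Lemma homX (i : 'I_3) : ('X_i : {mpoly k[3]}) \is 1.-homog.
Proof. by rewrite dhomogX /= mdeg1. Qed.

Lemma homX2 (i : 'I_3) : ('X_i ^+ 2 : {mpoly k[3]}) \is 2.-homog.
Proof. exact: (dhomogMn 2 (homX i)). Qed.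

Lemma cubic_homog (a eta : k) : cubic a eta \is 3.-homog.
Proof.
have [h1 h2] := (homX, homX2).
have h21 i j : ('X_i ^+ 2 * 'X_j : {mpoly k[3]}) \is 3.-homog.
  exact: (dhomogM (d := 2) (e := 1)).
have h12 i j : ('X_i * 'X_j ^+ 2 : {mpoly k[3]}) \is 3.-homog.
  exact: (dhomogM (d := 1) (e := 2)).
have h111 i j l : ('X_i * 'X_j * 'X_l : {mpoly k[3]}) \is 3.-homog.
  by apply: (dhomogM (d := 2) (e := 1)) => //; apply: (dhomogM (d := 1) (e := 1)).
rewrite /cubic; apply: rpredB; first exact: dhomogD.
apply: dhomogD; last exact: dhomogZ.
by apply: dhomogD; [exact: (dhomogMn 3 (homX _))|exact: dhomogZ].
Qed.

Lemma quartic_homog (a b c e : k) : quartic a b c e \is 4.-homog.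
Proof.
have [h1 h2] := (homX, homX2).
have h4 : ('X_o0 ^+ 4 : {mpoly k[3]}) \is 4.-homog.
  exact: (dhomogMn 4 (homX _)).
have hw : ('X_o2 ^+ 2 + b *: 'X_o1 ^+ 2 + (a * b) *: 'X_o0 ^+ 2
    : {mpoly k[3]}) \is 2.-homog.
  by do ?apply: dhomogD; do ?apply: dhomogZ.
rewrite /quartic; apply: dhomogD; first exact: dhomogZ.
apply: (dhomogM (d := 2) (e := 2)) => //; apply: dhomogD; first exact: dhomogZ.
apply: dhomogD; last exact: dhomogZ.
by apply: dhomogD => //; apply: (dhomogM (d := 1) (e := 1)).
Qed.

Lemma cubic_neq0 (a eta : k) : cubic a eta != 0.
Proof.
apply: contraTneq (oner_neq0 k) => h; rewrite negbK -oppr_eq0.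
have := eval3_cubic a eta 1 0 0; rewrite h /eval3 meval0.
by rewrite !(mul0r, mulr0, expr0n, expr1n, add0r, addr0) => <-.
Qed.

Section Reduction.
Variables a eta : k.

Let g : {poly k} := 'X^3 + a *: 'X^2 + eta *: 'X.

(** On the chart z = 1 the cubic reads y^2 = g(x) - x y, so that every power
    of y, and hence every form, becomes A(x) + B(x) y. *)
Fixpoint ypow j : {poly k} * {poly k} :=
  if j is j'.+1 then (g * (ypow j').2, (ypow j').1 - 'X * (ypow j').2) else (1, 0).

Lemma ypowE x y j : y ^+ 2 + x * y = g.[x] ->
  y ^+ j = (ypow j).1.[x] + (ypow j).2.[x] * y.
Proof.
move=> e; elim: j => [|j IH] /=; first by rewrite hornerE horner0 mul0r addr0 expr0.
rewrite exprS IH; set P := (ypow j).1; set Q := (ypow j).2.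
have -> : y * (P.[x] + Q.[x] * y) =
  (y ^+ 2 + x * y) * Q.[x] + (P.[x] - x * Q.[x]) * y by ring.
by rewrite e hornerM hornerD hornerN hornerM hornerX.
Qed.

Definition redA N (H : {mpoly k[3]}) : {poly k} :=
  \sum_(m : 'X_{1..3 < N.+1}) H@_m *: ('X^(m o0) * (ypow (m o1)).1).
Definition redB N (H : {mpoly k[3]}) : {poly k} :=
  \sum_(m : 'X_{1..3 < N.+1}) H@_m *: ('X^(m o0) * (ypow (m o1)).2).

Lemma eval3_sum N (H : {mpoly k[3]}) (x y z : k) : H \is N.-homog ->
  eval3 H x y z =
  \sum_(m : 'X_{1..3 < N.+1}) H@_m * (x ^+ m o0 * y ^+ m o1 * z ^+ m o2).
Proof.
move=> hH; have sH : (msize H <= N.+1)%N.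
  by rewrite msizeE; apply/bigmax_leqP_seq => m mH _; rewrite (dhomog_mf hH mH).
rewrite /eval3 [in LHS](mpolywE sH) raddf_sum /=; apply: eq_bigr => m _.
rewrite mevalZ mevalX; congr (_ * _).
rewrite !big_ord_recl big_ord0 mulr1 mulrA.
have -> : lift ord0 (lift ord0 ord0) = o2 :> 'I_3 by apply: val_inj.
have -> : lift ord0 ord0 = o1 :> 'I_3 by apply: val_inj.
have -> : ord0 = o0 :> 'I_3 by apply: val_inj.
by rewrite !vec3E.
Qed.

Lemma redE N (H : {mpoly k[3]}) (x y : k) : H \is N.-homog -> y ^+ 2 + x * y = g.[x] ->
  eval3 H x y 1 = (redA N H).[x] + (redB N H).[x] * y.
Proof.
move=> hH e; rewrite (eval3_sum _ _ _ hH) !horner_sum mulr_suml -big_split /=.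
apply: eq_bigr => m _.
by rewrite !(hornerZ, hornerM, hornerXn) (ypowE _ e) expr1n; ring.
Qed.

(** In the weights 2 and 3 of the poles of x and y at the point (0 : 1 : 0),
    the reduction of y^j has the weight 3j, with the leading coefficient 1. *)
Lemma ypow_weight j i :
  [/\ (3 * j < 2 * i)%N -> (ypow j).1`_i = 0,
      (3 * j < 2 * i + 3)%N -> (ypow j).2`_i = 0,
      (2 * i = 3 * j)%N -> (ypow j).1`_i = 1 &
      (2 * i + 3 = 3 * j)%N -> (ypow j).2`_i = 1].
Proof.
elim: j i => [|j IH] i.
  split=> h; rewrite [ypow 0]/= ?coef0 // ?coef1; last by lia.
    by case: i h.
  by case: i h.
have gE : (g * (ypow j).2)`_i =
    (if (i < 3)%N then 0 else (ypow j).2`_(i - 3)) +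
    a * (if (i < 2)%N then 0 else (ypow j).2`_(i - 2)) +
    eta * (if i == 0%N then 0 else (ypow j).2`_i.-1).
  by rewrite /g !mulrDl -!scalerAl !coefD !coefZ !coefXnM coefXM.
have bE : ((ypow j).1 - 'X * (ypow j).2)`_i =
    (ypow j).1`_i - (if i == 0%N then 0 else (ypow j).2`_i.-1).
  by rewrite coefB coefXM.
have [P0 _ P1 _] := IH i.
have [_ Q3 _ Q3'] := IH (i - 3)%N.
have [_ Q2 _ _] := IH (i - 2)%N.
have [_ Q1 _ _] := IH i.-1.
rewrite [ypow _]/= gE bE; split=> h.
- rewrite Q3 ?Q2 ?Q1; try lia.
  by do 3?case: ifP => _; rewrite !(mulr0, addr0).
- rewrite P0 ?Q1; try lia.
  by case: ifP => _; rewrite subr0.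
- rewrite ifF ?Q3'; try lia.
  rewrite Q2 ?Q1; try lia.
  by do 2?case: ifP => _; rewrite !(mulr0, addr0).
- rewrite P1 ?Q1; try lia.
  by case: ifP => _; rewrite subr0.
Qed.

(** At (0 : 1 : 0) a form of degree N takes the coefficient of y^N, and y^N is
    its only monomial of weight 3N; the top coefficient sits in A or in B
    according to the parity of N. *)
Lemma red_top N H i : H \is N.-homog ->
  ((2 * i = 3 * N)%N -> (redA N H)`_i = eval3 H 0 1 0) /\
  ((2 * i + 3 = 3 * N)%N -> (redB N H)`_i = eval3 H 0 1 0).
Proof.
move=> hH; rewrite (eval3_sum _ _ _ hH).
have supp (m : 'X_{1..3 < N.+1}) : H@_m != 0 -> (m o0 + m o1 + m o2 = N)%N.
  rewrite -mcoeff_msupp => /(dhomog_mf hH) e.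
  rewrite -[RHS]e /= mdegE !big_ord_recl big_ord0 addn0 addnA.
  by congr (m _ + m _ + m _)%N; apply: val_inj.
split=> hi; rewrite coef_sum; apply: eq_bigr => m _; rewrite coefZ coefXnM;
  (have [->|/supp hm] := eqVneq H@_m 0; first by rewrite !mul0r); congr (_ * _);
  rewrite expr1n mulr1 !expr0n;
  have [P0 Q0 P1 Q1] := (ypow_weight (m o1) (i - m o0)).
- have [m0|m0] := eqVneq (m o0) 0%N; last first.
    by rewrite mul0r; case: ifP => // /negbT h; apply: P0; lia.
  have [m2|m2] := eqVneq (m o2) 0%N; last first.
    by rewrite mulr0; case: ifP => // /negbT h; apply: P0; lia.
  by rewrite mulr1 ifF ?P1 //; lia.
- have [m0|m0] := eqVneq (m o0) 0%N; last first.
    by rewrite mul0r; case: ifP => // /negbT h; apply: Q0; lia.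
  have [m2|m2] := eqVneq (m o2) 0%N; last first.
    by rewrite mulr0; case: ifP => // /negbT h; apply: Q0; lia.
  by rewrite mulr1 ifF ?Q1 //; lia.
Qed.

(** The norm of A + B y from the function field of the cubic to k(x). *)
Definition ynorm (A B : {poly k}) : {poly k} := A ^+ 2 - 'X * A * B - B ^+ 2 * g.

Lemma ynormE A B (x y : k) : y ^+ 2 + x * y = g.[x] ->
  (ynorm A B).[x] = (A.[x] + B.[x] * y) * (A.[x] - B.[x] * (x + y)).
Proof.
rewrite /ynorm; move: (g) => G e.
rewrite !(hornerD, hornerN, hornerM, hornerX) -e; ring.
Qed.

Lemma size_g : size g = 4%N.
Proof.
rewrite /g -addrA size_polyDl size_polyXn //.
by rewrite (leq_ltn_trans (size_polyD _ _)) // gtn_max !(leq_ltn_trans (size_scale_leq _ _)) ?size_polyXn ?size_polyX.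
Qed.

(** The degrees of A^2 and of g B^2 have different parities. *)
Lemma ynorm_neq0 (A B : {poly k}) : (A != 0) || (B != 0) -> ynorm A B != 0.
Proof.
have g0 : g != 0 by rewrite -size_poly_eq0 size_g.
have [->|B0] := eqVneq B 0.
  by rewrite orbF /ynorm mulr0 expr0n mul0r !subr0 expf_eq0.
have [->|A0] := eqVneq A 0.
  by rewrite /ynorm mulr0 mul0r expr0n subr0 sub0r oppr_eq0 mulf_neq0 // expf_eq0.
move=> _; have sA : (0 < size A)%N by rewrite lt0n size_poly_eq0.
have sB : (0 < size B)%N by rewrite lt0n size_poly_eq0.
have sA2 : size (A ^+ 2) = (2 * size A).-1 by rewrite expr2 size_mul // addnn mul2n.
have sB2 : size (B ^+ 2 * g) = (2 * size B + 2)%N.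
  rewrite size_mul ?expf_neq0 // size_g expr2 size_mul //.
  by case: (size B) sB => // n _; lia.
have sAB : size ('X * A * B) = (size A + size B)%N.
  by rewrite !size_mul ?mulf_neq0 ?polyX_eq0 // size_polyX add2n.
rewrite -size_poly_eq0 /ynorm.
have [h|h] := leqP (size B + 2) (size A).
  rewrite -addrA size_polyDl; first by rewrite sA2; lia.
  rewrite sA2 -opprD size_polyN (leq_ltn_trans (size_polyD _ _)) // sAB sB2.
  lia.
rewrite addrC size_polyDl size_polyN ?sB2; first by lia.
rewrite (leq_ltn_trans (size_polyD _ _)) // size_polyN sAB sA2; lia.
Qed.

End Reduction.
End Curves.

(** * Homogeneous coordinates and forms over a base *)

Section LocalCoordinates.
Variable k : fieldType.

(** The converse of [into_plane]: divide by a coordinate that does not vanish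
    at the point. *)
Lemma plane_coords (Z : fspace k) (f : Z -> P2 k) (z : Z) : local_rings Z ->
  local_morphism f z -> exists s0 s1 s2 : Z -> k,
    [/\ germ z s0, germ z s1, germ z s2 &
        nearby z [set t | has_coords (f t) (s0 t) (s1 t) (s2 t)]].
Proof.
move=> lZ [cf rf].
have [j j0] : exists j, coord j (f z) != 0.
  have [h _] := coordP (f z); move: h; rewrite vec3_eq0 !negb_and => /or3P[] h;
    [by exists o0|by exists o1|by exists o2].
have gs i := rf _ (coord_germ i j0).
exists (fun t => coord o0 (f t) / coord j (f t)).
exists (fun t => coord o1 (f t) / coord j (f t)).
exists (fun t => coord o2 (f t) / coord j (f t)); split; try exact: gs.
have oj : is_open [set q : P2 k | coord j q != 0].
  exists [set 'X_j]; split.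
    by move=> F ->; exists 1%N; rewrite dhomogX /= mdeg1.
  have e (q : P2 k) : proj_eval 'X_j q = coord j q by rewrite /proj_eval mevalXU.
  apply/seteqP; split=> q /=; first by exists 'X_j; rewrite ?e.
  by move=> [F ->]; rewrite e.
apply: nearbyS (cf _ oj j0) => t /= jt; rewrite ![_ / coord j _]mulrC.
by apply: has_coordsZ (coordP _); rewrite invr_eq0.
Qed.

Lemma proj_evalD n (F G : {mpoly k[n.+1]}) p :
  proj_eval (F + G) p = proj_eval F p + proj_eval G p.
Proof. exact: mevalD. Qed.

Lemma proj_evalM n (F G : {mpoly k[n.+1]}) p :
  proj_eval (F * G) p = proj_eval F p * proj_eval G p.
Proof. exact: mevalM. Qed.

Lemma proj_evalZ n t (F : {mpoly k[n.+1]}) p :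
  proj_eval (t *: F) p = t * proj_eval F p.
Proof. exact: mevalZ. Qed.

(** Clear the denominators of the functions on the plane; the result is a form
    whose coefficients are regular on the base. *)
Lemma tensor_form (Y : fspace k) (U : set (P2 k)) (V : set Y) h (p : P2 k) :
  ringed Y -> is_open V -> U p -> tensor_fun U V h ->
  exists d D (H : Y -> {mpoly k[3]}),
    [/\ D \is d.-homog, proj_eval D p != 0, forall t, H t \is d.-homog,
        forall m t, V t -> germ t (fun u => (H u)@_m) &
        forall q t, U q -> V t -> proj_eval D q != 0 ->
          proj_eval (H t) q = h (q, t) * proj_eval D q].
Proof.
move=> [lY sY] oV Up [n [f [g [rf rg hE]]]].
have : forall q t, h (q, t) = \sum_(i < n) f i q * g i t by move=> q t; rewrite hE.
elim: n h f g rf rg {hE} => [|n IH] h f g rf rg hE.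
  exists 0%N, 1, (fun=> 0); split.
  - exact: dhomog1.
  - by rewrite /proj_eval meval1 oner_neq0.
  - by move=> t; apply: dhomog0.
  - move=> m t _; apply: germ_ext _ (germ_cst lY t 0) => u.
    by rewrite mcoeff0.
  - by move=> q t _ _ _; rewrite hE big_ord0 mul0r /proj_eval meval0.
pose w := widen_ord (leqnSn n).
have [d [D [H [hD Dp hH gH HE]]]] :=
  IH (fun xy => \sum_(i < n) f (w i) xy.1 * g (w i) xy.2) _ _
    (fun i => rf (w i)) (fun i => rg (w i)) (fun _ _ => erefl).
have [d' [F [G [hF hG Gp fE]]]] := rf ord_max _ Up.
exists (d + d')%N, (D * G), (fun t => H t * G + g ord_max t *: (D * F)); split.
- exact: dhomogM.
- by rewrite proj_evalM mulf_neq0.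
- by move=> t; apply: dhomogD; [|apply: dhomogZ]; apply: dhomogM.
- move=> m t Vt; have e u : (H u * G + g ord_max u *: (D * F))@_m =
      \sum_(l : 'X_{1..3 < (mdeg m).+1, (mdeg m).+1} | m == (l.1 + l.2)%MM)
        (H u)@_l.1 * G@_l.2 + g ord_max u * (D * F)@_m.
    by rewrite mcoeffD mcoeffM mcoeffZ.
  apply: (germ_ext e); apply: germD => //.
    apply: germ_sum => // l _; apply: germM => //; first exact: gH.
    exact: germ_cst.
  apply: germM => //; last exact: germ_cst.
  exact: (germ_regular (lr_top lY) oV (rg _)).
move=> q t Uq Vt; rewrite proj_evalM mulf_eq0 negb_or => /andP[Dq Gq].
rewrite proj_evalD proj_evalZ !proj_evalM HE // hE big_ord_recr /= fE //.
by rewrite -/w; field.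
Qed.

(** The non-vanishing loci of such forms are a basis of the topology: an open
    set of the plane that occurs as a domain is absorbed by multiplication with
    a form that vanishes outside it. *)
Lemma prod_plane_basis (Y : fspace k) (W : set (prod_space (P2 k) Y)) p y :
  ringed Y -> is_open W -> W (p, y) ->
  exists (V : set Y) d (H : Y -> {mpoly k[3]}),
    [/\ is_open V /\ V y, forall t, H t \is d.-homog,
        forall m t, V t -> germ t (fun u => (H u)@_m),
        proj_eval (H y) p != 0 &
        forall q t, V t -> proj_eval (H t) q != 0 -> W (q, t)].
Proof.
move=> gY oW Wpy; have [lY _] := gY.
have [U [V [h [[oU oV] [Up Vy] th h0 hW]]]] := oW _ Wpy.
have [d [D [H [hD Dp hH gH HE]]]] := tensor_form gY oV Up th.
have [I [hI UE]] := oU; move: Up th HE hW; rewrite UE => Up th HE hW.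
have [F IF Fp] := Up; have [d' hF] := hI F IF.
exists V, (d + (d + d'))%N, (fun t => H t * (D * F)); split=> //.
- by move=> t; do 2?apply: dhomogM.
- move=> m t Vt; have e u : (H u * (D * F))@_m =
      \sum_(l : 'X_{1..3 < (mdeg m).+1, (mdeg m).+1} | m == (l.1 + l.2)%MM)
        (H u)@_l.1 * (D * F)@_l.2.
    by rewrite mcoeffM.
  apply: (germ_ext e).
  apply: germ_sum => // l _; apply: germM => //; first exact: gH.
  exact: germ_cst.
- by rewrite !proj_evalM HE // !mulf_neq0.
- move=> q t Vt; rewrite !proj_evalM !mulf_eq0 !negb_or => /and3P[Hq Dq Fq].
  have Uq : exists2 F0, I F0 & proj_eval F0 q != 0 by exists F.
  apply: hW => //; move: Hq; rewrite HE // mulf_eq0 negb_or.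
  by case/andP.
Qed.

End LocalCoordinates.

(** * Families of plane curves *)

Section Families.
Variable k : fieldType.
Variables (Y : fspace k) (F : Y -> {mpoly k[3]}).
Hypothesis gY : ringed Y.
Let lY := proj1 gY.
Let tY := lr_top lY.
Let gP := proj_space_ringed k 2.

Lemma total_prod_ringed : ringed (prod_space (P2 k) Y).
Proof. exact: prod_space_ringed. Qed.

Lemma total_ringed : ringed (total_space F).
Proof.
split; first exact: subspace_local_rings (proj1 total_prod_ringed).
exact: subspace_sheaf total_prod_ringed.
Qed.

Definition proj_plane (w : total_space F) : P2 k := (val w).1.

Lemma proj_plane_local (w : total_space F) : local_morphism proj_plane w.
Proof.
have tT := lr_top (proj1 total_ringed).
apply: (local_morphism_comp tT (val_local_morphism w (lr_top (proj1 total_prod_ringed)))).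
exact: fst_local_morphism.
Qed.

Lemma proj_base_local (w : total_space F) : local_morphism (@proj_base k Y F) w.
Proof.
have tT := lr_top (proj1 total_ringed).
apply: (local_morphism_comp tT (val_local_morphism w (lr_top (proj1 total_prod_ringed)))).
exact: snd_local_morphism.
Qed.

Lemma into_total (Z : fspace k) (f : Z -> total_space F) (z : Z) : local_rings Z ->
  local_morphism (fun t => proj_plane (f t)) z ->
  local_morphism (fun t => proj_base (f t)) z -> local_morphism f z.
Proof.
move=> lZ l1 l2; have tZ := lr_top lZ.
apply: into_subspace => //; first exact: (lr_top (proj1 total_prod_ringed)).
have := pair_local_morphism gP gY lZ l1 l2.
apply: local_morphism_eq => //; apply: nearby_all => // t /=.
by rewrite -surjective_pairing.
Qed.

Lemma total_eq (w w' : total_space F) :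
  proj_plane w = proj_plane w' -> proj_base w = proj_base w' -> w = w'.
Proof.
rewrite /proj_plane /proj_base => e1 e2; apply: val_inj.
by rewrite [LHS]surjective_pairing [RHS]surjective_pairing e1 e2.
Qed.

Lemma total_on_curve (w : total_space F) :
  proj_eval (F (proj_base w)) (proj_plane w) = 0.
Proof. exact: (set_valP w). Qed.

Definition total_point (p : P2 k) (y : Y) (h : proj_eval (F y) p = 0) :
  total_space F := exist _ (p, y) (mem_set (h : total_set F (p, y))).

(** The equation of the family, in local coordinates of the plane, is a regular
    function; its non-vanishing locus is open.  The second hypothesis says
    that the coefficients of the equation are regular on the base. *)
Lemma total_closed d : (forall y, F y \is d.-homog) ->
  (forall (w : prod_space (P2 k) Y) s0 s1 s2, germ w s0 -> germ w s1 -> germ w s2 ->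
     germ w (fun u => eval3 (F u.2) (s0 u) (s1 u) (s2 u))) ->
  is_closed (total_set F).
Proof.
move=> hF gF; have [lT _] := total_prod_ringed; have tT := lr_top lT.
apply/(openP tT) => w Fw.
have [s0 [s1 [s2 [g0 g1 g2 hs]]]] := plane_coords lT (fst_local_morphism gP gY w).
have Fw' : eval3 (F w.2) (s0 w) (s1 w) (s2 w) != 0.
  by rewrite -(proj_eval_eq0 (nearby_point hs) (hF _)); apply/eqP.
have := germ_neq0 lT (gF _ _ _ _ g0 g1 g2) Fw'.
move=> h; apply: nearbyS (nearbyI tT hs h) => u [/= hu].
by rewrite -(proj_eval_eq0 hu (hF _)) => /eqP.
Qed.

Lemma proj_base_morphism : morphism (@proj_base k Y F).
Proof.
apply/(local_morphismP _ total_ringed tY) => w; exact: proj_base_local.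
Qed.

End Families.

(** * Irreducibility of cubics and of families of cubics *)

Section CubicCurves.
Variable k : closedFieldType.

Lemma nonroot_exists (p : {poly k}) : p != 0 -> exists x, p.[x] != 0.
Proof. by move=> /closed_nonrootP [x]; exists x. Qed.

Lemma quadratic_root (u v : k) : exists y, y ^+ 2 + u * y = v.
Proof.
have [y yE] := @solve_monicpoly k 2 (nth 0 [:: v; - u]) isT.
exists y; rewrite yE big_ord_recr big_ord1 /= expr0 expr1; ring.
Qed.

Section OneCubic.
Variables a eta : k.

Lemma cubic_chart (x y : k) : (eval3 (cubic a eta) x y 1 == 0) =
  (y ^+ 2 + x * y == ('X^3 + a *: 'X^2 + eta *: 'X).[x]).
Proof.
rewrite -[RHS]subr_eq0 eval3_cubic !(hornerD, hornerZ, hornerXn, hornerX).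
by congr (_ == 0); ring.
Qed.

(** A point with z = 0 is (0 : 1 : 0), where the weights of [red_top] show that
    the reduction is not zero; elsewhere the form equals A(x) + B(x) y. *)
Lemma red_neq0 N (H : {mpoly k[3]}) (p : P2 k) : H \is N.-homog ->
  proj_eval (cubic a eta) p = 0 -> proj_eval H p != 0 ->
  (redA a eta N H != 0) || (redB a eta N H != 0).
Proof.
move=> hH cp Hp; have hp := coordP p; have hC := cubic_homog a eta.
have [z0|z0] := eqVneq (coord o2 p) 0; last first.
  have iz0 : (coord o2 p)^-1 != 0 by rewrite invr_eq0.
  have := has_coordsZ iz0 hp; rewrite (mulVf z0) => hp'.
  move/eqP: cp; rewrite (proj_eval_eq0 hp' hC) cubic_chart => /eqP cp.
  move: Hp; rewrite (proj_eval_eq0 hp' hH) (redE hH cp).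
  rewrite -negb_and; apply: contraNN => /andP[/eqP-> /eqP->].
  by rewrite !horner0 mul0r addr0.
move: hp; rewrite z0; set x := coord o0 p; set y := coord o1 p => hp.
have x0 : x = 0.
  move/eqP: cp; rewrite (proj_eval_eq0 hp hC) eval3_cubic.
  rewrite expr0n !mulr0 !addr0 sub0r oppr_eq0 expf_eq0 => /andP[_ /eqP //].
have y0 : y != 0.
  by have [+ _] := hp; rewrite vec3_eq0 x0 !eqxx andbT.
have iy0 : y^-1 != 0 by rewrite invr_eq0.
have := has_coordsZ iy0 hp; rewrite (mulVf y0) x0 !mulr0 => hp'.
move: Hp; rewrite (proj_eval_eq0 hp' hH) => H0.
have [i hi] : exists i, (2 * i = 3 * N)%N \/ (2 * i + 3 = 3 * N)%N.
  have := odd_double_half N; case: (odd N) => e.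
    by exists (3 * N./2)%N; right; lia.
  by exists (3 * N./2)%N; left; lia.
have [tA tB] := red_top a eta i hH.
case: hi => hi; apply/orP; [left|right]; apply: contraNneq H0 => e.
  by rewrite -tA // e coef0.
by rewrite -tB // e coef0.
Qed.

Lemma red_points (A B A' B' : {poly k}) :
  (A != 0) || (B != 0) -> (A' != 0) || (B' != 0) ->
  exists x y, [/\ x != 0, eval3 (cubic a eta) x y 1 = 0,
    A.[x] + B.[x] * y != 0 & A'.[x] + B'.[x] * y != 0].
Proof.
move=> AB AB'; have n0 := ynorm_neq0 a eta AB; have n0' := ynorm_neq0 a eta AB'.
have [x] : exists x, ('X * ynorm a eta A B * ynorm a eta A' B').[x] != 0.
  by apply: nonroot_exists; rewrite !mulf_neq0 // polyX_eq0.
rewrite !hornerM hornerX !mulf_eq0 !negb_or => /andP[/andP[x0 nx] nx'].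
have [y ye] := quadratic_root x ('X^3 + a *: 'X^2 + eta *: 'X).[x].
exists x, y; split=> //.
- by apply/eqP; rewrite cubic_chart ye.
- by move: nx; rewrite (ynormE _ _ ye) mulf_eq0 negb_or => /andP[].
- by move: nx'; rewrite (ynormE _ _ ye) mulf_eq0 negb_or => /andP[].
Qed.

(** Irreducibility of the cubic in terms of forms: take x outside the zeros of
    both norms. *)
Lemma common_nonzero N N' (H H' : {mpoly k[3]}) (p p' : P2 k) :
  H \is N.-homog -> H' \is N'.-homog ->
  proj_eval (cubic a eta) p = 0 -> proj_eval (cubic a eta) p' = 0 ->
  proj_eval H p != 0 -> proj_eval H' p' != 0 ->
  exists q, [/\ proj_eval (cubic a eta) q = 0, proj_eval H q != 0,
                proj_eval H' q != 0 & coord o0 q != 0].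
Proof.
move=> hH hH' cp cp' Hp Hp'.
have [x [y [x0 cxy Hxy Hxy']]] :=
  red_points (red_neq0 hH cp Hp) (red_neq0 hH' cp' Hp').
have v0 : vec3 x y 1 != 0 by rewrite vec3_eq0 oner_eq0 !andbF.
have hq := pointP v0.
have ce : y ^+ 2 + x * y = ('X^3 + a *: 'X^2 + eta *: 'X).[x].
  by apply/eqP; rewrite -cubic_chart cxy.
exists (point x y 1); split.
- by apply/eqP; rewrite (proj_eval_eq0 hq (cubic_homog _ _)) cxy.
- by rewrite (proj_eval_eq0 hq hH) (redE hH ce).
- by rewrite (proj_eval_eq0 hq hH') (redE hH' ce).
- have [t t0 [-> _ _]] := has_coords_scale hq (coordP _).
  by rewrite mulf_neq0.
Qed.

Lemma cubic_infinity : exists2 p : P2 k,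
  has_coords p 0 1 0 & proj_eval (cubic a eta) p = 0.
Proof.
have v0 : vec3 (0 : k) 1 0 != 0 by rewrite vec3_eq0 oner_eq0 andbF.
exists (point 0 1 0); first exact: pointP.
apply/eqP; rewrite (proj_eval_eq0 (pointP v0) (cubic_homog _ _)) eval3_cubic.
by apply/eqP; ring.
Qed.

Lemma cubic_irreducible : irreducible (plane_curve (cubic a eta)).
Proof.
have [p _ cp] := cubic_infinity.
split; first by exists (exist _ p (mem_set cp)).
move=> _ _ [U [I [hI ->]] ->] [U' [I' [hI' ->]] ->] [u [F IF Fu]] [u' [F' IF' Fu']].
have [d hF] := hI _ IF; have [d' hF'] := hI' _ IF'.
have cu := set_valP u; have cu' := set_valP u'.
have [q [cq Fq Fq' _]] := common_nonzero hF hF' cu cu' Fu Fu'.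
by exists (exist _ q (mem_set cq)); split; [exists F|exists F'].
Qed.

End OneCubic.

Section CubicFamily.
Variables (Y : fspace k) (a eta : Y -> k).
Hypotheses (gY : ringed Y) (irrY : irreducible Y).
Hypotheses (ga : forall y, germ y a) (geta : forall y, germ y eta).
Let lY := proj1 gY.
Let tY := lr_top lY.

Lemma germ_ypow (y : Y) j x :
  germ y (fun t => (ypow (a t) (eta t) j).1.[x]) /\
  germ y (fun t => (ypow (a t) (eta t) j).2.[x]).
Proof.
elim: j => [|j [IH1 IH2]]; split.
- exact: germ_cst.
- exact: germ_cst.
- have e t : (ypow (a t) (eta t) j.+1).1.[x] =
      (x ^+ 3 + a t * x ^+ 2 + eta t * x) * (ypow (a t) (eta t) j).2.[x].
    by rewrite /= hornerM !(hornerD, hornerZ, hornerXn, hornerX).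
  apply: (germ_ext e); apply: germM => //; apply: germD => //; last first.
    by apply: germM => //; apply: germ_cst.
  apply: germD => //; first exact: germ_cst.
  by apply: germM => //; apply: germ_cst.
- have e t : (ypow (a t) (eta t) j.+1).2.[x] =
      (ypow (a t) (eta t) j).1.[x] - x * (ypow (a t) (eta t) j).2.[x].
    by rewrite /= hornerD hornerN hornerM hornerX.
  apply: (germ_ext e); apply: germB => //; apply: germM => //; exact: germ_cst.
Qed.

Lemma germ_red (y : Y) N (H : Y -> {mpoly k[3]}) x :
  (forall m, germ y (fun t => (H t)@_m)) ->
  germ y (fun t => (redA (a t) (eta t) N (H t)).[x]) /\
  germ y (fun t => (redB (a t) (eta t) N (H t)).[x]).
Proof.
move=> gH; split.
  have e t : (redA (a t) (eta t) N (H t)).[x] = \sum_(m : 'X_{1..3 < N.+1})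
      (H t)@_m * (x ^+ m o0 * (ypow (a t) (eta t) (m o1)).1.[x]).
    by rewrite horner_sum; apply: eq_bigr => m _; rewrite hornerZ hornerM hornerXn.
  apply: (germ_ext e); apply: germ_sum => // m _; apply: germM => //.
  by apply: germM => //; [exact: germ_cst|case: (germ_ypow y (m o1) x)].
have e t : (redB (a t) (eta t) N (H t)).[x] = \sum_(m : 'X_{1..3 < N.+1})
    (H t)@_m * (x ^+ m o0 * (ypow (a t) (eta t) (m o1)).2.[x]).
  by rewrite horner_sum; apply: eq_bigr => m _; rewrite hornerZ hornerM hornerXn.
apply: (germ_ext e); apply: germ_sum => // m _; apply: germM => //.
by apply: germM => //; [exact: germ_cst|case: (germ_ypow y (m o1) x)].
Qed.

Let C (y : Y) := cubic (a y) (eta y).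

(** The image in the base of a basic open set contains an open set, since the
    reduction of a form has coefficients regular on the base; so two basic
    open sets meet the same fibre, and this fibre is irreducible. *)
Lemma cubic_family_irreducible : irreducible (total_space C).
Proof.
have [[y0 _] irr] := irrY.
split.
  have [p _ cp] := cubic_infinity (a y0) (eta y0).
  by exists (total_point cp).
have shadow (W : set (prod_space (P2 k) Y)) (w : total_space C) :
    is_open W -> W (val w) -> exists (V : set Y) N (H : Y -> {mpoly k[3]}),
    [/\ is_open V, V !=set0, forall t, H t \is N.-homog,
        forall t, V t -> exists2 q, proj_eval (C t) q = 0 & proj_eval (H t) q != 0 &
        forall q t, V t -> proj_eval (H t) q != 0 -> W (q, t)].
  move=> oW; case: w => -[p y] /= cw Ww; have cp : proj_eval (C y) p = 0 by apply: (set_mem cw).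
  have [V [N [H [[oV Vy] hH gH Hp hW]]]] := prod_plane_basis gY oW Ww.
  have AB := red_neq0 (hH y) cp Hp.
  have [x [z [x0 cxz ABx _]]] := red_points (a y) (eta y) AB AB.
  have {ABx} : ((redA (a y) (eta y) N (H y)).[x] != 0) ||
      ((redB (a y) (eta y) N (H y)).[x] != 0).
    rewrite -negb_and; apply: contraNN ABx => /andP[/eqP-> /eqP->].
    by rewrite mul0r addr0.
  have [gA gB] := germ_red N x (fun m => gH m y Vy).
  move=> ABx; have [V' [oV' Vy' hV']] : nearby y [set t |
      ((redA (a t) (eta t) N (H t)) != 0) || ((redB (a t) (eta t) N (H t)) != 0)].
    case/orP: ABx => ABx.
      apply: nearbyS (germ_neq0 lY gA ABx) => t /= h; apply/orP; left.
      by apply: contraNneq h => ->; rewrite horner0.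
    apply: nearbyS (germ_neq0 lY gB ABx) => t /= h; apply/orP; right.
    by apply: contraNneq h => ->; rewrite horner0.
  exists (V `&` V'), N, H; split=> //; first exact: open_setI.
  - by exists y.
  - move=> t [Vt /hV' /= ABt].
    have [x' [y' [_ cxy ABxy _]]] := red_points (a t) (eta t) ABt ABt.
    have v0 : vec3 x' y' 1 != 0 by rewrite vec3_eq0 oner_eq0 !andbF.
    have ce : y' ^+ 2 + x' * y' = ('X^3 + a t *: 'X^2 + eta t *: 'X).[x'].
      by apply/eqP; rewrite -cubic_chart cxy.
    exists (point x' y' 1).
      by apply/eqP; rewrite (proj_eval_eq0 (pointP v0) (cubic_homog _ _)) cxy.
    by rewrite (proj_eval_eq0 (pointP v0) (hH t)) (redE (hH t) ce).
  - by move=> q t [Vt _]; apply: hW.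
move=> _ _ [W oW ->] [W' oW' ->] [w Ww] [w' Ww'].
have [V [N [H [oV V0 hH HV hW]]]] := shadow W w oW Ww.
have [V' [N' [H' [oV' V0' hH' HV' hW']]]] := shadow W' w' oW' Ww'.
have [t [Vt Vt']] := irr V V' oV oV' V0 V0'.
have [q cq Hq] := HV t Vt; have [q' cq' Hq'] := HV' t Vt'.
have [r [cr Hr Hr' _]] := common_nonzero (hH t) (hH' t) cq cq' Hq Hq'.
by exists (total_point cr); split; [apply: hW|apply: hW'].
Qed.

Lemma cubic_family_fibration : plane_fibration 3 C.
Proof.
split.
- by move=> y; split; [exact: cubic_neq0|exact: cubic_homog].
- apply: (total_closed gY (d := 3)); first by move=> y; apply: cubic_homog.
  have [lT _] := total_prod_ringed gY.
  move=> w s0 s1 s2 g0 g1 g2.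
  have gP := proj_space_ringed k 2.
  have ga' : germ w (fun u => a u.2).
    exact: (proj2 (snd_local_morphism gP gY w) _ (ga _)).
  have ge' : germ w (fun u => eta u.2).
    exact: (proj2 (snd_local_morphism gP gY w) _ (geta _)).
  have e (u : prod_space (P2 k) Y) : eval3 (C u.2) (s0 u) (s1 u) (s2 u) =
      s1 u ^+ 2 * s2 u + s0 u * s1 u * s2 u - (s0 u ^+ 3 +
        a u.2 * (s0 u ^+ 2 * s2 u) + eta u.2 * (s0 u * s2 u ^+ 2)).
    by rewrite eval3_cubic.
  apply: (germ_ext e).
  by do ![assumption | apply: (germB lT) | apply: (germD lT) | apply: (germX lT) | apply: (germM lT)].
- exact: cubic_family_irreducible.
- exact: proj_base_morphism.
- move=> y; have [p _ cp] := cubic_infinity (a y) (eta y).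
  by exists (total_point cp).
Qed.

End CubicFamily.
End CubicCurves.

(** * The two maps on points *)

Section PointMaps.
Variable k : closedFieldType.
Hypothesis char2 : 2%N \in [pchar k].

Lemma eval3_cubic_char2 (a eta x y z : k) : eval3 (cubic a eta) x y z =
  y ^+ 2 * z + x * y * z + x ^+ 3 + a * x ^+ 2 * z + eta * x * z ^+ 2.
Proof. by rewrite eval3_cubic opp2 //; ring. Qed.

Lemma eval3_cubic_root (u v x y z : k) :
  eval3 (cubic (root2 u) (root2 v)) (root2 x) (root2 y) (root2 z) =
  root2 (eval3 (cubic u v) x y z).
Proof.
have sqE (U V X Y Z : k) : eval3 (cubic (U ^+ 2) (V ^+ 2)) (X ^+ 2) (Y ^+ 2) (Z ^+ 2) =
    eval3 (cubic U V) X Y Z ^+ 2.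
  by rewrite !eval3_cubic_char2 !(sqrD char2); ring.
have := sqE (root2 u) (root2 v) (root2 x) (root2 y) (root2 z).
by rewrite !root2K => ->; rewrite sqrK.
Qed.

Lemma on_cubicP (a eta x y z : k) : eval3 (cubic a eta) x y z = 0 ->
  x * (x ^+ 2 + a * x * z + eta * z ^+ 2 + y * z) = y ^+ 2 * z.
Proof.
rewrite eval3_cubic_char2 => h; apply/eqP; rewrite -(add_eq0 char2) -h; apply/eqP; ring.
Qed.

(** In characteristic 2 this is the square of z + b^(1/2) y + (ab)^(1/2) x, and
    the quartic equation says that its product with [vform] is c x^4. *)
Definition wform (a b x y z : k) := z ^+ 2 + b * y ^+ 2 + a * b * x ^+ 2.
Definition vform (a b e x y z : k) :=
  e * wform a b x y z + (y ^+ 2 + x * y + a * x ^+ 2).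

Lemma on_quarticP (a b c e x y z : k) : eval3 (quartic a b c e) x y z = 0 ->
  wform a b x y z * vform a b e x y z = c * x ^+ 4.
Proof.
rewrite eval3_quartic /= => h; apply/eqP; rewrite -(add_eq0 char2) -h.
by apply/eqP; rewrite addrC.
Qed.

Section Left.
Variables A B C E : k.
Hypothesis C0 : C != 0.
Let E1 := cubic A (C * E).
Let Q1 := quartic (A ^+ 2) (B ^+ 2) (C ^+ 2) (E ^+ 2).

Definition left3 (x y z : k) : k := B * y ^+ 2 + A * B * x ^+ 2 + C * x * z.

Definition left_point (p : P2 k) : P2 k :=
  let x := coord o0 p in let y := coord o1 p in let z := coord o2 p in
  if (x == 0) && (y == 0) then point 0 E (1 + B * E)
  else point (x ^+ 2) (y ^+ 2) (left3 x y z).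

Lemma left_special_neq0 : vec3 0 E (1 + B * E) != 0.
Proof.
rewrite vec3_eq0 eqxx /=; apply/negP => /andP[/eqP-> ].
by rewrite mulr0 addr0 oner_eq0.
Qed.

Lemma left_generic_neq0 (x y t : k) : ~~ ((x == 0) && (y == 0)) ->
  vec3 (x ^+ 2) (y ^+ 2) t != 0.
Proof.
by apply: contraNN; rewrite vec3_eq0 !sqrf_eq0 => /and3P[-> ->].
Qed.

Lemma left_special p x y z : has_coords p x y z -> x = 0 -> y = 0 ->
  has_coords (left_point p) 0 E (1 + B * E).
Proof.
move=> hp x0 y0; have [t t0 [ex ey _]] := has_coords_scale hp (coordP p).
rewrite /left_point ex ey x0 y0 !mulr0 eqxx; exact: pointP left_special_neq0.
Qed.

Lemma left_generic p x y z : has_coords p x y z -> ~~ ((x == 0) && (y == 0)) ->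
  has_coords (left_point p) (x ^+ 2) (y ^+ 2) (left3 x y z).
Proof.
move=> hp n0; have [t t0 [ex ey ez]] := has_coords_scale (coordP p) hp.
have n1 : ~~ ((coord o0 p == 0) && (coord o1 p == 0)).
  by apply: contraNN n0 => /andP[/eqP x0 /eqP y0]; rewrite ex ey x0 y0 mulr0 eqxx.
rewrite /left_point (negPf n1).
have t20 : t ^+ 2 != 0 by rewrite expf_neq0.
have := has_coordsZ t20 (pointP (left_generic_neq0 (left3 (coord o0 p) (coord o1 p) (coord o2 p)) n1)).
rewrite -!exprMn -ex -ey; set r := t ^+ 2 * _.
by rewrite (_ : r = left3 x y z) // /r /left3 ex ey ez; ring.
Qed.

(** At (0 : 0 : 1) the coordinates of the map all vanish.  The cubic equation
    reads x u = y^2 z, so their product with u / y^2 is polynomial, and it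
    does not vanish at that point. *)
Lemma left_chart p (x y z : k) :
  let u := x ^+ 2 + A * x * z + C * E * z ^+ 2 + y * z in
  let r := B * u + A * B * x * z + C * z ^+ 2 in
  has_coords p x y z -> proj_eval E1 p = 0 -> vec3 (x * z) u r != 0 ->
  has_coords (left_point p) (x * z) u r.
Proof.
move=> u r hp /eqP; rewrite (proj_eval_eq0 hp (cubic_homog _ _)) => /eqP/on_cubicP.
rewrite -/u => xu n0.
have [/andP[/eqP x0 /eqP y0]|n1] := boolP ((x == 0) && (y == 0)).
  have z0 : z != 0 by have [+ _] := hp; rewrite vec3_eq0 x0 y0 eqxx.
  have cz : C * z ^+ 2 != 0 by rewrite mulf_neq0 // expf_neq0.
  have := has_coordsZ cz (left_special hp x0 y0).
  have -> : C * z ^+ 2 * 0 = x * z by rewrite x0; ring.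
  have -> : C * z ^+ 2 * E = u by rewrite /u x0 y0; ring.
  by have -> : C * z ^+ 2 * (1 + B * E) = r by rewrite /r /u x0 y0; ring.
apply: (proportional_coords (left_generic hp n1)) => //.
- by rewrite expr2 -mulrA xu; ring.
- have -> : x ^+ 2 * r = B * x * (x * u) + A * B * x ^+ 3 * z + C * x ^+ 2 * z ^+ 2.
    by rewrite /r; ring.
  by rewrite xu /left3; ring.
- have -> : left3 x y z * u =
    B * y ^+ 2 * u + A * B * x * (x * u) + C * z * (x * u) by rewrite /left3; ring.
  by rewrite xu /r; ring.
Qed.

Lemma left_wform x y z :
  wform (A ^+ 2) (B ^+ 2) (x ^+ 2) (y ^+ 2) (left3 x y z) = (C * x * z) ^+ 2.
Proof.
apply: (@eq_mod2 _ char2 _ _ (B ^+ 2 * y ^+ 4 + A ^+ 2 * B ^+ 2 * x ^+ 4)).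
rewrite /wform /left3 !(sqrD char2); ring.
Qed.

Lemma special_wform : wform (A ^+ 2) (B ^+ 2) 0 E (1 + B * E) = 1.
Proof.
apply: (@eq_mod2 _ char2 _ _ (B * E + B ^+ 2 * E ^+ 2)).
rewrite /wform; ring.
Qed.

Lemma special_on_quartic : eval3 Q1 0 E (1 + B * E) = 0.
Proof.
rewrite eval3_quartic -/(wform _ _ _ _ _) /= -/(wform _ _ _ _ _).
apply: (@eq_mod2 _ char2 _ _ (E ^+ 2)).
have := special_wform; rewrite /wform => ->; ring.
Qed.

(** Hence images of points of the cubic lie on the quartic, and conversely a
    point with x <> 0 whose image lies on the quartic lies on the cubic. *)
Lemma left_quartic_square x y z :
  eval3 Q1 (x ^+ 2) (y ^+ 2) (left3 x y z) = (C * x * eval3 E1 x y z) ^+ 2.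
Proof.
rewrite eval3_quartic /=; have := left_wform x y z; rewrite /wform => ->.
by rewrite eval3_cubic_char2 !exprMn !(sqrD char2); ring.
Qed.

Lemma left_on_quartic p : proj_eval E1 p = 0 -> proj_eval Q1 (left_point p) = 0.
Proof.
have hp := coordP p; set x := coord o0 p in hp; set y := coord o1 p in hp.
set z := coord o2 p in hp.
move=> /eqP; rewrite (proj_eval_eq0 hp (cubic_homog _ _)) => /eqP cp.
have hQ := quartic_homog (A ^+ 2) (B ^+ 2) (C ^+ 2) (E ^+ 2).
have [/andP[/eqP x0 /eqP y0]|n1] := boolP ((x == 0) && (y == 0)); apply/eqP.
  by rewrite (proj_eval_eq0 (left_special hp x0 y0) hQ) special_on_quartic.
by rewrite (proj_eval_eq0 (left_generic hp n1) hQ) left_quartic_square cp mulr0 expr0n.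
Qed.

Lemma affine_coords (p : P2 k) :
  coord o0 p != 0 -> exists y z, has_coords p 1 y z.
Proof.
move=> x0; have ix0 : (coord o0 p)^-1 != 0 by rewrite invr_eq0.
by have := has_coordsZ ix0 (coordP p); rewrite mulVf //; do 2!eexists; eauto.
Qed.

Lemma cubic_points_x0 a eta (p : P2 k) : proj_eval (cubic a eta) p = 0 -> coord o0 p = 0 ->
  has_coords p 0 0 1 \/ has_coords p 0 1 0.
Proof.
have hp := coordP p; move=> /eqP; rewrite (proj_eval_eq0 hp (cubic_homog _ _)).
move=> + x0; move: hp; rewrite x0 => hp; rewrite eval3_cubic_char2.
rewrite !expr0n /= !(mulr0, mul0r, addr0) mulf_eq0 sqrf_eq0.
have [v0 _] := hp; move: v0; rewrite vec3_eq0 eqxx /= => n0.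
case/orP => /eqP h; rewrite h eqxx ?andbT /= in n0; rewrite h in hp; [left|right].
  by have := has_coordsZ (invr_neq0 n0) hp; rewrite !mulr0 mulVf.
by have := has_coordsZ (invr_neq0 n0) hp; rewrite !mulr0 mulVf.
Qed.

(** For x = 0 the quartic equation is the square of a product of two linear
    forms, z + b^(1/2) y and e^(1/2) (z + b^(1/2) y) + y. *)
Lemma quartic_x0 (p : P2 k) : proj_eval Q1 p = 0 -> coord o0 p = 0 ->
  has_coords p 0 1 B \/ has_coords p 0 E (1 + B * E).
Proof.
have hp := coordP p; set y := coord o1 p in hp; set z := coord o2 p in hp.
move=> /eqP; rewrite (proj_eval_eq0 hp (quartic_homog _ _ _ _)) => + x0.
rewrite x0 in hp *; rewrite eval3_quartic /=.
have -> : z ^+ 2 + B ^+ 2 * y ^+ 2 + A ^+ 2 * B ^+ 2 * 0 ^+ 2 = (z + B * y) ^+ 2.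
  by rewrite sqrD // exprMn expr0n /= mulr0 addr0.
have -> : C ^+ 2 * 0 ^+ 4 + (z + B * y) ^+ 2 *
    (E ^+ 2 * (z + B * y) ^+ 2 + (y ^+ 2 + 0 * y + A ^+ 2 * 0 ^+ 2)) =
    ((z + B * y) * (E * (z + B * y) + y)) ^+ 2.
  by rewrite [in RHS]exprMn (sqrD char2 _ y) exprMn; ring.
rewrite sqrf_eq0 mulf_eq0 !(add_eq0 char2) => /orP[] /eqP h.
  left; rewrite h in hp; have y0 : y != 0.
    by have [+ _] := hp; apply: contraNneq => ->; rewrite mulr0 vec3_eq0 eqxx.
  have := has_coordsZ (invr_neq0 y0) hp; rewrite mulr0 mulVf //.
  by rewrite mulrC mulfK.
right; set s := z + B * y in h.
have zE : z = s * (1 + B * E).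
  by rewrite mulrDr mulr1 mulrCA (mulrC s) h /s -addrA addxx // addr0.
have s0 : s != 0.
  have [+ _] := hp; apply: contraNneq => s0.
  by rewrite zE -h s0 mulr0 mul0r vec3_eq0 eqxx.
have := has_coordsZ (invr_neq0 s0) hp; rewrite mulr0 -h zE mulKf //.
by rewrite (mulrC E) mulKf.
Qed.

Lemma left_affine p y z : has_coords p 1 y z ->
  has_coords (left_point p) 1 (y ^+ 2) (B * y ^+ 2 + A * B + C * z).
Proof.
move=> hp; have := left_generic hp; rewrite oner_eq0 => /(_ isT).
by rewrite /left3 expr1n !mulr1.
Qed.

Lemma left_origin p : has_coords p 0 0 1 -> has_coords (left_point p) 0 E (1 + B * E).
Proof. by move=> hp; apply: (left_special hp). Qed.

Lemma left_infinity p : has_coords p 0 1 0 -> has_coords (left_point p) 0 1 B.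
Proof.
move=> hp; have := left_generic hp; rewrite oner_eq0 andbF => /(_ isT).
by rewrite /left3 expr0n expr1n /= !(mulr0, mulr1, addr0).
Qed.

Lemma left_coord0 p : proj_eval E1 p = 0 ->
  (coord o0 (left_point p) == 0) = (coord o0 p == 0).
Proof.
move=> cp; have [x0|x0] := eqVneq (coord o0 p) 0.
  have [/left_origin hp|/left_infinity hp] := cubic_points_x0 cp x0;
    by have [t t0 [-> _ _]] := has_coords_scale hp (coordP _); rewrite mulr0 eqxx.
have [y [z /left_affine hp]] := affine_coords x0.
have [t t0 [-> _ _]] := has_coords_scale hp (coordP _).
by rewrite mulr1 (negPf t0).
Qed.

Lemma left_inj p q : proj_eval E1 p = 0 -> proj_eval E1 q = 0 ->
  left_point p = left_point q -> p = q.
Proof.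
move=> cp cq e; have x0E : (coord o0 p == 0) = (coord o0 q == 0).
  by rewrite -(left_coord0 cp) -(left_coord0 cq) e.
have [xp|xp] := eqVneq (coord o0 p) 0; last first.
  have [y [z hp]] := affine_coords xp; rewrite x0E in xp.
  have [y' [z' hq]] := affine_coords xp.
  have hq' := left_affine hq; rewrite -e in hq'.
  have [t _ [t1 ey ez]] := has_coords_scale (left_affine hp) hq'.
  rewrite mulr1 in t1; rewrite -t1 !mul1r in ey ez.
  move/(sqr_inj char2): ey => ey; rewrite ey in ez hq.
  move/addrI/(mulfI C0): ez => ez; rewrite ez in hq.
  exact: has_coords_inj hp hq.
have xq : coord o0 q = 0 by apply/eqP; rewrite -x0E xp.
have no r s : has_coords r 0 0 1 -> has_coords s 0 1 0 ->
    left_point r = left_point s -> False.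
  move=> /left_origin hr /left_infinity hs ers; rewrite ers in hr.
  have [t _ [_ tE]] := has_coords_scale hs hr; rewrite tE mulr1 (mulrC B).
  by move=> /eqP; rewrite -subr_eq0 addrK oner_eq0.
case: (cubic_points_x0 cp xp) => hp; case: (cubic_points_x0 cq xq) => hq.
- exact: has_coords_inj hp hq.
- by case: (no _ _ hp hq).
- by case: (no _ _ hq hp).
- exact: has_coords_inj hp hq.
Qed.

Lemma left_surj q : proj_eval Q1 q = 0 ->
  exists2 p, proj_eval E1 p = 0 & left_point p = q.
Proof.
move=> cq; have [xq|xq] := eqVneq (coord o0 q) 0; last first.
  have [Y [Z hq]] := affine_coords xq.
  pose y := root2 Y; pose z := (Z + B * Y + A * B) / C.
  have n0 : vec3 1 y z != 0 by rewrite vec3_eq0 oner_eq0.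
  have hp := pointP n0.
  have yE : y ^+ 2 = Y by rewrite root2K.
  have zE : left3 1 y z = Z.
    apply: (@eq_mod2 _ char2 _ _ (B * Y + A * B)).
    by rewrite /left3 yE /z; field.
  exists (point 1 y z).
    apply/eqP; rewrite (proj_eval_eq0 hp (cubic_homog _ _)).
    have := left_quartic_square 1 y z; rewrite expr1n yE zE mulr1.
    move/eqP: cq; rewrite (proj_eval_eq0 hq (quartic_homog _ _ _ _)) => /eqP ->.
    by move/esym/eqP; rewrite sqrf_eq0 mulf_eq0 (negPf C0).
  have := left_generic hp; rewrite oner_eq0 => /(_ isT).
  by rewrite expr1n yE zE => hL; apply: has_coords_inj hL hq.
have v1 : vec3 (0 : k) 0 1 != 0 by rewrite vec3_eq0 oner_eq0 !andbF.
have v2 : vec3 (0 : k) 1 0 != 0 by rewrite vec3_eq0 oner_eq0 !andbF.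
have hE := cubic_homog A (C * E).
case: (quartic_x0 cq xq) => hq.
  exists (point 0 1 0); last exact: has_coords_inj (left_infinity (pointP v2)) hq.
  apply/eqP; rewrite (proj_eval_eq0 (pointP v2) hE) eval3_cubic.
  by apply/eqP; ring.
exists (point 0 0 1); last exact: has_coords_inj (left_origin (pointP v1)) hq.
apply/eqP; rewrite (proj_eval_eq0 (pointP v1) hE) eval3_cubic.
by apply/eqP; ring.
Qed.

End Left.
End PointMaps.

Section RightPoint.
Variable k : closedFieldType.
Hypothesis char2 : 2%N \in [pchar k].
Variables a b c e : k.
Hypothesis c0 : c != 0.
Let Q := quartic a b c e.
Let E := cubic a (c * e).

Definition right_point (p : P2 k) : P2 k :=
  let x := coord o0 p in let y := coord o1 p in let z := coord o2 p in
  let w := wform a b x y z in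
  if (x == 0) && (w == 0) then point 0 1 0 else point (c * x ^+ 2) (c * x * y) w.

Lemma wformZ (t x y z : k) :
  wform a b (t * x) (t * y) (t * z) = t ^+ 2 * wform a b x y z.
Proof. by rewrite /wform; ring. Qed.

Lemma right_special (p : P2 k) x y z : has_coords p x y z ->
  x = 0 -> wform a b x y z = 0 -> has_coords (right_point p) 0 1 0.
Proof.
move=> hp x0 w0; have [t t0 [ex ey ez]] := has_coords_scale hp (coordP p).
rewrite /right_point ex ey ez wformZ w0 x0 !mulr0 eqxx.
by apply: pointP; rewrite vec3_eq0 oner_eq0 andbF.
Qed.

Lemma right_generic_neq0 (x y z : k) : ~~ ((x == 0) && (wform a b x y z == 0)) ->
  vec3 (c * x ^+ 2) (c * x * y) (wform a b x y z) != 0.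
Proof.
apply: contraNN; rewrite vec3_eq0 mulf_eq0 (negPf c0) sqrf_eq0 /=.
by move=> /and3P[-> _ ->].
Qed.

Lemma right_generic (p : P2 k) x y z : has_coords p x y z ->
  ~~ ((x == 0) && (wform a b x y z == 0)) ->
  has_coords (right_point p) (c * x ^+ 2) (c * x * y) (wform a b x y z).
Proof.
move=> hp n0; have [t t0 [ex ey ez]] := has_coords_scale (coordP p) hp.
set x' := coord o0 p in ex; set y' := coord o1 p in ey; set z' := coord o2 p in ez.
have n1 : ~~ ((x' == 0) && (wform a b x' y' z' == 0)).
  apply: contraNN n0 => /andP[/eqP x0 /eqP w0].
  by rewrite ex ey ez wformZ w0 x0 !mulr0 eqxx.
rewrite /right_point -/x' -/y' -/z' (negPf n1).
have t20 : t ^+ 2 != 0 by rewrite expf_neq0.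
have := has_coordsZ t20 (pointP (right_generic_neq0 n1)).
rewrite -wformZ -ex -ey -ez.
have -> : t ^+ 2 * (c * x' ^+ 2) = c * x ^+ 2 by rewrite ex; ring.
by have -> : t ^+ 2 * (c * x' * y') = c * x * y by rewrite ex ey; ring.
Qed.

(** At (0 : 1 : b^(1/2)) the coordinates of the map all vanish.  The quartic
    equation reads w v = c x^4, so their product with v / (c x) is polynomial,
    and it does not vanish at that point. *)
Lemma right_chart (p : P2 k) x y z :
  let v := vform a b e x y z in
  has_coords p x y z -> proj_eval Q p = 0 -> vec3 (x * v) (y * v) (x ^+ 3) != 0 ->
  has_coords (right_point p) (x * v) (y * v) (x ^+ 3).
Proof.
move=> v hp /eqP; rewrite (proj_eval_eq0 hp (quartic_homog _ _ _ _)).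
move=> /eqP /(on_quarticP char2); rewrite -/v => wv n0.
have [/andP[/eqP x0 /eqP w0]|n1] := boolP ((x == 0) && (wform a b x y z == 0)).
  have yv : y * v != 0.
    by apply: contraNneq n0 => h; rewrite h x0 mul0r expr0n vec3_eq0 eqxx.
  have := has_coordsZ yv (right_special hp x0 w0).
  by rewrite x0 mul0r expr0n /= !mulr0 mulr1.
apply: (proportional_coords (right_generic hp n1)) => //.
- by ring.
- by rewrite [RHS]mulrCA wv; ring.
- by rewrite [RHS]mulrCA wv; ring.
Qed.

(** Hence images of points of the quartic lie on the cubic, and conversely a
    point with x <> 0 whose image lies on the cubic lies on the quartic. *)
Lemma right_cubic (x y z : k) :
  eval3 E (c * x ^+ 2) (c * x * y) (wform a b x y z) =
  c ^+ 2 * x ^+ 2 * eval3 Q x y z.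
Proof.
rewrite (eval3_cubic_char2 char2) eval3_quartic /= -/(wform a b x y z); ring.
Qed.

Lemma right_on_cubic p : proj_eval Q p = 0 -> proj_eval E (right_point p) = 0.
Proof.
have hp := coordP p; set x := coord o0 p in hp; set y := coord o1 p in hp.
set z := coord o2 p in hp.
move=> /eqP; rewrite (proj_eval_eq0 hp (quartic_homog _ _ _ _)) => /eqP cp.
have [/andP[/eqP x0 /eqP w0]|n1] := boolP ((x == 0) && (wform a b x y z == 0)).
  apply/eqP; rewrite (proj_eval_eq0 (right_special hp x0 w0) (cubic_homog _ _)).
  by rewrite eval3_cubic; apply/eqP; ring.
apply/eqP; rewrite (proj_eval_eq0 (right_generic hp n1) (cubic_homog _ _)).
by rewrite right_cubic cp mulr0.
Qed.

Lemma right_affine (p : P2 k) y z : has_coords p 1 y z ->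
  has_coords (right_point p) c (c * y) (wform a b 1 y z).
Proof.
move=> hp; have := right_generic hp; rewrite oner_eq0 => /(_ isT).
by rewrite expr1n !mulr1.
Qed.

Lemma infinity_wform : wform a b 0 1 (root2 b) = 0.
Proof.
rewrite /wform root2K expr0n expr1n /= mulr0 mulr1 addr0; exact: addxx.
Qed.

Lemma right_infinity (p : P2 k) : has_coords p 0 1 (root2 b) ->
  has_coords (right_point p) 0 1 0.
Proof. by move=> hp; apply: (right_special hp erefl infinity_wform). Qed.

Lemma origin_wform : wform a b 0 (root2 e) (1 + root2 b * root2 e) = 1.
Proof.
by have := special_wform char2 (root2 a) (root2 b) (root2 e); rewrite !root2K.
Qed.

Lemma right_origin (p : P2 k) : has_coords p 0 (root2 e) (1 + root2 b * root2 e) ->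
  has_coords (right_point p) 0 0 1.
Proof.
move=> hp; have := right_generic hp.
by rewrite origin_wform oner_eq0 andbF expr0n /= !(mulr0, mul0r); apply.
Qed.

Lemma quartic_points_x0 (p : P2 k) : proj_eval Q p = 0 -> coord o0 p = 0 ->
  has_coords p 0 1 (root2 b) \/ has_coords p 0 (root2 e) (1 + root2 b * root2 e).
Proof.
move=> cp x0.
by apply: (@quartic_x0 _ char2 (root2 a) (root2 b) (root2 c) (root2 e)); rewrite ?root2K.
Qed.

Lemma right_coord0 p : proj_eval Q p = 0 ->
  (coord o0 (right_point p) == 0) = (coord o0 p == 0).
Proof.
move=> cp; have [x0|x0] := eqVneq (coord o0 p) 0.
  have [/right_infinity hp|/right_origin hp] := quartic_points_x0 cp x0;
    by have [t t0 [-> _ _]] := has_coords_scale hp (coordP _); rewrite mulr0 eqxx.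
have [y [z /right_affine hp]] := affine_coords x0.
have [t t0 [-> _ _]] := has_coords_scale hp (coordP _).
by rewrite mulf_eq0 (negPf t0) (negPf c0).
Qed.

Lemma right_inj p q : proj_eval Q p = 0 -> proj_eval Q q = 0 ->
  right_point p = right_point q -> p = q.
Proof.
move=> cp cq epq; have x0E : (coord o0 p == 0) = (coord o0 q == 0).
  by rewrite -(right_coord0 cp) -(right_coord0 cq) epq.
have [xp|xp] := eqVneq (coord o0 p) 0; last first.
  have [y [z hp]] := affine_coords xp; rewrite x0E in xp.
  have [y' [z' hq]] := affine_coords xp.
  have hq' := right_affine hq; rewrite -epq in hq'.
  have [t _ [t1 ey ez]] := has_coords_scale (right_affine hp) hq'.
  have {}t1 : t = 1 by apply: (mulIf c0); rewrite mul1r.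
  rewrite t1 !mul1r in ey ez; move/(mulfI c0): ey => ey; rewrite ey in ez hq.
  move: ez; rewrite /wform -!addrA => /addIr/(sqr_inj char2) ez.
  by rewrite ez in hq; apply: has_coords_inj hp hq.
have xq : coord o0 q = 0 by apply/eqP; rewrite -x0E xp.
have no r s : has_coords r 0 1 (root2 b) ->
    has_coords s 0 (root2 e) (1 + root2 b * root2 e) ->
    right_point r = right_point s -> False.
  move=> /right_infinity hr /right_origin hs ers; rewrite ers in hr.
  have [t _ [_ _ tE]] := has_coords_scale hr hs.
  by move/eqP: tE; rewrite mulr0 oner_eq0.
case: (quartic_points_x0 cp xp) => hp; case: (quartic_points_x0 cq xq) => hq.
- exact: has_coords_inj hp hq.
- by case: (no _ _ hp hq).
- by case: (no _ _ hq hp).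
- exact: has_coords_inj hp hq.
Qed.

Lemma right_surj q : proj_eval E q = 0 ->
  exists2 p, proj_eval Q p = 0 & right_point p = q.
Proof.
move=> cq; have hQ := quartic_homog a b c e.
have [xq|xq] := eqVneq (coord o0 q) 0; last first.
  have [Y [Z hq]] := affine_coords xq.
  pose z := root2 (c * Z + b * Y ^+ 2 + a * b).
  have wE : wform a b 1 Y z = c * Z.
    apply: (@eq_mod2 _ char2 _ _ (b * Y ^+ 2 + a * b)).
    by rewrite /wform root2K; ring.
  have n0 : vec3 1 Y z != 0 by rewrite vec3_eq0 oner_eq0.
  have hp := pointP n0; have hR := right_affine hp.
  exists (point 1 Y z); last first.
    apply: has_coords_inj hR _; rewrite wE -[X in has_coords _ X]mulr1.
    exact: has_coordsZ hq.
  apply/eqP; rewrite (proj_eval_eq0 hp hQ).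
  have := right_cubic 1 Y z; rewrite expr1n !mulr1 wE.
  have := has_coordsZ c0 hq; rewrite mulr1 => hq'.
  move/eqP: cq; rewrite (proj_eval_eq0 hq' (cubic_homog _ _)) => /eqP ->.
  by move/esym/eqP; rewrite mulf_eq0 sqrf_eq0 (negPf c0).
have v1 : vec3 0 1 (root2 b) != 0 by rewrite vec3_eq0 oner_eq0 !andbF.
have v2 := left_special_neq0 (root2 b) (root2 e).
case: (cubic_points_x0 char2 cq xq) => hq.
  exists (point 0 (root2 e) (1 + root2 b * root2 e)); last first.
    exact: has_coords_inj (right_origin (pointP v2)) hq.
  apply/eqP; rewrite (proj_eval_eq0 (pointP v2) hQ).
  have := special_on_quartic char2 (root2 a) (root2 b) (root2 c) (root2 e).
  by rewrite !root2K => ->.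
exists (point 0 1 (root2 b)); last exact: has_coords_inj (right_infinity (pointP v1)) hq.
apply/eqP; rewrite (proj_eval_eq0 (pointP v1) hQ) eval3_quartic /=.
by have := infinity_wform; rewrite /wform => ->; rewrite expr0n mulr0 mul0r addr0.
Qed.

Lemma right_left (p : P2 k) (x y z : k) : has_coords p x y z ->
  proj_eval (cubic (root2 a) (root2 c * root2 e)) p = 0 ->
  has_coords (right_point (left_point (root2 a) (root2 b) (root2 c) (root2 e) p))
    (x ^+ 2) (y ^+ 2) (z ^+ 2).
Proof.
set A := root2 a; set B := root2 b; set C := root2 c => hp cp.
have C0 : C != 0 by rewrite root2_eq0.
have on0 : eval3 (cubic A (C * root2 e)) x y z = 0.
  by apply/eqP; rewrite -(proj_eval_eq0 hp (cubic_homog _ _)) cp.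
have [/andP[/eqP x0 /eqP y0]|n1] := boolP ((x == 0) && (y == 0)).
  have hL := @left_special _ A B C (root2 e) _ _ _ _ hp x0 y0.
  have z0 : z != 0 by have [+ _] := hp; rewrite vec3_eq0 x0 y0 !eqxx.
  have := has_coordsZ (expf_neq0 2 z0) (right_origin hL).
  by rewrite x0 y0 !expr0n /= !mulr0 mulr1.
have hL := @left_generic _ A B C (root2 e) _ _ _ _ hp n1.
have wE : wform a b (x ^+ 2) (y ^+ 2) (left3 A B C x y z) = (C * x * z) ^+ 2.
  by have := left_wform char2 A B C x y z; rewrite !root2K.
have [x0|x0] := eqVneq x 0.
  rewrite x0 eqxx /= in n1; rewrite x0 mulr0 mul0r expr0n /= in wE.
  have z0 : z = 0.
    move: on0; rewrite (eval3_cubic_char2 char2) x0 !expr0n /= !(mulr0, mul0r, addr0).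
    by move/eqP; rewrite mulf_eq0 sqrf_eq0 (negPf n1) => /eqP.
  rewrite x0 in hL.
  have := right_special hL; rewrite expr0n /= => /(_ erefl wE) hR.
  have := has_coordsZ (expf_neq0 2 n1) hR.
  by rewrite x0 z0 !expr0n /= !mulr0 mulr1.
have Cx0 : (C * x) ^+ 2 != 0 by rewrite expf_neq0 // mulf_neq0.
have := right_generic hL; rewrite sqrf_eq0 (negPf x0) => /(_ isT) hR.
have := has_coordsZ (invr_neq0 Cx0) hR; rewrite wE.
have cE : c = C ^+ 2 by rewrite root2K.
rewrite cE.
have -> : ((C * x) ^+ 2)^-1 * (C ^+ 2 * x ^+ 2 ^+ 2) = x ^+ 2.
  by field; rewrite C0 x0.
have -> : ((C * x) ^+ 2)^-1 * (C ^+ 2 * x ^+ 2 * y ^+ 2) = y ^+ 2.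
  by field; rewrite C0 x0.
have -> // : ((C * x) ^+ 2)^-1 * (C * x * z) ^+ 2 = z ^+ 2.
by field; rewrite C0 x0.
Qed.

End RightPoint.

(** * The two maps of fibrations *)

Section Helpers.
Variable k : fieldType.

Lemma nearby_vec3 (Z : fspace k) (z : Z) (s0 s1 s2 : Z -> k) : local_rings Z ->
  germ z s0 -> germ z s1 -> germ z s2 -> vec3 (s0 z) (s1 z) (s2 z) != 0 ->
  nearby z [set t | vec3 (s0 t) (s1 t) (s2 t) != 0].
Proof.
move=> lZ g0 g1 g2; rewrite vec3_eq0 !negb_and => /or3P[] h.
- apply: nearbyS (germ_neq0 lZ g0 h) => t /= ht.
  by rewrite vec3_eq0 (negPf ht).
- apply: nearbyS (germ_neq0 lZ g1 h) => t /= ht.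
  by rewrite vec3_eq0 (negPf ht) andbF.
- apply: nearbyS (germ_neq0 lZ g2 h) => t /= ht.
  by rewrite vec3_eq0 (negPf ht) !andbF.
Qed.

Lemma injective_surjective_bijective (T T' : Type) (f : T -> T') :
  injective f -> (forall y, exists x, f x = y) -> bijective f.
Proof.
move=> fi /boolp.choice [g gK]; exists g => // x.
by apply: fi; rewrite gK.
Qed.

End Helpers.

Ltac germs lX := do ![assumption | apply: (germ_cst lX) | apply: (germD lX)
  | apply: (germM lX) | apply: (germX lX)].

Section TotalMaps.
Variable k : closedFieldType.
Hypothesis char2 : 2%N \in [pchar k].
Variables (Y Y' : fspace k) (phi : Y' -> Y).
Hypotheses (gY : ringed Y) (gY' : ringed Y').
Hypothesis phi_frob : is_frobenius phi.
Variables a b c e : Y -> k.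
Hypotheses (ga : forall y, germ y a) (gb : forall y, germ y b).
Hypotheses (gc : forall y, germ y c) (ge : forall y, germ y e).
Hypothesis c0 : forall y, c y != 0.

Let root (f : Y -> k) (y : Y') := root2 (f (phi y)).

(** The square roots of the parameters are regular on the source of the
    Frobenius morphism phi. *)
Definition covering_cubic (y : Y') := cubic (root a y) (root c y * root e y).
Definition quartic_family (y : Y) := quartic (a y) (b y) (c y) (e y).
Definition cubic_family (y : Y) := cubic (a y) (c y * e y).

Let T1 := total_space covering_cubic.
Let T2 := total_space quartic_family.
Let T3 := total_space cubic_family.

Lemma germ_root f (y : Y') : germ (phi y) f -> germ y (root f).
Proof.
have [g [mg _] phiE] := phi_frob; rewrite phiE => gf.
have tY := lr_top (proj1 gY).
have : @germ k (frob_push Y) (g y) (fun t => root2 (f t)).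
  apply/germ_frob => //; apply: germ_ext _ gf => t.
  by rewrite root2K.
move/(proj2 (morphism_local y mg)) => h; apply: germ_ext _ h => t.
by rewrite /root phiE.
Qed.

Let gT1 := total_ringed covering_cubic gY'.
Let gT2 := total_ringed quartic_family gY.
Let gT3 := total_ringed cubic_family gY.

Lemma left_total_subproof (w : T1) :
  proj_eval (quartic_family (phi (proj_base w)))
    (left_point (root a (proj_base w)) (root b (proj_base w)) (root c (proj_base w))
       (root e (proj_base w)) (proj_plane w)) = 0.
Proof.
have := left_on_quartic char2 (root b (proj_base w)) (total_on_curve w).
by rewrite !root2K.
Qed.

Definition left_total (w : T1) : T2 := total_point (left_total_subproof w).

Lemma right_total_subproof (w : T2) :
  proj_eval (cubic_family (proj_base w))
    (right_point (a (proj_base w)) (b (proj_base w)) (c (proj_base w)) (proj_plane w)) = 0.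
Proof. exact: (right_on_cubic char2 (c0 _) (total_on_curve w)). Qed.

Definition right_total (w : T2) : T3 := total_point (right_total_subproof w).

Lemma phi_local (y : Y') : local_morphism phi y.
Proof. exact: morphism_local (frobenius_morphism char2 gY' gY phi_frob). Qed.

Lemma left_total_morphism : morphism left_total.
Proof.
have [l1 _] := gT1; have t1 := lr_top l1.
apply/(local_morphismP _ gT1 (lr_top (proj1 gT2))) => w.
apply: (into_total gY) => //; last first.
  apply: (local_morphism_comp t1 (proj_base_local gY' w)).
  exact: phi_local.
have [s0 [s1 [s2 [g0 g1 g2 hs]]]] := plane_coords l1 (proj_plane_local gY' w).
have gr f : (forall y, germ y f) -> germ w (fun t : T1 => root f (proj_base t)).
  move=> gf; apply: (proj2 (proj_base_local gY' w)); apply: germ_root; exact: gf.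
have [gA gB gC gE] := And4 (gr _ ga) (gr _ gb) (gr _ gc) (gr _ ge).
have C0 (y : Y') : root c y != 0 by rewrite root2_eq0.
have [/andP[/eqP x0 /eqP y0]|n0] := boolP ((s0 w == 0) && (s1 w == 0)).
  pose u (t : T1) := s0 t ^+ 2 + root a (proj_base t) * s0 t * s2 t +
    root c (proj_base t) * root e (proj_base t) * s2 t ^+ 2 + s1 t * s2 t.
  pose r (t : T1) := root b (proj_base t) * u t +
    root a (proj_base t) * root b (proj_base t) * s0 t * s2 t +
    root c (proj_base t) * s2 t ^+ 2.
  have gu : germ w u by rewrite /u; germs l1.
  have gr' : germ w r by rewrite /r; germs l1.
  have gx : germ w (fun t => s0 t * s2 t) by germs l1.
  apply: (into_plane l1 gx gu gr').
  have z0 : s2 w != 0.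
    by have [+ _] := nearby_point hs; rewrite vec3_eq0 x0 y0 !eqxx.
  have v0 : vec3 (s0 w * s2 w) (u w) (r w) != 0.
    rewrite vec3_eq0 x0 mul0r eqxx /=; apply/negP => /andP[/eqP u0].
    rewrite /r u0 x0 !(mulr0, mul0r, add0r) mulf_eq0 sqrf_eq0 (negPf z0) orbF.
    by rewrite (negPf (C0 _)).
  apply: nearbyS (nearbyI t1 hs (nearby_vec3 l1 gx gu gr' v0)) => t [/= ht vt].
  exact: (left_chart char2 (C0 _) ht (total_on_curve t)).
have g0' : germ w (fun t => s0 t ^+ 2) by germs l1.
have g1' : germ w (fun t => s1 t ^+ 2) by germs l1.
have g2' : germ w (fun t : T1 => left3 (root a (proj_base t)) (root b (proj_base t))
    (root c (proj_base t)) (s0 t) (s1 t) (s2 t)) by rewrite /left3; germs l1.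
apply: (into_plane l1 g0' g1' g2').
have v0 := left_generic_neq0 (left3 (root a (proj_base w)) (root b (proj_base w))
    (root c (proj_base w)) (s0 w) (s1 w) (s2 w)) n0.
have h0 : vec3 (s0 w) (s1 w) 0 != 0 by rewrite vec3_eq0 eqxx andbT.
have gz : germ w (fun _ : T1 => 0 : k) by exact: germ_cst.
apply: nearbyS (nearbyI t1 hs (nearby_vec3 l1 g0 g1 gz h0)) => t [/= ht].
by rewrite vec3_eq0 eqxx andbT; apply: left_generic.
Qed.

Lemma right_total_morphism : morphism right_total.
Proof.
have [l2 _] := gT2; have t2 := lr_top l2.
apply/(local_morphismP _ gT2 (lr_top (proj1 gT3))) => w.
apply: (into_total gY) => //; last exact: proj_base_local.
have [s0 [s1 [s2 [g0 g1 g2 hs]]]] := plane_coords l2 (proj_plane_local gY w).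
have gr f : (forall y, germ y f) -> germ w (fun t : T2 => f (proj_base t)).
  by move=> gf; apply: (proj2 (proj_base_local gY w)).
have [gA gB gC gE] := And4 (gr _ ga) (gr _ gb) (gr _ gc) (gr _ ge).
pose W (t : T2) := wform (a (proj_base t)) (b (proj_base t)) (s0 t) (s1 t) (s2 t).
have gW : germ w W by rewrite /W /wform; germs l2.
have [/andP[/eqP x0 /eqP w0]|n0] := boolP ((s0 w == 0) && (W w == 0)).
  pose v (t : T2) := vform (a (proj_base t)) (b (proj_base t)) (e (proj_base t))
    (s0 t) (s1 t) (s2 t).
  have gv : germ w v by rewrite /v /vform /wform; germs l2.
  have h0 : germ w (fun t => s0 t * v t) by germs l2.
  have h1 : germ w (fun t => s1 t * v t) by germs l2.
  have h2 : germ w (fun t => s0 t ^+ 3) by germs l2.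
  apply: (into_plane l2 h0 h1 h2).
  have y0 : s1 w != 0.
    have [+ _] := nearby_point hs; apply: contraNneq => y0.
    move: w0; rewrite /W /wform y0 x0 !expr0n /= !mulr0 !addr0 => /eqP.
    by rewrite sqrf_eq0 => /eqP ->; rewrite vec3_eq0 eqxx.
  have v0 : vec3 (s0 w * v w) (s1 w * v w) (s0 w ^+ 3) != 0.
    rewrite vec3_eq0 x0 mul0r expr0n eqxx andbT mulf_eq0 (negPf y0) /=.
    rewrite /v /vform; move: w0; rewrite /W => ->.
    by rewrite x0 expr0n /= !(mulr0, mul0r, addr0, add0r) sqrf_eq0.
  apply: nearbyS (nearbyI t2 hs (nearby_vec3 l2 h0 h1 h2 v0)) => t [/= ht vt].
  exact: (right_chart char2 (c0 _) ht (total_on_curve t)).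
have h0 : germ w (fun t : T2 => c (proj_base t) * s0 t ^+ 2) by germs l2.
have h1 : germ w (fun t : T2 => c (proj_base t) * s0 t * s1 t) by germs l2.
apply: (into_plane l2 h0 h1 gW).
have gz : germ w (fun _ : T2 => 0 : k) by exact: germ_cst.
have v0 : vec3 (s0 w) (W w) 0 != 0 by rewrite vec3_eq0 eqxx andbT.
apply: nearbyS (nearbyI t2 hs (nearby_vec3 l2 g0 gW gz v0)) => t [/= ht].
by rewrite vec3_eq0 eqxx andbT; apply: right_generic.
Qed.

Lemma left_total_surj (t : T2) : exists w, left_total w = t.
Proof.
have [f fK phiK] := frobenius_bijective phi_frob.
have := total_on_curve t; rewrite -[proj_base t]phiK.
set y := f (proj_base t) => ct.
have C0 : root c y != 0 by rewrite root2_eq0.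
have ct' : proj_eval (quartic (root a y ^+ 2) (root b y ^+ 2) (root c y ^+ 2)
    (root e y ^+ 2)) (proj_plane t) = 0 by rewrite /root !root2K.
have [p cp pE] := left_surj char2 C0 ct'.
exists (total_point (cp : proj_eval (covering_cubic y) p = 0)).
by apply: total_eq; [exact: pE|exact: phiK].
Qed.

(** The composite is the Frobenius morphism: its inverse takes square roots of
    coordinates, and both directions exchange regular functions with their
    squares. *)
Lemma right_left_frobenius : is_frobenius (right_total \o left_total).
Proof.
have [l1 _] := gT1; have t1 := lr_top l1.
have [l3 _] := gT3; have t3 := lr_top l3.
have [lY _] := gY; have tY := lr_top lY.
have lP := prod_space_ringed (proj_space_ringed k 2) gY.
have tP := lr_top (proj1 lP).
have gT3' := frob_push_ringed char2 gT3.
have [g [mg [f [mf fK phiK]]] phiE] := phi_frob.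
have RL (w : T1) x y z : has_coords (proj_plane w) x y z ->
    has_coords (proj_plane (right_total (left_total w))) (x ^+ 2) (y ^+ 2) (z ^+ 2).
  by move=> hw; apply: (right_left char2 (b _) (c0 _) hw (total_on_curve w)).
pose F : T1 -> frob_push T3 := right_total \o left_total.
exists F => //; split.
  apply/(local_morphismP _ gT1 (lr_top (proj1 gT3'))) => w.
  apply: (into_frob_subspace char2) => //.
  have [s0 [s1 [s2 [g0 g1 g2 hs]]]] := plane_coords l1 (proj_plane_local gY' w).
  have h1 : @local_morphism k T1 (frob_push (P2 k)) (fun t => proj_plane (F t)) w.
    apply: (into_frob_plane char2 l1 g0 g1 g2).
    by apply: nearbyS hs => t; apply: RL.
  have h2 : @local_morphism k T1 (frob_push Y) (fun t => phi (proj_base t)) w.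
    apply: (local_morphism_eq t1 (g := g \o (@proj_base _ _ _))).
      by apply: nearby_all => // t /=; rewrite phiE.
    apply: (local_morphism_comp t1 (proj_base_local gY' w)).
    exact: morphism_local.
  have gP' := frob_push_ringed char2 (proj_space_ringed k 2).
  have := pair_local_morphism gP' (frob_push_ringed char2 gY) l1 h1 h2.
  move=> h; have := local_morphism_comp t1 h (morphism_local _ (prod_frob_morphism char2 (X := P2 k) (Y := Y))).
  apply: local_morphism_eq => //; apply: nearby_all => // t /=.
pose rootp (p : P2 k) := point (root2 (coord o0 p)) (root2 (coord o1 p)) (root2 (coord o2 p)).
have rootpP p x y z : has_coords p x y z ->
    has_coords (rootp p) (root2 x) (root2 y) (root2 z).
  move=> hp; have [t t0 [ex ey ez]] := has_coords_scale (coordP p) hp.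
  have n0 : vec3 (root2 (coord o0 p)) (root2 (coord o1 p)) (root2 (coord o2 p)) != 0.
    by have [+ _] := coordP p; rewrite !vec3_eq0 !root2_eq0.
  have rt0 : root2 t != 0 by rewrite root2_eq0.
  by have := has_coordsZ rt0 (pointP n0); rewrite -!(root2M char2) -ex -ey -ez.
have onE (t : T3) : proj_eval (covering_cubic (f (proj_base t))) (rootp (proj_plane t)) = 0.
  have := total_on_curve t; have ht := coordP (proj_plane t).
  move/eqP; rewrite (proj_eval_eq0 ht (cubic_homog _ _)) => ct; apply/eqP.
  rewrite (proj_eval_eq0 (rootpP _ _ _ _ ht) (cubic_homog _ _)) /root phiE phiK.
  by rewrite -(root2M char2) (eval3_cubic_root char2) root2_eq0.
pose G (t : frob_push T3) : T1 := total_point (onE t).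
exists G; split.
- have tF := lr_top (proj1 gT3').
  apply/(local_morphismP _ gT3' t1) => t.
  apply: (into_total gY' (proj1 gT3')); last first.
    have h := @frob_push_functor k char2 T3 Y _ t t3 tY (proj_base_local gY t).
    by apply: (local_morphism_comp tF h); apply: morphism_local.
  have [s0 [s1 [s2 [g0 g1 g2 hs]]]] := plane_coords l3 (proj_plane_local gY t).
  have gr s : @germ k T3 t s -> @germ k (frob_push T3) t (fun u => root2 (s u)).
    by move=> gs; apply/(germ_frob char2) => //; apply: germ_ext _ gs => u; rewrite root2K.
  apply: (into_plane (proj1 gT3') (gr _ g0) (gr _ g1) (gr _ g2)).
  by case: hs => V [oV Vt hV]; exists V; split=> // u /hV; apply: rootpP.
- move=> w; apply: total_eq; last first.
    by rewrite -[LHS]/(f (phi (proj_base w))) phiE; apply: fK.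
  have hw := coordP (proj_plane w).
  have := rootpP _ _ _ _ (RL _ _ _ _ hw); rewrite !(sqrK char2) => h.
  exact: has_coords_inj h hw.
- move=> t; apply: total_eq; last first.
    by rewrite -[LHS]/(phi (f (proj_base t))) phiE; apply: phiK.
  have ht := coordP (proj_plane t).
  have := RL (G t) _ _ _ (rootpP _ _ _ _ ht); rewrite !root2K => h.
  exact: has_coords_inj h ht.
Qed.

End TotalMaps.

(** * The maps on the fibres *)

Section CurveSpaces.
Variable k : fieldType.

Lemma plane_curve_ringed (C : {mpoly k[3]}) : ringed (plane_curve C).
Proof.
have gP := proj_space_ringed k 2; split.
  exact: subspace_local_rings (proj1 gP).
exact: subspace_sheaf gP.
Qed.

Definition curve_point (C : {mpoly k[3]}) (p : P2 k) (h : proj_eval C p = 0) :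
  plane_curve C := exist _ p (mem_set (h : [set q | proj_eval C q = 0] p)).

Lemma on_curve (C : {mpoly k[3]}) (p : plane_curve C) : proj_eval C (val p) = 0.
Proof. exact: (set_valP p). Qed.

Lemma val_curve_local (C : {mpoly k[3]}) (p : plane_curve C) :
  local_morphism (val : plane_curve C -> P2 k) p.
Proof. exact: val_local_morphism (lr_top (proj1 (proj_space_ringed k 2))). Qed.

Lemma form_open (C : {mpoly k[3]}) d F : F \is d.-homog ->
  @is_open k (plane_curve C) [set p | proj_eval F (val p) != 0].
Proof.
move=> hF; exists [set p | proj_eval F p != 0] => //; exists [set F].
split; first by move=> _ ->; exists d.
by apply/seteqP; split=> p /=; [exists F|case=> _ ->].
Qed.

Lemma coord_open (C : {mpoly k[3]}) i :
  @is_open k (plane_curve C) [set p | coord i (val p) != 0].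
Proof.
have hX : ('X_i : {mpoly k[3]}) \is 1.-homog by rewrite dhomogX /= mdeg1.
have := form_open C hX; congr (is_open _); apply/funext => p /=.
by rewrite /proj_eval mevalXU.
Qed.

Lemma germ_curve (C : {mpoly k[3]}) (p : plane_curve C) h : germ p h ->
  exists d F G, [/\ F \is d.-homog, G \is d.-homog, proj_eval G (val p) != 0 &
    nearby p [set q | h q = proj_eval F (val q) / proj_eval G (val q)]].
Proof.
have [lC _] := plane_curve_ringed C; have tC := lr_top lC.
have tP := lr_top (proj1 (proj_space_ringed k 2)).
move=> /(germ_subspace _ _ tP) [f [U [f' [oU Up rf ff']]] hf].
have [d [F [G [hF hG Gp fE]]]] := rf _ Up.
exists d, F, G; split=> //.
have near W : nearby (val p) W -> @nearby k (plane_curve C) p [set q | W (val q)].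
  exact: local_morphism_nearby (val_curve_local p).
have nU : nearby (val p) U by exists U; split.
apply: nearbyS (nearbyI tC (nearbyI tC hf (near _ ff'))
  (nearbyI tC (near _ nU) (nearby_open (form_open C hG) Gp))).
by move=> q [[/= -> ->] [Uq Gq]]; apply: fE.
Qed.

Lemma germ_spreads (X : fspace k) (x : X) f : topology_axioms X -> germ x f ->
  nearby x [set t | germ t f].
Proof.
move=> tX [U [g [oU Ux rg [V [oV Vx fg]]]]]; exists (U `&` V); split=> //.
  exact: open_setI.
by move=> t [Ut Vt]; exists U, g; split=> //; exists V; split.
Qed.

Lemma const_local (X Y : fspace k) (x : X) (y : Y) :
  local_rings X -> local_morphism (fun _ : X => y) x.
Proof.
move=> lX; split=> [V oV Vy|g _]; first by apply: nearby_all => //; apply: lr_top.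
exact: germ_cst.
Qed.

(** The map of fibres is the inclusion of a fibre, followed by the morphism of
    total spaces and the projection to the plane. *)
Lemma fibre_morphism (Y Z : fspace k) (F : Y -> {mpoly k[3]}) (G : Z -> {mpoly k[3]})
    (f : total_space F -> total_space G) (y : Y) (D : {mpoly k[3]})
    (g : plane_curve (F y) -> plane_curve D) :
  ringed Y -> ringed Z -> morphism f ->
  (forall p, val (g p) = proj_plane (f (total_point (on_curve p)))) -> morphism g.
Proof.
move=> gY gZ mf gE; have gC := plane_curve_ringed (F y).
have tC := lr_top (proj1 gC); have tP := lr_top (proj1 (proj_space_ringed k 2)).
apply/(local_morphismP _ gC (lr_top (proj1 (plane_curve_ringed D)))) => p.
apply: into_subspace => //.
pose i (q : plane_curve (F y)) : total_space F := total_point (on_curve q).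
apply: (local_morphism_eq tC (g := fun q => proj_plane (f (i q)))).
  by apply: nearby_all => // q /=; rewrite gE.
have li : local_morphism i p.
  apply: (into_total gY (proj1 gC)); first exact: val_curve_local.
  exact: const_local (proj1 gC).
apply: (local_morphism_comp (g := fun w => proj_plane (f w)) tC li).
have tF := lr_top (proj1 (total_ringed F gY)).
apply: (local_morphism_comp (f := f) (g := @proj_plane _ _ G) tF).
  exact: morphism_local.
exact: proj_plane_local.
Qed.

Lemma restriction_morphism (X Y : fspace k) (U : set X) (V : set Y)
    (f : subspace U -> subspace V) (g : X -> Y) :
  ringed X -> ringed Y -> morphism g -> (forall u, val (f u) = g (val u)) ->
  morphism f.
Proof.
move=> [lX sX] [lY sY] mg fE; have tX := lr_top lX; have tY := lr_top lY.
have gU : ringed (subspace U).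
  by split; [exact: subspace_local_rings|exact: subspace_sheaf].
apply/(local_morphismP _ gU (subspace_top V tY)) => u.
have tU := lr_top (proj1 gU).
apply: into_subspace => //; apply: (local_morphism_eq tU (g := g \o val)).
  by apply: nearby_all => // w /=; rewrite fE.
apply: (local_morphism_comp tU (val_local_morphism u tX)).
exact: morphism_local.
Qed.

Lemma birational_criterion (X Y : fspace k) (g : X -> Y) (gi : Y -> X)
    (U : set X) (V : set Y) :
  ringed X -> ringed Y -> irreducible X -> morphism g -> cancel g gi -> cancel gi g ->
  is_open U -> is_open V -> U !=set0 -> (forall x, V (g x) <-> U x) ->
  (forall y, V y -> local_morphism gi y) -> birational g.
Proof.
move=> gX gY irr mg gK giK oU oV [x Ux] UV lgi.
have [tX tY] := (lr_top (proj1 gX), lr_top (proj1 gY)).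
split=> //.
  apply: (irreducible_image (f := g) _ _ irr) => [W oW|y]; first by case: (mg W oW).
  by exists (gi y).
have fU (u : subspace U) : V (g (val u)) by apply/UV; apply: (set_valP u).
have fV (v : subspace V) : U (gi (val v)).
  by apply/UV; rewrite giK; apply: (set_valP v).
pose f (u : subspace U) : subspace V := exist _ (g (val u)) (mem_set (fU u)).
pose f' (v : subspace V) : subspace U := exist _ (gi (val v)) (mem_set (fV v)).
have U0 : U !=set0 by exists x.
have V0 : V !=set0 by exists (g x); apply/UV.
exists U, V; split=> //.
exists f => //; split; first exact: (restriction_morphism (g := g)).
exists f'; split; last 2 first.
- by move=> u; apply: val_inj => /=; rewrite gK.
- by move=> v; apply: val_inj => /=; rewrite giK.
have gV : ringed (subspace V).
  by split; [exact: subspace_local_rings (proj1 gY)|exact: subspace_sheaf].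
apply/(local_morphismP _ gV (subspace_top U tX)) => v.
apply: into_subspace => //; first exact: subspace_top.
apply: (local_morphism_comp (g := gi) (lr_top (proj1 gV)) (val_local_morphism v tY)).
by apply: lgi; apply: (set_valP v).
Qed.

Lemma irreducible_meets (X : fspace k) (U V : set X) :
  irreducible X -> is_open U -> is_open V -> U !=set0 -> V !=set0 ->
  exists x, U x /\ V x.
Proof. by move=> [_ irr] oU oV U0 V0; have [x [? ?]] := irr U V oU oV U0 V0; exists x. Qed.

Lemma cubic_affine_point (K : closedFieldType) (a eta : K) :
  exists2 p : P2 K, proj_eval (cubic a eta) p = 0 & coord o0 p != 0.
Proof.
have [p _ cp] := cubic_infinity a eta.
have one : proj_eval (1 : {mpoly K[3]}) p != 0 by rewrite /proj_eval meval1 oner_neq0.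
have h1 : (1 : {mpoly K[3]}) \is 0.-homog by exact: dhomog1.
have [q [cq _ _ q0]] := common_nonzero h1 h1 cp cp one one.
by exists q.
Qed.

End CurveSpaces.

Section LeftFibre.
Variable k : closedFieldType.
Hypothesis char2 : 2%N \in [pchar k].
Variables A B C E : k.
Hypothesis C0 : C != 0.
Let E1 := cubic A (C * E).

(** For the point (1 : y : z) the third coordinate of the image gives z = l,
    and the cubic equation gives y z = 1 + A z + C E z^2 + y^2 z, where y^2
    is the second coordinate of the image; the formula is this point times z,
    made homogeneous. *)
Lemma left_inverse_coords p X Y Z : let l := (Z + B * Y + A * B * X) / C in
  proj_eval E1 p = 0 -> coord o0 p != 0 ->
  has_coords (left_point A B C E p) X Y Z ->
  has_coords p (X * l) (X ^+ 2 + A * X * l + C * E * l ^+ 2 + Y * l) (l ^+ 2).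
Proof.
move=> l cp x0 hq; have [y [z hp]] := affine_coords x0.
have [t t0 [eX eY eZ]] := has_coords_scale (left_affine A B C E hp) hq.
rewrite mulr1 in eX.
have cyz : y ^+ 2 * z + y * z + 1 + A * z + C * E * z ^+ 2 = 0.
  have := cp; move/eqP; rewrite (proj_eval_eq0 hp (cubic_homog _ _)) => /eqP.
  by rewrite (eval3_cubic_char2 char2) => <-; ring.
have z0 : z != 0.
  apply/eqP => z0; move/eqP: cyz; rewrite z0 expr0n /= !mulr0 !(add0r, addr0).
  by rewrite oner_eq0.
have lE : l = t * z.
  apply: (mulIf C0); rewrite /l divfK // eX eY eZ.
  by apply: (@eq_mod2 _ char2 _ _ (t * B * y ^+ 2 + t * A * B)); ring.
have tz : t ^+ 2 * z != 0 by rewrite mulf_neq0 // expf_neq0.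
have := has_coordsZ tz hp; rewrite mulr1 lE eX eY.
have -> : t ^+ 2 * z = t * (t * z) by ring.
have -> : t * (t * z) * z = (t * z) ^+ 2 by ring.
suff -> : t * (t * z) * y = t ^+ 2 + A * t * (t * z) + C * E * (t * z) ^+ 2 +
   t * y ^+ 2 * (t * z) by [].
have -> : t ^+ 2 + A * t * (t * z) + C * E * (t * z) ^+ 2 + t * y ^+ 2 * (t * z) =
    t ^+ 2 * (y ^+ 2 * z + y * z + 1 + A * z + C * E * z ^+ 2) - t * (t * z) * y by ring.
by rewrite cyz mulr0 sub0r opp2.
Qed.

Lemma left_birational (D : {mpoly k[3]}) (g : plane_curve E1 -> plane_curve D) :
  morphism g -> bijective g ->
  (forall p, val (g p) = left_point A B C E (val p)) -> birational g.
Proof.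
move=> mg [gi gK giK] gE.
have gC := plane_curve_ringed E1; have [lD sD] := plane_curve_ringed D.
have tP := lr_top (proj1 (proj_space_ringed k 2)); have tD := lr_top lD.
have x0E (p : plane_curve E1) : (coord o0 (val (g p)) == 0) = (coord o0 (val p) == 0).
  by rewrite gE; apply: (left_coord0 char2 B (on_curve p)).
have [p cp p0] := cubic_affine_point A (C * E).
have U0 : [set q : plane_curve E1 | coord o0 (val q) != 0] !=set0.
  by exists (curve_point cp).
apply: (birational_criterion gC (conj lD sD) (cubic_irreducible _ _) mg gK giK
  (coord_open E1 o0) (coord_open D o0) U0) => [q|q q0]; first by rewrite /= x0E.
apply: (into_subspace tD tP).
have [s0 [s1 [s2 [g0 g1 g2 hs]]]] := plane_coords lD (val_curve_local q).
have cst t : germ q (fun _ : plane_curve D => t : k) by exact: germ_cst.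
pose l (t : plane_curve D) := (s2 t + B * s1 t + A * B * s0 t) * C^-1.
have gl : germ q l by rewrite /l; germs lD.
have h0 : germ q (fun t => s0 t * l t) by germs lD.
have h1 : germ q (fun t => s0 t ^+ 2 + A * s0 t * l t + C * E * l t ^+ 2 + s1 t * l t).
  by germs lD.
have h2 : germ q (fun t => l t ^+ 2) by germs lD.
apply: (into_plane lD h0 h1 h2).
apply: nearbyS (nearbyI tD hs (nearby_open (coord_open D o0) q0)) => t [/= ht t0].
apply: left_inverse_coords.
- exact: (on_curve (gi t)).
- by rewrite -x0E giK.
- by rewrite -gE giK.
Qed.

End LeftFibre.

(** * The degree of the map on the right *)

Section SquareClass.
Variable k : closedFieldType.
Hypothesis char2 : 2%N \in [pchar k].

Lemma poly_eq0_off0 (p : {poly k}) : (forall x, x != 0 -> p.[x] = 0) -> p = 0.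
Proof.
move=> h; apply/eqP; apply: contraT => p0.
have [x] : exists x, ('X * p).[x] != 0.
  by apply: nonroot_exists; rewrite mulf_neq0 // polyX_eq0.
rewrite hornerM hornerX mulf_eq0 negb_or => /andP[x0].
by rewrite h // eqxx.
Qed.

(** A square is never c x times a non-zero square, by the parity of degrees. *)
Lemma square_parity (c : k) (p q : {poly k}) :
  c != 0 -> p ^+ 2 = c *: ('X * q ^+ 2) -> q = 0.
Proof.
move=> c0 e; apply/eqP; apply: contraT => q0.
have := congr1 (fun r : {poly k} => size r) e.
rewrite size_scale // mulrC size_mulX ?expf_neq0 //.
have p0 : p != 0.
  apply: contraNneq q0 => p0; move/esym/eqP: e; rewrite p0 expr0n /=.
  by rewrite scaler_eq0 (negPf c0) mulf_eq0 polyX_eq0 expf_eq0.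
rewrite !expr2 !size_mul // !addnn.
have : (0 < size p)%N by rewrite lt0n size_poly_eq0.
have : (0 < size q)%N by rewrite lt0n size_poly_eq0.
case: (size p) => // m; case: (size q) => // n _ _; lia.
Qed.

(** On the cubic, c x times the square of a non-zero function C + D y is not a
    square.  The left-hand side reduces to (A' + B' y)^2; both sides are
    linear in y after reduction, and comparison at the two points y and y + x
    over x gives B'^2 = c x D^2 and then A'^2 = c x C^2. *)
Lemma cubic_square_class (a eta c s r : k) (A B C D : {poly k}) : c != 0 ->
  (forall x y, x != 0 -> eval3 (cubic a eta) x y 1 = 0 ->
     (x * (A.[x] + B.[x] * y) + (s * y + r * x) * (C.[x] + D.[x] * y)) ^+ 2 =
     c * x * (C.[x] + D.[x] * y) ^+ 2) ->
  C = 0 /\ D = 0.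
Proof.
move=> c0 h; pose g : {poly k} := 'X^3 + a *: 'X^2 + eta *: 'X.
pose A' := 'X * A + r *: ('X * C) + s *: (D * g).
pose B' := 'X * B + s *: C + r *: ('X * D) + s *: ('X * D).
have A'E x : A'.[x] = x * A.[x] + r * (x * C.[x]) + s * (D.[x] * g.[x]).
  by rewrite /A' !(hornerD, hornerZ, hornerM, hornerX).
have B'E x : B'.[x] = x * B.[x] + s * C.[x] + r * (x * D.[x]) + s * (x * D.[x]).
  by rewrite /B' !(hornerD, hornerZ, hornerM, hornerX).
have split x : x != 0 -> B'.[x] ^+ 2 = c * (x * D.[x] ^+ 2) /\
    A'.[x] ^+ 2 = c * (x * C.[x] ^+ 2).
  move=> x0; have [y0 ye] := quadratic_root x g.[x].
  have key y : y ^+ 2 + x * y = g.[x] ->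
      (A'.[x] + B'.[x] * y) ^+ 2 = c * x * (C.[x] + D.[x] * y) ^+ 2.
    move=> e; rewrite -h //; last by apply/eqP; rewrite cubic_chart e.
    congr (_ ^+ 2); rewrite A'E B'E -e.
    by apply: (@eq_mod2 _ char2 _ _ (s * (x * D.[x]) * y)); ring.
  have ye' : (y0 + x) ^+ 2 + x * (y0 + x) = g.[x].
    by rewrite -ye; apply: (@eq_mod2 _ char2 _ _ (x * y0 + x ^+ 2)); ring.
  have := key _ ye; have := key _ ye'; rewrite !(mulrDr, addrA).
  rewrite ![(_ + _ * x) ^+ 2](sqrD char2) mulrDr => + k1; rewrite k1 => /addrI.
  rewrite !exprMn [RHS]mulrA => /(mulIf (expf_neq0 2 x0)); rewrite -mulrA => kB.
  split=> //; move: k1; rewrite !(sqrD char2) mulrDr !exprMn kB !mulrA => /addIr.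
  by rewrite -!mulrA.
have D0 : D = 0.
  apply: (@square_parity c B') => //; apply/eqP; rewrite -subr_eq0; apply/eqP.
  apply: poly_eq0_off0 => x /split [kB _].
  by rewrite hornerD hornerN hornerZ horner_exp hornerM hornerX horner_exp kB subrr.
have C0 : C = 0.
  apply: (@square_parity c A') => //; apply/eqP; rewrite -subr_eq0; apply/eqP.
  apply: poly_eq0_off0 => x /split [_ kA].
  by rewrite hornerD hornerN hornerZ horner_exp hornerM hornerX horner_exp kA subrr.
by [].
Qed.

End SquareClass.

Section RightFibre.
Variable k : closedFieldType.
Hypothesis char2 : 2%N \in [pchar k].
Variables a b c e : k.
Hypothesis c0 : c != 0.
Let Q := quartic a b c e.
Let E := cubic a (c * e).
Variable g : plane_curve Q -> plane_curve E.
Hypothesis mg : morphism g.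
Hypothesis gE : forall p, val (g p) = right_point a b c (val p).
Hypothesis g_surj : forall q, exists p, g p = q.

Let gQ : ringed (plane_curve Q). Proof. exact: plane_curve_ringed. Qed.
Let gC : ringed (plane_curve E). Proof. exact: plane_curve_ringed. Qed.
Hypothesis irrQ : irreducible (plane_curve Q).
Let irrE : irreducible (plane_curve E). Proof. exact: cubic_irreducible. Qed.

Let slope (p : plane_curve Q) : k := coord o1 (val p) / coord o0 (val p).
Let zx (p : plane_curve Q) : k := coord o2 (val p) / coord o0 (val p).
Let slopeE (q : plane_curve E) : k := coord o1 (val q) / coord o0 (val q).
(* The value of (z/x)^2 as a function on the cubic. *)
Let zx2E (q : plane_curve E) : k :=
  c * (coord o2 (val q) / coord o0 (val q)) + b * slopeE q ^+ 2 + a * b.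

Lemma curve_coords (C : {mpoly k[3]}) (p : plane_curve C) : coord o0 (val p) != 0 ->
  has_coords (val p) 1 (coord o1 (val p) / coord o0 (val p))
    (coord o2 (val p) / coord o0 (val p)).
Proof.
move=> x0; have := has_coordsZ (invr_neq0 x0) (coordP (val p)).
by rewrite mulVf // ![_^-1 * _]mulrC.
Qed.

Lemma right_coord0E p : (coord o0 (val (g p)) == 0) = (coord o0 (val p) == 0).
Proof. by rewrite gE; apply: (right_coord0 char2 c0 (on_curve p)). Qed.

Lemma right_chart_values p : coord o0 (val p) != 0 ->
  slopeE (g p) = slope p /\ zx2E (g p) = zx p ^+ 2.
Proof.
move=> x0; have hp := curve_coords x0.
have := right_affine a b c0 hp; rewrite -gE => hq.
have [t t0 [e0 e1 e2]] := has_coords_scale hq (coordP _).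
have tc : t * c != 0 by rewrite mulf_neq0.
have Ue : slopeE (g p) = slope p.
  by rewrite /slopeE e0 e1 -/(slope p); field; rewrite t0 c0.
split=> //; rewrite /zx2E Ue e0 e2 -/(slope p) -/(zx p).
have -> : c * (t * wform a b 1 (slope p) (zx p) / (t * c)) = wform a b 1 (slope p) (zx p).
  by field; rewrite t0 c0.
by apply: (@eq_mod2 _ char2 _ _ (b * slope p ^+ 2 + a * b)); rewrite /wform; ring.
Qed.

Lemma affine_point_E : exists q : plane_curve E, coord o0 (val q) != 0.
Proof.
have [q cq q0] := cubic_affine_point a (c * e).
by exists (curve_point cq).
Qed.

Lemma affine_point_Q : exists p : plane_curve Q, coord o0 (val p) != 0.
Proof.
have [q q0] := affine_point_E; have [p pE] := g_surj q.
by exists p; rewrite -right_coord0E pE.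
Qed.

Lemma germ_slopeE (q : plane_curve E) : coord o0 (val q) != 0 -> germ q slopeE.
Proof.
by move=> q0; exact: (proj2 (val_curve_local q) _ (coord_germ o1 q0)).
Qed.

Lemma germ_zx2E (q : plane_curve E) : coord o0 (val q) != 0 -> germ q zx2E.
Proof.
move=> q0; have [lC _] := gC; have gU := germ_slopeE q0.
have gW : germ q (fun t : plane_curve E => coord o2 (val t) / coord o0 (val t)).
  exact: (proj2 (val_curve_local q) _ (coord_germ o2 q0)).
by rewrite /zx2E; germs lC.
Qed.

Lemma germ_zx (p : plane_curve Q) : coord o0 (val p) != 0 -> germ p zx.
Proof.
by move=> p0; exact: (proj2 (val_curve_local p) _ (coord_germ o2 p0)).
Qed.

(** The parts of a form, dehomogenized by x = 1, that are even and odd in z,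
    as polynomials in y and z^2. *)
Let even_part (F : {mpoly k[3]}) (y r : k) : k := \sum_(m <- msupp F)
  F@_m * (y ^+ m o1 * (if odd (m o2) then 0 else r ^+ (m o2)./2)).
Let odd_part (F : {mpoly k[3]}) (y r : k) : k := \sum_(m <- msupp F)
  F@_m * (y ^+ m o1 * (if odd (m o2) then r ^+ (m o2)./2 else 0)).

Lemma even_odd_parts F y z :
  eval3 F 1 y z = even_part F y (z ^+ 2) + odd_part F y (z ^+ 2) * z.
Proof.
rewrite /eval3 mevalE mulr_suml -big_split /=; apply: eq_bigr => m _.
rewrite -mulrA -mulrDr; congr (_ * _).
rewrite !big_ord_recl big_ord0 mulr1.
have -> : lift ord0 (lift ord0 ord0) = o2 :> 'I_3 by apply: val_inj.
have -> : lift ord0 ord0 = o1 :> 'I_3 by apply: val_inj.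
have -> : ord0 = o0 :> 'I_3 by apply: val_inj.
rewrite !vec3E expr1n mul1r -mulrA -mulrDr; congr (_ * _).
rewrite -!exprM -[in LHS](odd_double_half (m o2)) -mul2n.
by case: (odd (m o2)); rewrite ?add0r ?mul0r ?addr0 // -exprSr.
Qed.

Lemma germ_parts F (q : plane_curve E) : coord o0 (val q) != 0 ->
  germ q (fun t => even_part F (slopeE t) (zx2E t)) /\
  germ q (fun t => odd_part F (slopeE t) (zx2E t)).
Proof.
have [lC _] := gC; move=> q0; have gU := germ_slopeE q0; have gR := germ_zx2E q0.
split; apply: (germ_sum lC) => m _; apply: (germM lC); try exact: (germ_cst lC);
  apply: (germM lC); try exact: (germX lC).
  by case: (odd (m o2)); [exact: (germ_cst lC)|exact: (germX lC)].
by case: (odd (m o2)); [exact: (germX lC)|exact: (germ_cst lC)].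
Qed.

(** With F = f0 + f1 z/x and G = g0 + g1 z/x, where f0, f1, g0, g1 are functions
    on the cubic, F/G = F G / G^2, and G^2 is a function on the cubic. *)
Lemma right_span (h : plane_curve Q -> k) : rational h ->
  exists (p : plane_curve Q) (h0 h1 : plane_curve E -> k),
  [/\ coord o0 (val p) != 0, germ (g p) h0, germ (g p) h1 &
      nearby p [set t | h t = h0 (g t) + h1 (g t) * zx t]].
Proof.
have [lQ _] := gQ; have tQ := lr_top lQ; have [lC _] := gC.
move=> /(rationalP _ gQ) [p0 /(germ_spreads tQ) [V [oV Vp0 gh]]].
have [p [Vp px]] : exists p : plane_curve Q, V p /\ coord o0 (val p) != 0.
  apply: (irreducible_meets irrQ oV (coord_open Q o0)); first by exists p0.
  exact: affine_point_Q.
have [d [F [G [hF hG Gp hE]]]] := germ_curve (gh p Vp).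
pose s0 q := even_part F (slopeE q) (zx2E q); pose s1 q := odd_part F (slopeE q) (zx2E q).
pose t0 q := even_part G (slopeE q) (zx2E q); pose t1 q := odd_part G (slopeE q) (zx2E q).
pose D q := t0 q ^+ 2 + zx2E q * t1 q ^+ 2.
have gpx : coord o0 (val (g p)) != 0 by rewrite right_coord0E.
have [gs0 gs1] := germ_parts F gpx; have [gt0 gt1] := germ_parts G gpx.
have gR := germ_zx2E gpx.
have gD : germ (g p) D by rewrite /D; germs lC.
have DE t : coord o0 (val t) != 0 ->
    D (g t) = eval3 G 1 (slope t) (zx t) ^+ 2.
  move=> tx; have [eU eR] := right_chart_values tx.
  rewrite /D /t0 /t1 eU eR even_odd_parts (sqrD char2).
  by move: (zx t) => z; ring.
have Dp : D (g p) != 0.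
  rewrite DE // expf_neq0 //.
  by rewrite -(proj_eval_eq0 (curve_coords px) hG).
exists p, (fun q => (s0 q * t0 q + zx2E q * s1 q * t1 q) * (D q)^-1).
exists (fun q => (s0 q * t1 q + s1 q * t0 q) * (D q)^-1); split=> //.
- by apply: germ_div => //; germs lC.
- by apply: germ_div => //; germs lC.
apply: nearbyS (nearbyI tQ hE (nearbyI tQ (nearby_open (coord_open Q o0) px)
  (nearby_open (form_open Q hG) Gp))) => t [/= -> [tx Gt]].
have hc := curve_coords tx.
rewrite (proj_eval_ratio hc hF hG) DE // -/(slope t) -/(zx t).
have Gt' : eval3 G 1 (slope t) (zx t) != 0 by rewrite -(proj_eval_eq0 hc hG).
have [eU eR] := right_chart_values tx.
rewrite /s0 /s1 /t0 /t1 eU eR; move: Gt'; rewrite !even_odd_parts.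
move: (zx t) => z; move: (even_part F _ _) (odd_part F _ _) => f0 f1.
by move: (even_part G _ _) (odd_part G _ _) => g0 g1 Gt'; field.
Qed.

(** Write h0 = F0/G0 and h1 = F1/G1.  A relation h0 + h1 z/x = 0 gives, after
    squaring, P^2 x^2 = R^2 (c z x + b y^2 + ab x^2) on the cubic with
    P = F0 G1 and R = F1 G0, that is, a square equal to c x R^2; so R = 0. *)
Lemma right_independent (h0 h1 : plane_curve E -> k) : rational h0 -> rational h1 ->
  Defs.gen_eq (fun p => h0 (g p) + h1 (g p) * zx p) (fun=> 0) ->
  Defs.gen_eq h0 (fun=> 0) /\ Defs.gen_eq h1 (fun=> 0).
Proof.
have [lC _] := gC; have tC := lr_top lC; have [lQ _] := gQ; have tQ := lr_top lQ.
move=> /(rationalP _ gC) [q0 /(germ_spreads tC) [V0 [oV0 Vq0 gh0]]].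
move=> /(rationalP _ gC) [q0' /(germ_spreads tC) [V1 [oV1 Vq1 gh1]]].
move=> [W [oW W0 hW]].
have [q1 [Vq Vq']] : exists q : plane_curve E, V0 q /\ V1 q.
  by apply: (irreducible_meets irrE oV0 oV1); [exists q0|exists q0'].
have [d0 [F0 [G0 [hF0 hG0 G0q h0E]]]] := germ_curve (gh0 _ Vq).
have [d1 [F1 [G1 [hF1 hG1 G1q h1E]]]] := germ_curve (gh1 _ Vq').
have [N [oN Nq hN]] := nearbyI tC (nearbyI tC h0E h1E)
  (nearbyI tC (nearby_open (form_open E hG0) G0q) (nearby_open (form_open E hG1) G1q)).
have meets (O : set (plane_curve E)) : is_open O -> O !=set0 ->
    exists p, [/\ W p, N (g p), O (g p) & coord o0 (val p) != 0].
  move=> oO [q Oq].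
  have pre (O' : set (plane_curve E)) : is_open O' -> is_open (g @^-1` O').
    by move=> oO'; case: (mg oO').
  have pre0 (O' : set (plane_curve E)) q' : O' q' -> (g @^-1` O') !=set0.
    by move=> Oq'; have [p pE] := g_surj q'; exists p; rewrite /= pE.
  have [p1 m1] := irreducible_meets irrQ oW (pre _ oN) W0 (pre0 _ _ Nq).
  have [p2 m2] := irreducible_meets irrQ (pre _ oO) (coord_open Q o0) (pre0 _ _ Oq) affine_point_Q.
  have [p [[Wp Np] [Op px]]] := irreducible_meets irrQ
    (open_setI tQ oW (pre _ oN)) (open_setI tQ (pre _ oO) (coord_open Q o0))
    (ex_intro _ p1 m1) (ex_intro _ p2 m2).
  by exists p.
pose P := F0 * G1; pose R := F1 * G0.
have hP : P \is (d0 + d1).-homog by exact: dhomogM.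
have hR : R \is (d0 + d1).-homog by rewrite addnC; exact: dhomogM.
pose K : {mpoly k[3]} := c *: ('X_o2 * 'X_o0) + b *: 'X_o1 ^+ 2 + (a * b) *: 'X_o0 ^+ 2.
have hK : K \is 2.-homog.
  apply: dhomogD; last by apply: dhomogZ; apply: homX2.
  apply: dhomogD; last by apply: dhomogZ; apply: homX2.
  by apply: dhomogZ; apply: (dhomogM (d := 1) (e := 1)); apply: homX.
pose T : {mpoly k[3]} := P ^+ 2 * 'X_o0 ^+ 2 + R ^+ 2 * K.
have hT : T \is ((d0 + d1) * 2 + 2).-homog.
  apply: dhomogD; apply: dhomogM => //; try exact: dhomogMn.
  exact: homX2.
have KE q : proj_eval K q = c * (coord o2 q * coord o0 q) +
    b * coord o1 q ^+ 2 + a * b * coord o0 q ^+ 2.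
  by rewrite /K /proj_eval !(mevalD, mevalZ, mevalM) !mevalXU.
have TE q : proj_eval T q = proj_eval P q ^+ 2 * coord o0 q ^+ 2 +
    proj_eval R q ^+ 2 * proj_eval K q.
  by rewrite /T /proj_eval !(mevalD, mevalM) !mevalXU.
(* On the open set where the relation holds it gives P^2 x^2 = R^2 K; a form
   that vanishes on a non-empty open set vanishes on the whole cubic. *)
have T0 q : proj_eval E q = 0 -> proj_eval T q = 0.
  move=> cq; apply: contrapT => /eqP Tq.
  have O0 : [set q : plane_curve E | proj_eval T (val q) != 0] !=set0.
    by exists (curve_point cq).
  have [p [Wp Np /= Tp px]] := meets _ (form_open E hT) O0.
  have [[/= e0 e1] [G0p G1p]] := hN _ Np.
  have gpx : coord o0 (val (g p)) != 0 by rewrite right_coord0E.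
  have [_ zE] := right_chart_values px.
  have rel : proj_eval P (val (g p)) = proj_eval R (val (g p)) * zx p.
    have := hW _ Wp; rewrite e0 e1 !proj_evalM.
    move: (zx p) => z; move: G0p G1p.
    move: (proj_eval G0 _) (proj_eval G1 _) (proj_eval F0 _) (proj_eval F1 _).
    move=> g0 g1 f0 f1 g00 g10 h; apply/eqP; rewrite -(add_eq0 char2); apply/eqP.
    transitivity (g0 * g1 * (f0 / g0 + f1 / g1 * z)); last by rewrite h mulr0.
    by field; rewrite g00 g10.
  have RK : proj_eval K (val (g p)) = zx2E (g p) * coord o0 (val (g p)) ^+ 2.
    by rewrite KE /zx2E /slopeE; move: gpx; move: (coord o0 _) => x x0; field.
  by move: Tp; rewrite TE RK rel zE exprMn -mulrA addxx // eqxx.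
have [RA RB] : redA a (c * e) (d0 + d1) R = 0 /\ redB a (c * e) (d0 + d1) R = 0.
  apply: (@cubic_square_class _ char2 a (c * e) c (root2 b) (root2 (a * b))
     (redA a (c * e) (d0 + d1) P) (redB a (c * e) (d0 + d1) P)) => // x y x0 cxy.
  have ce : y ^+ 2 + x * y = ('X^3 + a *: 'X^2 + (c * e) *: 'X).[x].
    by apply/eqP; rewrite -cubic_chart cxy.
  rewrite -(redE hP ce) -(redE hR ce) (sqrD char2) !exprMn (sqrD char2) !exprMn !root2K.
  have v0 : vec3 x y 1 != 0 by rewrite vec3_eq0 oner_eq0 !andbF.
  have hq := pointP v0.
  have cq : proj_eval E (point x y 1) = 0.
    by apply/eqP; rewrite (proj_eval_eq0 hq (cubic_homog _ _)) cxy.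
  have /eqP := T0 _ cq; rewrite (proj_eval_eq0 hq hT).
  have -> : eval3 T x y 1 = eval3 P x y 1 ^+ 2 * x ^+ 2 + eval3 R x y 1 ^+ 2 *
      (c * x + b * y ^+ 2 + a * b * x ^+ 2).
    rewrite /eval3 /T /K !(mevalD, mevalZ, mevalM) !mevalXU !vec3E mul1r.
    by [].
  move: (eval3 P x y 1) (eval3 R x y 1) => p r /eqP h.
  apply/eqP; rewrite -(add_eq0 char2); apply/eqP; rewrite -h; ring.
have R0 q : proj_eval E q = 0 -> proj_eval R q = 0.
  move=> cq; apply: contrapT => /eqP Rq.
  by have := red_neq0 hR cq Rq; rewrite RA RB eqxx.
have F10 q : proj_eval E q = 0 -> proj_eval F1 q = 0.
  move=> cq; apply: contrapT => /eqP Fq.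
  have [q' [cq' Fq' Gq' _]] := common_nonzero hF1 hG0 cq (on_curve q1) Fq G0q.
  have := R0 q' cq'; rewrite proj_evalM => /eqP.
  by rewrite mulf_eq0 (negPf Fq') (negPf Gq').
have h1N q : N q -> h1 q = 0.
  by move=> /hN [[/= _ ->] _]; rewrite F10 ?mul0r //; apply: on_curve.
split; last by exists N; split=> //; exists q1.
have F00 q : proj_eval E q = 0 -> proj_eval F0 q = 0.
  move=> cq; apply: contrapT => /eqP Fq.
  have O0 : [set q : plane_curve E | proj_eval F0 (val q) != 0] !=set0.
    by exists (curve_point cq).
  have [p [Wp Np /= Fp _]] := meets _ (form_open E hF0) O0.
  have [[/= e0 _] [G0p _]] := hN _ Np.
  have := hW _ Wp; rewrite (h1N _ Np) mul0r addr0 e0 => /eqP.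
  by rewrite mulf_eq0 invr_eq0 (negPf Fp) (negPf G0p).
exists N; split=> //; first by exists q1.
by move=> q /hN [[/= -> _] _]; rewrite F00 ?mul0r //; apply: on_curve.
Qed.

Lemma right_has_degree : has_degree g 2.
Proof.
have [p0 p0x] := affine_point_Q; have [lQ _] := gQ.
have [lC _] := gC; have tQ := lr_top lQ.
pose u (i : 'I_2) (p : plane_curve Q) : k := if val i == 0%N then 1 else zx p.
have sumE (h : 'I_2 -> plane_curve E -> k) p :
    \sum_(i < 2) h i (g p) * u i p = h ord0 (g p) + h ord_max (g p) * zx p.
  rewrite big_ord_recl big_ord1 /u /= mulr1; congr (_ + h _ _ * _).
  exact: val_inj.
exists u; split.
- move=> i; apply/(rationalP _ gQ); exists p0; rewrite /u.
  by case: (val i == 0%N); [exact: germ_cst|exact: germ_zx].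
- move=> h /right_span [p [h0 [h1 [px g0 g1 hE]]]].
  exists (fun i : 'I_2 => if val i == 0%N then h0 else h1).
    move=> i; apply/(rationalP _ gC); exists (g p).
    by case: (val i == 0%N).
  have [V [oV Vp hV]] := hE; exists V; split=> //; first by exists p.
  by move=> t /hV /= ->; rewrite (sumE (fun i => if val i == 0%N then h0 else h1)).
- move=> h rh [V [oV V0 hV]] i.
  have [|e0 e1] := right_independent (rh ord0) (rh ord_max).
    by exists V; split=> // p /hV; rewrite sumE.
  case: i => -[|[|//]] hi.
    by rewrite (_ : Ordinal hi = ord0) //; apply: val_inj.
  by rewrite (_ : Ordinal hi = ord_max) //; apply: val_inj.
Qed.

(** The square of h0 + h1 z/x is a function on the cubic. *)
Lemma right_purely_inseparable : purely_inseparable g.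
Proof.
have [lC _] := gC; split=> //.
  move=> V oV [q Vq]; have [p pE] := g_surj q; exists p.
  by rewrite /= pE.
move=> h /right_span [p [h0 [h1 [px g0 g1 [V [oV Vp hV]]]]]]; exists 1%N.
have gR : germ (g p) zx2E by apply: germ_zx2E; rewrite right_coord0E.
exists (fun q => h0 q ^+ 2 + zx2E q * h1 q ^+ 2).
  by apply/(rationalP _ gC); exists (g p); germs lC.
have [lQ _] := gQ; have tQ := lr_top lQ.
exists (V `&` [set t | coord o0 (val t) != 0]); split.
- by apply: (open_setI tQ) => //; exact: coord_open.
- by exists p.
- move=> t [/hV /= -> tx]; have [_ zE] := right_chart_values tx.
  by rewrite expn1 (sqrD char2) exprMn zE [zx t ^+ 2 * _]mulrC.
Qed.

End RightFibre.

(** * Assembling the diagram *)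

Section Smooth.
Variable k : closedFieldType.
Hypothesis char2 : 2%N \in [pchar k].

Lemma mderivU (i j : 'I_3) : ('X_j : {mpoly k[3]})^`M(i) = (i == j)%:R.
Proof.
rewrite mderivX mnm1E eq_sym; case: eqVneq => [->|_]; last by rewrite scale0r.
rewrite scale1r -(mpolyX0 3 k); congr ('X_[_]).
by apply/mnmP => l; rewrite mnmBE subnn mnm0E.
Qed.

Lemma eval3_cubic_deriv (a eta x y z : k) :
  [/\ eval3 ((cubic a eta)^`M(o0)) x y z = y * z + x ^+ 2 + eta * z ^+ 2,
      eval3 ((cubic a eta)^`M(o1)) x y z = x * z &
      eval3 ((cubic a eta)^`M(o2)) x y z = y ^+ 2 + x * y + a * x ^+ 2].
Proof.
have E i : eval3 ((cubic a eta)^`M(i)) x y z =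
  (i == o1)%:R * y * z + (i == o1)%:R * y * z + (i == o2)%:R * y ^+ 2 +
  ((i == o0)%:R * y * z + x * (i == o1)%:R * z + x * y * (i == o2)%:R) -
  ((i == o0)%:R * x ^+ 2 *+ 3 + a * ((i == o0)%:R * x * z *+ 2 + x ^+ 2 * (i == o2)%:R) +
   eta * ((i == o0)%:R * z ^+ 2 + x * z * (i == o2)%:R *+ 2)).
  rewrite /eval3 /cubic !exprS !expr0 !mulr1.
  rewrite !(mderivB, mderivD, mderivM, mderivZ) !mderivU.
  rewrite !(mevalB, mevalD, mevalM, mevalZ) !mevalXU !vec3E.
  rewrite !(rmorph_nat (meval _)); ring.
rewrite !E /=; split.
- apply: (@eq_mod2 _ char2 _ _ (- (2%:R * x ^+ 2) - a * x * z - eta * z ^+ 2)); ring.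
- by apply: (@eq_mod2 _ char2 _ _ (y * z)); ring.
- by apply: (@eq_mod2 _ char2 _ _ (- (a * x ^+ 2) - eta * x * z)); ring.
Qed.

Lemma cubic_elliptic (a eta : k) : eta != 0 -> elliptic_cubic (cubic a eta).
Proof.
move=> eta0; split=> [|p cp]; first exact: cubic_homog.
apply: contrapT => sing; have hp := coordP p.
have d0 i : proj_eval ((cubic a eta)^`M(i)) p = 0.
  by apply: contrapT => /eqP di; apply: sing; exists i.
have [] := eval3_cubic_deriv a eta (coord o0 p) (coord o1 p) (coord o2 p).
have pE i : eval3 ((cubic a eta)^`M(i)) (coord o0 p) (coord o1 p) (coord o2 p) = 0.
  rewrite -[RHS](d0 i); apply: meval_eq => j.
  by case: (ord3P j) => ->; rewrite vec3E.
rewrite !pE; have [+ _] := hp; rewrite vec3_eq0.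
move: (coord o0 p) (coord o1 p) (coord o2 p) => x y z n0 e0 /esym/eqP.
rewrite mulf_eq0 => /orP[] /eqP h; rewrite h in e0 n0 *.
  move=> /esym/eqP; rewrite expr0n /= mul0r mulr0 !addr0 sqrf_eq0 => /eqP y0.
  move/esym/eqP: e0; rewrite y0 expr0n /= mul0r !add0r mulf_eq0 (negPf eta0).
  by rewrite sqrf_eq0 => /eqP z0; rewrite y0 z0 !eqxx in n0.
move/esym/eqP: e0; rewrite expr0n /= !mulr0 add0r addr0 sqrf_eq0 => /eqP x0.
rewrite x0 mul0r expr0n /= mulr0 !addr0 => /esym/eqP; rewrite sqrf_eq0 => /eqP y0.
by rewrite x0 y0 !eqxx in n0.
Qed.

End Smooth.

Section Diagram.
Variable k : closedFieldType.
Hypothesis char2 : 2%N \in [pchar k].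
Variables (Y Y' : fspace k) (phi : Y' -> Y).
Hypotheses (gY : ringed Y) (gY' : ringed Y').
Hypothesis irrY' : irreducible Y'.
Hypothesis phi_frob : is_frobenius phi.
Variables a b c e : Y -> k.
Hypotheses (ga : forall y, germ y a) (gb : forall y, germ y b).
Hypotheses (gc : forall y, germ y c) (ge : forall y, germ y e).
Hypothesis c0 : forall y, c y != 0.

Local Notation T1 := (total_space (covering_cubic phi a c e)).
Local Notation T2 := (total_space (quartic_family a b c e)).
Local Notation T3 := (total_space (cubic_family a c e)).
Local Notation left_map := (@left_total k char2 Y Y' phi a b c e).
Local Notation right_map := (@right_total k char2 Y a b c e c0).

Let phi_surj y : exists x, phi x = y.
Proof. by have [f _ fK] := frobenius_bijective phi_frob; exists (f y). Qed.

Lemma covering_fibration : plane_fibration 3 (covering_cubic phi a c e).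
Proof.
have gr f : (forall y, germ y f) -> forall y, germ y (fun t => root2 (f (phi t))).
  by move=> gf y; apply: (germ_root char2 gY phi_frob).
apply: (cubic_family_fibration gY' irrY') => y; first exact: gr.
by apply: germM; [exact: (proj1 gY')|exact: gr|exact: gr].
Qed.

Lemma covering_elliptic : (exists y, e y != 0) ->
  elliptic_fibration (covering_cubic phi a c e).
Proof.
move=> [y1 e1]; split; first exact: covering_fibration.
have [lY' _] := gY'.
exists [set y | root2 (e (phi y)) != 0]; split.
- apply/(openP (lr_top lY')) => y ey; apply: (germ_neq0 lY') ey.
  exact: (germ_root char2 gY phi_frob).
- by have [y yE] := phi_surj y1; exists y; rewrite /= root2_eq0 yE.
- move=> y ey; apply: (cubic_elliptic char2); rewrite mulf_neq0 //.
  by rewrite root2_eq0.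
Qed.

Lemma quartic_fibration : plane_fibration 4 (quartic_family a b c e).
Proof.
split.
- move=> y; split; last exact: quartic_homog.
  have n0 : vec3 1 0 (root2 (a y * b y)) != 0 by rewrite vec3_eq0 oner_eq0.
  have E := eval3_quartic (a y) (b y) (c y) (e y) 1 0 (root2 (a y * b y)).
  rewrite /= root2K !(expr0n, expr1n, mulr0, mulr1, addr0) addxx // mul0r addr0 in E.
  by apply: contraNneq (c0 y) => h; rewrite -E -/(quartic_family a b c e y) h /eval3 meval0.
- apply: (total_closed gY (d := 4)); first by move=> y; apply: quartic_homog.
  have [lT _] := total_prod_ringed gY => w s0 s1 s2 g0 g1 g2.
  have pull f : (forall y, germ y f) -> germ w (fun u => f u.2).
    by move=> gf; exact: (proj2 (snd_local_morphism (proj_space_ringed k 2) gY w) _ (gf _)).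
  have [gA gB gC gE] := And4 (pull _ ga) (pull _ gb) (pull _ gc) (pull _ ge).
  apply: (germ_ext (fun u => eval3_quartic _ _ _ _ _ _ _)) => /=.
  by germs lT.
(* The total space is the image of the irreducible family of cubics. *)
- apply: (irreducible_image (f := left_map)).
  + move=> V oV.
    by case: (left_total_morphism char2 gY gY' phi_frob ga gb gc ge c0 oV).
  + exact: left_total_surj.
  + by case: covering_fibration.
- exact: proj_base_morphism.
- move=> y; have n0 : vec3 0 1 (root2 (b y)) != 0 by rewrite vec3_eq0 oner_eq0 andbF.
  have cp : proj_eval (quartic_family a b c e y) (point 0 1 (root2 (b y))) = 0.
    apply/eqP; rewrite (proj_eval_eq0 (pointP n0) (quartic_homog _ _ _ _)).
    rewrite eval3_quartic /=; have := infinity_wform char2 (a y) (b y).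
    by rewrite /wform => ->; rewrite expr0n mulr0 mul0r addr0.
  by exists (total_point cp).
Qed.

Lemma base_irreducible : irreducible Y.
Proof.
apply: (irreducible_image (f := phi)) irrY' => //.
by move=> V oV; case: (frobenius_morphism char2 gY' gY phi_frob oV).
Qed.

Lemma cubic_fibration : plane_fibration 3 (cubic_family a c e).
Proof.
apply: (cubic_family_fibration gY base_irreducible) => // y.
by apply: germM; first exact: (proj1 gY).
Qed.

Lemma left_fibre (y : Y') (C : {mpoly k[3]}) : C = covering_cubic phi a c e y ->
  exists g : plane_curve C -> plane_curve (quartic_family a b c e (phi y)),
    [/\ induces_on_fibres left_map y (phi y) g, morphism g, bijective g & birational g].
Proof.
move=> ->; pose D := quartic_family a b c e (phi y).
pose f := left_point (root2 (a (phi y))) (root2 (b (phi y))) (root2 (c (phi y)))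
  (root2 (e (phi y))).
have C0 : root2 (c (phi y)) != 0 by rewrite root2_eq0.
have fD p : proj_eval (covering_cubic phi a c e y) p = 0 -> proj_eval D (f p) = 0.
  by move=> cp; have := left_on_quartic char2 (root2 (b (phi y))) cp; rewrite !root2K.
pose g (p : plane_curve (covering_cubic phi a c e y)) : plane_curve D :=
  curve_point (fD _ (on_curve p)).
have mg : morphism g.
  apply: (@fibre_morphism _ _ _ _ _ left_map y D g gY' gY) => //.
  exact: (left_total_morphism char2 gY gY' phi_frob ga gb gc ge c0).
have bg : bijective g.
  apply: injective_surjective_bijective => [p q epq|q].
    apply: val_inj; apply: (left_inj char2 C0 (on_curve p) (on_curve q)).
    exact: (congr1 val epq).
  have [p cp pE] : exists2 p, proj_eval (covering_cubic phi a c e y) p = 0 & f p = val q.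
    by apply: left_surj => //; rewrite !root2K; exact: on_curve.
  by exists (curve_point cp); apply: val_inj.
exists g; split=> //.
  by move=> p; exists (total_point (on_curve p)).
exact: (left_birational char2 C0 (g := g)).
Qed.

Lemma right_fibre (y : Y) :
  exists g : plane_curve (quartic_family a b c e y) -> plane_curve (cubic_family a c e y),
    [/\ induces_on_fibres right_map y y g, morphism g, bijective g,
        purely_inseparable g & has_degree g 2].
Proof.
have irrQ : irreducible (plane_curve (quartic_family a b c e y)).
  have [y' <-] := phi_surj y.
  by have [g [_ _ _ [_ + _ _]]] := left_fibre (erefl (covering_cubic phi a c e y')).
pose f := right_point (a y) (b y) (c y).
have fE p : proj_eval (quartic_family a b c e y) p = 0 ->
    proj_eval (cubic_family a c e y) (f p) = 0.
  exact: right_on_cubic.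
pose g (p : plane_curve (quartic_family a b c e y)) : plane_curve (cubic_family a c e y) :=
  curve_point (fE _ (on_curve p)).
have mg : morphism g.
  apply: (@fibre_morphism _ _ _ _ _ right_map y _ g gY gY) => //.
  exact: (right_total_morphism char2 gY ga gb gc ge c0).
have g_surj q : exists p, g p = q.
  have [p cp pE] := right_surj char2 (b y) (c0 y) (on_curve q).
  by exists (curve_point cp); apply: val_inj.
have bg : bijective g.
  apply: injective_surjective_bijective => // p q epq.
  apply: val_inj; apply: (right_inj char2 (c0 y) (on_curve p) (on_curve q)).
  exact: (congr1 val epq).
exists g; split=> //.
- by move=> p; exists (total_point (on_curve p)).
- exact: (right_purely_inseparable char2 (c0 y) mg).
- exact: (right_has_degree char2 (c0 y) mg).
Qed.

Lemma left_formula (w : T1) x y z : has_coords (proj_plane w) x y z ->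
  let r (f : Y -> k) := root2 (f (phi (proj_base w))) in
  (~ has_coords (proj_plane w) 0 0 1 ->
     has_coords (proj_plane (left_map w)) (x ^+ 2) (y ^+ 2)
       (r b * y ^+ 2 + r a * r b * x ^+ 2 + r c * x * z)) /\
  (has_coords (proj_plane w) 0 0 1 ->
     has_coords (proj_plane (left_map w)) 0 (r e) (1 + r b * r e)).
Proof.
move=> hw r; split=> [n0|h0]; last exact: left_origin.
apply: left_generic => //; apply/negP => /andP[/eqP x0 /eqP y0]; apply: n0.
have z0 : z != 0 by have := has_coords_neq0 hw; rewrite vec3_eq0 x0 y0 !eqxx.
by have := has_coordsZ (invr_neq0 z0) hw; rewrite x0 y0 !mulr0 mulVf.
Qed.

Lemma right_formula (t : T2) x y z : has_coords (proj_plane t) x y z ->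
  let P := proj_base t in
  (~ has_coords (proj_plane t) 0 1 (root2 (b P)) ->
     has_coords (proj_plane (right_map t)) (c P * x ^+ 2) (c P * x * y)
       (z ^+ 2 + b P * y ^+ 2 + a P * b P * x ^+ 2)) /\
  (has_coords (proj_plane t) 0 1 (root2 (b P)) ->
     has_coords (proj_plane (right_map t)) 0 1 0).
Proof.
move=> ht P; split=> [n0|h0]; last exact: right_infinity.
apply: right_generic => //; apply/negP => /andP[/eqP x0 /eqP w0]; apply: n0.
have zE : z = root2 (b P) * y.
  apply/eqP; rewrite -(add_eq0 char2) -sqrf_eq0 (sqrD char2) exprMn root2K -w0.
  by rewrite /wform x0 expr0n /= mulr0 addr0.
have y0 : y != 0.
  apply: contraNneq (has_coords_neq0 ht) => y0.
  by rewrite vec3_eq0 zE x0 y0 mulr0 eqxx.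
have := has_coordsZ (invr_neq0 y0) ht; rewrite zE x0 mulr0 mulVf //.
by rewrite mulrCA mulVf // mulr1.
Qed.

Lemma composite_formula (w : T1) x y z : has_coords (proj_plane w) x y z ->
  has_coords (proj_plane (right_map (left_map w))) (x ^+ 2) (y ^+ 2) (z ^+ 2).
Proof. by move=> hw; apply: (right_left char2 (b _) (c0 _) hw (total_on_curve w)). Qed.

End Diagram.

(** * The bases *)

Section Bases.
Variable k : closedFieldType.
Hypothesis char2 : 2%N \in [pchar k].

Lemma open_subspace_irreducible (X : fspace k) (S : set X) :
  topology_axioms X -> irreducible X -> is_open S -> S !=set0 ->
  irreducible (subspace S).
Proof.
move=> tX [_ irr] oS [x Sx]; split; first by exists (exist _ x (mem_set Sx)).
move=> _ _ [U oU ->] [V oV ->] [u Uu] [v Vv].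
have [||||y [[Sy Uy] [_ Vy]]] := irr (S `&` U) (S `&` V).
- exact: open_setI.
- exact: open_setI.
- by exists (val u); split=> //; apply: set_valP.
- by exists (val v); split=> //; apply: set_valP.
by exists (exist _ y (mem_set Sy)).
Qed.

Lemma open_subspace_ringed (X : fspace k) (S : set X) :
  local_rings X -> irreducible X -> is_open S -> S !=set0 -> ringed (subspace S).
Proof.
move=> lX irr oS S0; split; first exact: subspace_local_rings.
apply: subspace_sheaf_irreducible => //.
exact: (open_subspace_irreducible (lr_top lX)).
Qed.

Lemma nonzero_open (X : fspace k) f : local_rings X -> (forall x : X, germ x f) ->
  is_open [set x | f x != 0].
Proof.
move=> lX gf; apply/(openP (lr_top lX)) => x fx; exact: germ_neq0 (gf x) fx.
Qed.

(** On points the map is the identity, and in both directions a function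
    corresponds to one whose square is regular. *)
Lemma subspace_frobenius (X : fspace k) (S' : set (frob_push X)) (S : set X)
    (phi : subspace S' -> subspace S) :
  local_rings X -> ringed (subspace S') -> ringed (subspace S) ->
  (forall x, S x -> S' x) -> (forall x, val (phi x) = frob (val x)) ->
  is_frobenius phi.
Proof.
move=> lX gS' gS SS' phiE; have tX := lr_top lX.
have tS' := lr_top (proj1 gS'); have tS := lr_top (proj1 gS).
have tF : topology_axioms (frob_push X) := tX.
have tFS : topology_axioms (frob_push (subspace S)) := tS.
have fS (x : subspace S) : S' (val x) by apply: SS'; apply: (set_valP x).
pose f (x : frob_push (subspace S)) : subspace S' := exist _ (val x) (mem_set (fS x)).
exists phi => //; split.
  apply/(local_morphismP _ gS' tFS) => x.
  apply: (into_frob_subspace char2) => //.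
  apply: local_morphism_eq (val_local_morphism x tF) => //.
  by apply: nearby_all => // y; exact: phiE.
exists f; split.
- apply/(local_morphismP _ (frob_push_ringed char2 gS) tS') => x.
  apply: (into_subspace _ tF) => //.
  exact: (frob_push_functor char2 tS tX (val_local_morphism x tX)).
- by move=> x; apply: val_inj => /=; rewrite phiE.
- by move=> x; apply: val_inj; rewrite phiE.
Qed.

Lemma frobenius_purely_inseparable (X Y : fspace k) (f : X -> Y) :
  ringed X -> ringed Y -> irreducible X -> is_frobenius f -> purely_inseparable f.
Proof.
move=> gX gY irrX Ff; have mf := frobenius_morphism char2 gX gY Ff.
have [h _ hK] := frobenius_bijective Ff; split=> //.
- apply: (irreducible_image (f := f)) irrX => [V oV|y]; first by case: (mf V oV).
  by exists (h y).
- by move=> V oV [y Vy]; exists (h y); rewrite /= hK.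
- by move=> g rg; exists 1%N; apply: frobenius_power.
Qed.

(** The square root of b is a function on the pushforward, and it descends
    only if b is a square in the function field. *)
Lemma frobenius_exponent (X : fspace k) (S' : set (frob_push X)) (S : set X)
    (phi : subspace S' -> subspace S) (b : X -> k) :
  local_rings X -> irreducible X -> is_open S -> S !=set0 ->
  ringed (subspace S') -> (forall x, S x -> S' x) ->
  (forall x, val (phi x) = frob (val x)) ->
  (forall x, germ x b) -> ~ is_square_in_function_field b -> has_exponent phi 1.
Proof.
move=> lX irrX oS S0 gS' SS' phiE gb nsq; have tX := lr_top lX.
have gS := open_subspace_ringed lX irrX oS S0.
have tS := lr_top (proj1 gS).
have Fphi := subspace_frobenius lX gS' gS SS' phiE.
split=> [g rg|[|//] _ descends]; first exact: frobenius_power.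
have tF : topology_axioms (frob_push X) := tX.
have [s0 Ss0] := S0.
pose root_b (x : subspace S') : k := root2 (b (val x)).
have rb : rational root_b.
  apply/(rationalP _ gS'); exists (exist _ s0 (mem_set (SS' _ Ss0))).
  apply: (proj2 (val_local_morphism (_ : subspace S') tF) (fun x : frob_push X => root2 (b x))).
  by apply/(germ_frob char2) => //; apply: germ_ext _ (gb s0) => x; rewrite root2K.
have [h rh [_ [[U oU ->] [u Uu] hU]]] := descends _ rb.
have [P [Uh gh]] : exists P : subspace S, U (val P) /\ germ P h.
  have [P0 /(germ_spreads tS) [V [oV VP gV]]] := proj1 (rationalP _ gS) rh.
  have irrS := open_subspace_irreducible tX irrX oS S0.
  have oU' : @is_open k (subspace S) [set x | U (val x)] by exists U.
  have [||P [UP VP']] := irreducible_meets irrS oU' oV.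
  - by exists (phi u); rewrite /= phiE.
  - by exists P0.
  by exists P; split=> //; apply: gV.
have /(germ_subspace _ _ tX) [g [V [g' [oV VP rg gg']]] /subspace_nearby hg] := gh.
apply: nsq; exists g'; first by exists V; split=> //; exists (val P).
have nS : nearby (val P) S by exists S; split=> //; apply: set_valP.
have nU : nearby (val P) U by exists U; split.
have [N [oN NP hN]] := nearbyI tX (nearbyI tX nS nU) (nearbyI tX hg gg').
exists N; split=> //; first by exists (val P).
move=> y /hN [[Sy Uy] [/= hy <-]].
pose w : subspace S' := exist _ y (mem_set (SS' _ Sy)).
have := hU w Uy; rewrite /root_b /= expn0 expr1 => e.
by rewrite -[LHS]root2K e (hy (phi w)) ?phiE.
Qed.

End Bases.

(** * The cover of the quartic fibration by an elliptic fibration *)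

Theorem theorem3p8 (k : closedFieldType) (char2 : 2%N \in [pchar k])
    (B : fspace k) (varietyB : variety B) (a b c e : B -> k)
    (regular_a : regular [set: B] a) (regular_b : regular [set: B] b)
    (regular_c : regular [set: B] c) (regular_e : regular [set: B] e)
    (c_neq0 : c <> (fun=> 0)) (e_neq0 : e <> (fun=> 0))
    (b_nonsquare : ~ is_square_in_function_field b) :
  let Bc : fspace k := subspace [set P : B | c P != 0] in
  let B' : fspace k := frob_push B in
  let a' : B' -> k := fun P' => root2 (a (frob P')) in
  let b' : B' -> k := fun P' => root2 (b (frob P')) in
  let c' : B' -> k := fun P' => root2 (c (frob P')) in
  let e' : B' -> k := fun P' => root2 (e (frob P')) in
  let B'c' : fspace k := subspace [set P' : B' | c' P' != 0] in
  let E' : B'c' -> {mpoly k[3]} := fun P' =>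
    cubic (a' (val P')) (c' (val P') * e' (val P')) in
  let Q : Bc -> {mpoly k[3]} := fun P =>
    quartic (a (val P)) (b (val P)) (c (val P)) (e (val P)) in
  let E : Bc -> {mpoly k[3]} := fun P =>
    cubic (a (val P)) (c (val P) * e (val P)) in
  [/\ elliptic_fibration E', plane_fibration 4 Q & plane_fibration 3 E] /\
  exists phi : B'c' -> Bc,
  exists left_map : total_space E' -> total_space Q,
  exists right_map : total_space Q -> total_space E,
    (* the bases *)
    [/\ forall P', val (phi P') = frob (val P'),
        is_frobenius phi, bijective phi,
        purely_inseparable phi & has_exponent phi 1] /\
    (* the commutative diagram *)
    [/\ morphism left_map, morphism right_map,
        forall t, exists w, left_map w = t,
        forall w, proj_base (left_map w) = phi (proj_base w) &
        forall t, proj_base (right_map t) = proj_base t] /\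
    (* formula for the left-hand morphism *)
    (forall (w : total_space E') (x y z : k),
       has_coords (val w).1 x y z ->
       let P' := val (proj_base w) in
       let q := (val (left_map w)).1 in
       (~ has_coords (val w).1 0 0 1 ->
          has_coords q (x ^+ 2) (y ^+ 2)
            (b' P' * y ^+ 2 + a' P' * b' P' * x ^+ 2 + c' P' * x * z)) /\
       (has_coords (val w).1 0 0 1 ->
          has_coords q 0 (e' P') (1 + b' P' * e' P'))) /\
    (* the left-hand morphism on the fibres *)
    (forall P' : B'c',
       let P := val (phi P') in
       exists g : plane_curve (cubic (root2 (a P)) (root2 (c P * e P))) ->
                  plane_curve (quartic (a P) (b P) (c P) (e P)),
         [/\ induces_on_fibres left_map P' (phi P') g, morphism g,
             bijective g & birational g]) /\
    (* formula for the right-hand morphism *)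
    (forall (t : total_space Q) (x y z : k),
       has_coords (val t).1 x y z ->
       let P := val (proj_base t) in
       let q := (val (right_map t)).1 in
       (~ has_coords (val t).1 0 1 (root2 (b P)) ->
          has_coords q (c P * x ^+ 2) (c P * x * y)
            (z ^+ 2 + b P * y ^+ 2 + a P * b P * x ^+ 2)) /\
       (has_coords (val t).1 0 1 (root2 (b P)) -> has_coords q 0 1 0)) /\
    (* the right-hand morphism on the fibres *)
    (forall P : Bc,
       exists g : plane_curve (Q P) -> plane_curve (E P),
         [/\ induces_on_fibres right_map P P g, morphism g,
             bijective g, purely_inseparable g & has_degree g 2]) /\
    (* the composite horizontal morphism *)
    is_frobenius (right_map \o left_map) /\
    (forall (w : total_space E') (x y z : k),
       has_coords (val w).1 x y z ->
       has_coords (val (right_map (left_map w))).1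
         (x ^+ 2) (y ^+ 2) (z ^+ 2)).
Proof.
move=> Bc B' a' b' c' e' B'c' E' Q E.
have lB := variety_local_rings varietyB; have tB := lr_top lB.
have irrB : irreducible B by case: varietyB.
have global f : regular [set: B] f -> forall P : B, germ P f.
  by move=> rf P; apply: (germ_regular tB (open_setT tB) rf).
have [ga gb] := (global _ regular_a, global _ regular_b).
have [gc ge] := (global _ regular_c, global _ regular_e).
have nonzero (f : B -> k) : f <> (fun=> 0) -> exists P, f P != 0.
  move=> f0; apply: contrapT => h; apply: f0; apply/funext => P.
  by apply: contrapT => /eqP fP; apply: h; exists P.
have [Pc cPc] := nonzero c c_neq0; have [Pe ePe] := nonzero e e_neq0.
pose Sc : set B := [set P | c P != 0].
have oSc : is_open Sc by apply: nonzero_open.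
have Sc0 : Sc !=set0 by exists Pc.
have lB' := frob_push_local_rings char2 lB : local_rings B'.
pose Sc' : set B' := [set P' | c' P' != 0].
have c'E P : (c' P != 0) = (c P != 0) by rewrite /c' root2_eq0.
have Sc'E : Sc' = Sc by apply/funext => P; rewrite /Sc' /Sc /= c'E.
have oSc' : is_open Sc' by rewrite Sc'E.
have Sc'0 : Sc' !=set0 by rewrite Sc'E.
have gBc : ringed Bc by apply: open_subspace_ringed.
have gB'c' : ringed B'c' by apply: (open_subspace_ringed lB' irrB).
have irr' : irreducible B'c' by apply: (open_subspace_irreducible (lr_top lB') irrB).
have phiS (P' : B'c') : c (val P') != 0 by rewrite -c'E; exact: (set_valP P').
pose phi (P' : B'c') : Bc := exist _ (val P') (mem_set (phiS P' : Sc (val P'))).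
have phi_frob : is_frobenius phi.
  apply: (subspace_frobenius char2 lB gB'c' gBc) => // P cP.
  by rewrite /= c'E.
have pull f : (forall P : B, germ P f) -> forall P : Bc, germ P (fun P => f (val P)).
  by move=> gf P; apply: (proj2 (val_local_morphism P tB) f).
have [gca gcb] := (pull _ ga, pull _ gb); have [gcc gce] := (pull _ gc, pull _ ge).
pose aB (P : Bc) := a (val P); pose bB (P : Bc) := b (val P).
pose cB (P : Bc) := c (val P); pose eB (P : Bc) := e (val P).
have c0 (P : Bc) : cB P != 0 by exact: (set_valP P).
have e0 : exists P : Bc, e (val P) != 0.
  have [P [cP eP]] : exists P, Sc P /\ e P != 0.
    by apply: (irreducible_meets irrB oSc (nonzero_open lB ge)) => //; exists Pe.
  by exists (exist _ P (mem_set cP)).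
have SS' (P : B) : Sc P -> Sc' P by rewrite Sc'E.
split; first split.
- exact: (covering_elliptic char2 gBc gB'c' irr' phi_frob gca gcc gce c0 e0).
- exact: (quartic_fibration char2 gBc gB'c' irr' phi_frob gca gcb gcc gce c0).
- exact: (cubic_fibration char2 gBc gB'c' irr' phi_frob gca gcc gce).
exists phi, (@left_total k char2 Bc B'c' phi aB bB cB eB).
exists (@right_total k char2 Bc aB bB cB eB c0).
split; first split=> //.
- exact: frobenius_bijective.
- exact: frobenius_purely_inseparable.
- exact: (frobenius_exponent char2 lB irrB oSc Sc0 gB'c' SS' _ gb b_nonsquare).
split; first split=> //.
- exact: (left_total_morphism char2 gBc gB'c' phi_frob gca gcb gcc gce c0).
- exact: (right_total_morphism char2 gBc gca gcb gcc gce c0).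
- exact: (@left_total_surj k char2 Bc B'c' phi phi_frob aB bB cB eB c0).
split; first exact: (@left_formula k char2 Bc B'c' phi aB bB cB eB).
split.
  move=> P' P.
  apply: (left_fibre char2 gBc gB'c' phi_frob gca gcb gcc gce c0 (y := P')).
  by rewrite /covering_cubic (root2M char2).
split; first exact: (@right_formula k char2 Bc aB bB cB eB c0).
split.
  exact: (right_fibre char2 gBc gB'c' phi_frob gca gcb gcc gce c0).
split; first exact: (right_left_frobenius char2 gBc gB'c' phi_frob aB bB eB c0).
exact: (@composite_formula k char2 Bc B'c' phi aB bB cB eB c0).
Qed.
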